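(* Consider the linear SPDE $du=\mathcal L u\,dt+\mathcal G R\circ dW(t)$ on $[0,T]\times\mathbb T^d$ with initial datum $u_0$, where $\mathcal L=\sum_{|\alpha|\le p_1}a_\alpha\partial_x^\alpha$ and $\mathcal G=\sum_{|\beta|\le p_2}b_\beta\partial_x^\beta$ have constant real coefficients, in either the additive noise case ($R$ a given real-valued function) or the multiplicative noise case ($R=u$). Let the drift coefficients $a_\alpha\in\mathbb R$, $|\alpha|\le p_1$, be given. Let $\mathcal Q_1=\{\xi\in\mathbb Z^d:\widehat R(\xi)\ne0\}$ in the additive noise case and $\mathcal Q_1=\{\xi\in\mathbb Z^d:\mathbb E\,\widehat u_0(\xi)\neq0\}$ in the multiplicative noise case. Assume that $|\mathcal Q_1|$ is sufficiently large (i.e. $|\mathcal Q_1|\ge N_0$ for a suitable number $N_0=N_0(d,p_2)$) and that $\mathcal Q_1$ is not located on an algebraic polynomial hypersurface of degree $\le 2p_2$ (i.e. no nonzero real polynomial of degree $\le 2p_2$ vanishes identically on $\mathcal Q_1$). Then the parameters $b_\beta$, $|\beta|\le p_2$, are uniquely determined, up to an equivalence class, by the two instants $u(t_1,\cdot)$, $u(t_2,\cdot)$ with $|t_2-t_1|>0$ sufficiently small. Precisely: for any two real coefficient vectors $b=(b_\beta)_{|\beta|\le p_2}$, $b'=(b'_\beta)_{|\beta|\le p_2}$ there is $\delta>0$ such that, if $u,u'$ are the solutions with diffusion coefficients $b,b'$ (same $a_\alpha$, same $u_0$, and same $R$ in the additive case), and if for some $t_1,t_2\in[0,T]$ with $0<|t_2-t_1|<\delta$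 the means and covariances of $(\widehat u(t_1,\xi),\widehat u(t_2,\xi))$ and of $(\widehat u'(t_1,\xi),\widehat u'(t_2,\xi))$ coincide for every $\xi\in\mathcal Q_1$, then $b$ and $b'$ are equivalent.
   Context: $\mathbb T^d$ is the $d$-dimensional torus of side $2\pi$, $\mathbf i^2=-1$, and $\widehat f(\xi)=(2\pi)^{-d/2}\int_{\mathbb T^d}e^{-\mathbf i\xi\cdot x}f(x)\,dx$ for $\xi\in\mathbb Z^d$. $W$ is a real-valued standard Brownian motion (depending on time only) on a complete filtered probability space $(\Omega,\mathcal F,(\mathcal F_t)_{t\ge0},\mathbb P)$; $\circ\, dW$ denotes the Stratonovich integral; $u_0$ is $\mathcal F_0$-measurable. $\alpha,\beta\in\mathbb N^d$ are multi-indices and $p_1,p_2\in\mathbb N$. It is a standing assumption that the strong solution exists uniquely on $[0,T]$, and that the means and covariances mentioned are finite. In Fourier variables the equation reads, for each $\xi\in\mathbb Z^d$, $$d\widehat u(t,\xi)=\sum_{|\alpha|\le p_1}a_\alpha(\mathbf i\xi)^\alpha\,\widehat u(t,\xi)\,dt+\sum_{|\beta|\le p_2}b_\beta(\mathbf i\xi)^\beta\,\widehat R(\xi)\circ dW(t),$$ with $\widehat R$ replaced by $\widehat u(t,\xi)$ in the multiplicative case. Equivalence of coefficient vectors: $b$ and $b'$ are equivalent if they give the same values of the following quadratic expressions for all multi-indices $\gamma$ with $|\gamma|\le 2p_2$. Multiplicative case: $\displaystyle\sum_{\beta+\widehat\beta=\gamma}\mathbf i^{|\beta|+|\widehat\beta|}\,b_\beta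 b_{\widehat\beta}$. Additive case ($|\gamma|$ even): $\displaystyle\sum_{\beta+\widetilde\beta=\gamma,\ |\beta|,|\widetilde\beta|\text{ even}}\mathbf i^{|\beta+\widetilde\beta|}\,b_\beta b_{\widetilde\beta}+\sum_{\beta+\widetilde\beta=\gamma,\ |\beta|,|\widetilde\beta|\text{ odd}}\mathbf i^{|\beta|-|\widetilde\beta|}\,b_\beta b_{\widetilde\beta}$, i.e. the coefficients of the polynomial $\big|\sum_{|\beta|\le p_2}b_\beta(\mathbf i\xi)^\beta\big|^2$. All sums are over multi-indices of order at most $p_2$. *)

(* Defs.v *)
From HB Require Import structures.
From mathcomp Require Import all_boot all_order all_algebra complex.
From mathcomp Require Import all_classical all_reals all_analysis.
From mathcomp Require mpoly.
(* The notations of multinomials clash with those of mathcomp-analysis.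
   [bmultinom d n] is the finite type of multi-indices beta in N^d with
   |beta| = mdeg beta < n. *)
Import -(notations) mpoly.

Set Implicit Arguments.
Unset Strict Implicit.
Unset Printing Implicit Defensive.

Import Order.TTheory GRing.Theory Num.Theory.
Import numFieldNormedType.Exports.

Local Open Scope classical_set_scope.
Local Open Scope ring_scope.
Local Open Scope complex_scope.

(** * Fourier coefficients on the torus *)

(* The torus is represented by the cube [0, 2 pi]^d.  The integral over the cube
   is the iterated Lebesgue integral; by Tonelli and Fubini it is the integral
   against d-dimensional Lebesgue measure for nonnegative measurable functions
   and for integrable functions. *)
Fixpoint torus_integral (R : realType) (d : nat) :
    (d.-tuple R -> \bar R) -> \bar R :=
  match d with
  | 0 => fun f => f [tuple]
  | d'.+1 => fun f =>
      (\int[lebesgue_measure]_(x in `[0%R, (2 * pi)%R])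
          torus_integral (fun v : d'.-tuple R => f [tuple of x :: v]))%E
  end.

Definition torus_integrable (R : realType) (d : nat) (f : d.-tuple R -> R) :=
  measurable_fun setT f /\
  (torus_integral (fun x => `|f x|%:E) < +oo)%E.

Definition fourier_phase (R : realType) (d : nat) (xi : 'rV[int]_d)
    (x : d.-tuple R) : R :=
  \sum_(j < d) (xi 0 j)%:~R * tnth x j.

(* (2 pi)^(-d/2) times the integral of e^(- i xi.x) f(x), split into real and
   imaginary parts. *)
Definition fourier (R : realType) (d : nat) (f : d.-tuple R -> R)
    (xi : 'rV[int]_d) : R[i] :=
  ((2 * pi) `^ (- (d%:R / 2)))%:C *
  Complex
    (fine (torus_integral (fun x => (cos (fourier_phase xi x) * f x)%:E)))
    (- fine (torus_integral (fun x => (sin (fourier_phase xi x) * f x)%:E))).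

(* The Fourier symbol of sum_(|beta| <= p) c_beta D^beta. *)
Definition symbol (R : realType) (d p : nat) (c : bmultinom d p.+1 -> R)
    (xi : 'rV[int]_d) : R[i] :=
  \sum_(beta : bmultinom d p.+1)
    (c beta)%:C * \prod_(j < d) ('i%C * (xi 0 j)%:~R) ^+ beta j.

(** * Filtrations, Brownian motion and stochastic integrals *)

(* Times are elements of R; only nonnegative ones matter. *)

Definition measurable_wrt (R : realType) (disp : measure_display)
    (Omega : measurableType disp) (G : set (set Omega)) (X : Omega -> R) :=
  forall B : set R, measurable B -> G (X @^-1` B).

Record complete_filtration (R : realType) (disp : measure_display)
    (Omega : measurableType disp) (P : probability Omega R)
    (F : R -> set (set Omega)) : Prop := CompleteFiltration {
  filtration_sigma : forall t : R, 0 <= t -> sigma_algebra setT (F t);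
  filtration_sub : forall t : R, 0 <= t -> F t `<=` measurable;
  filtration_mono : forall s t : R, 0 <= s -> s <= t -> F s `<=` F t;
  filtration_complete : forall N, P.-negligible N -> F 0 N }.

Definition adapted (R : realType) (disp : measure_display)
    (Omega : measurableType disp) (F : R -> set (set Omega)) (T : R)
    (X : R -> Omega -> R) :=
  forall t : R, 0 <= t <= T -> measurable_wrt (F t) (X t).

Definition continuous_paths (R : realType) (disp : measure_display)
    (Omega : measurableType disp) (P : probability Omega R) (T : R)
    (X : R -> Omega -> R) :=
  \forall w \ae P, {within `[0, T], continuous (fun t => X t w)}.

Record brownian_motion (R : realType) (disp : measure_display)
    (Omega : measurableType disp) (P : probability Omega R)
    (F : R -> set (set Omega)) (W : R -> Omega -> R) : Prop :=
    BrownianMotion {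
  brownian0 : \forall w \ae P, W 0 w = 0;
  brownian_adapted : forall t : R, 0 <= t -> measurable_wrt (F t) (W t);
  brownian_continuous : forall T : R, 0 <= T -> continuous_paths P T W;
  brownian_normal : forall s t : R, 0 <= s -> s < t ->
    forall B : set R, measurable B ->
    P ((fun w => W t w - W s w) @^-1` B) = normal_prob 0 (Num.sqrt (t - s)) B;
  brownian_indep : forall s t : R, 0 <= s -> s < t ->
    forall (A : set Omega) (B : set R), F s A -> measurable B ->
    P (A `&` (fun w => W t w - W s w) @^-1` B) =
    (P A * P ((fun w => (W t w - W s w)%R) @^-1` B))%E }.

(* In what follows s lists the points other than 0 of a partition of [0, t],
   as in the library's [itv_partition 0 t s]. *)

Definition mesh (R : realType) (t : R) (s : seq R) : R :=
  \big[Num.max/0]_(0 <= k < size s) (nth t (0 :: s) k.+1 - nth t (0 :: s) k).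

Definition left_sum (R : realType) (Omega : Type) (X W : R -> Omega -> R)
    (t : R) (s : seq R) (w : Omega) : R :=
  let p := nth t (0 :: s) in
  \sum_(0 <= k < size s) X (p k) w * (W (p k.+1) w - W (p k) w).

Definition covariation_sum (R : realType) (Omega : Type)
    (X W : R -> Omega -> R) (t : R) (s : seq R) (w : Omega) : R :=
  let p := nth t (0 :: s) in
  \sum_(0 <= k < size s)
    (X (p k.+1) w - X (p k) w) * (W (p k.+1) w - W (p k) w).

(* Convergence in probability, at each time t in [0, T], of sums along
   partitions of [0, t] as their mesh tends to 0. *)
Definition partition_limit (R : realType) (disp : measure_display)
    (Omega : measurableType disp) (P : probability Omega R) (T : R)
    (S : R -> seq R -> Omega -> R) (Y : R -> Omega -> R) :=
  forall t : R, 0 <= t <= T ->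
  forall eps eta : R, 0 < eps -> 0 < eta ->
  exists2 delta : R, 0 < delta &
    forall s : seq R, itv_partition 0 t s -> mesh t s < delta ->
    (P [set w | (eps <= `|S t s w - Y t w|)%R] <= eta%:E)%E.

(* For an adapted integrand with continuous paths this characterizes the usual
   Ito integral. *)
Definition is_ito_integral (R : realType) (disp : measure_display)
    (Omega : measurableType disp) (P : probability Omega R)
    (F : R -> set (set Omega)) (T : R) (X W I : R -> Omega -> R) :=
  [/\ adapted F T X, continuous_paths P T X, adapted F T I &
      partition_limit P T (left_sum X W) I].

Definition is_covariation (R : realType) (disp : measure_display)
    (Omega : measurableType disp) (P : probability Omega R)
    (F : R -> set (set Omega)) (T : R) (X W C : R -> Omega -> R) :=
  [/\ adapted F T C, continuous_paths P T C,
      \forall w \ae P, bounded_variation 0 T (fun t => C t w) &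
      partition_limit P T (covariation_sum X W) C].

(* int X o dW = int X dW + [X, W] / 2 *)
Definition is_stratonovich_integral (R : realType) (disp : measure_display)
    (Omega : measurableType disp) (P : probability Omega R)
    (F : R -> set (set Omega)) (T : R) (X W J : R -> Omega -> R) :=
  exists I C : R -> Omega -> R,
    [/\ is_ito_integral P F T X W I, is_covariation P F T X W C &
        forall t : R, 0 <= t <= T ->
          \forall w \ae P, J t w = I t w + C t w / 2].

(** * The equation *)

Inductive noise (R : realType) (d : nat) :=
| AdditiveNoise of (d.-tuple R -> R)
| MultiplicativeNoise.

Arguments MultiplicativeNoise {R d}.

Definition noise_integrable (R : realType) (d : nat) (nu : noise R d) : Prop :=
  if nu is AdditiveNoise r then torus_integrable r else True.

Definition noise_integrand (R : realType) (d : nat) (Omega : Type)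
    (nu : noise R d) (xi : 'rV[int]_d) (X : R -> Omega -> R[i]) :
    R -> Omega -> R[i] :=
  if nu is AdditiveNoise r then fun _ _ => fourier r xi else X.

(* dX = A X dt + B G o dW, X(0) = x0, on [0, T] *)
Definition mode_equation (R : realType) (disp : measure_display)
    (Omega : measurableType disp) (P : probability Omega R)
    (F : R -> set (set Omega)) (W : R -> Omega -> R) (T : R) (A B : R[i])
    (x0 : Omega -> R[i]) (G X : R -> Omega -> R[i]) :=
  [/\ adapted F T (fun t w => complex.Re (X t w)) /\
      adapted F T (fun t w => complex.Im (X t w)),
      continuous_paths P T (fun t w => complex.Re (X t w)) /\
      continuous_paths P T (fun t w => complex.Im (X t w)) &
      exists J : R -> Omega -> R[i],
        [/\ is_stratonovich_integral P F T (fun t w => complex.Re (G t w)) W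
              (fun t w => complex.Re (J t w)),
            is_stratonovich_integral P F T (fun t w => complex.Im (G t w)) W
              (fun t w => complex.Im (J t w)) &
            forall t : R, 0 <= t <= T -> \forall w \ae P,
              X t w = x0 w
                + A * Complex
                    (\int[lebesgue_measure]_(s in `[0, t]) complex.Re (X s w))
                    (\int[lebesgue_measure]_(s in `[0, t]) complex.Im (X s w))
                + B * J t w]].

Definition mode_problem (R : realType) (d p1 p2 : nat)
    (disp : measure_display) (Omega : measurableType disp)
    (P : probability Omega R) (F : R -> set (set Omega))
    (W : R -> Omega -> R) (T : R) (nu : noise R d)
    (a : bmultinom d p1.+1 -> R) (b : bmultinom d p2.+1 -> R)
    (u0 : Omega -> d.-tuple R -> R) (xi : 'rV[int]_d)
    (X : R -> Omega -> R[i]) :=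
  mode_equation P F W T (symbol a xi) (symbol b xi)
    (fun w => fourier (u0 w) xi) (noise_integrand nu xi X) X.

(* u is the strong solution.  The last clause is the standing assumption that
   strong solutions are unique: the Fourier modes satisfy decoupled scalar
   equations, and each of these has no other solution. *)
Record strong_solution (R : realType) (d p1 p2 : nat)
    (disp : measure_display) (Omega : measurableType disp)
    (P : probability Omega R) (F : R -> set (set Omega))
    (W : R -> Omega -> R) (T : R) (nu : noise R d)
    (a : bmultinom d p1.+1 -> R) (b : bmultinom d p2.+1 -> R)
    (u0 : Omega -> d.-tuple R -> R) (u : R -> Omega -> d.-tuple R -> R) :
    Prop := StrongSolution {
  solution_integrable : forall t : R, 0 <= t <= T ->
    \forall w \ae P, torus_integrable (u t w);
  solution_modes : forall xi : 'rV[int]_d,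
    mode_problem P F W T nu a b u0 xi (fun t w => fourier (u t w) xi);
  solution_unique : forall (xi : 'rV[int]_d) (X : R -> Omega -> R[i]),
    mode_problem P F W T nu a b u0 xi X ->
    forall t : R, 0 <= t <= T -> \forall w \ae P, X t w = fourier (u t w) xi }.

(** * Means and covariances *)

Definition cexpectation (R : realType) (disp : measure_display)
    (Omega : measurableType disp) (P : probability Omega R)
    (X : Omega -> R[i]) : R[i] :=
  Complex (fine 'E_P[fun w => complex.Re (X w)])
          (fine 'E_P[fun w => complex.Im (X w)]).

(* Hermitian covariance E[(X - E X) conj(Y - E Y)] *)
Definition ccovariance (R : realType) (disp : measure_display)
    (Omega : measurableType disp) (P : probability Omega R)
    (X Y : Omega -> R[i]) : R[i] :=
  cexpectation P
    (fun w => (X w - cexpectation P X) * conjc (Y w - cexpectation P Y)).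

Definition cLfun (R : realType) (disp : measure_display)
    (Omega : measurableType disp) (P : probability Omega R) (q : \bar R)
    (X : Omega -> R[i]) :=
  (fun w => complex.Re (X w)) \in Lfun P q /\
  (fun w => complex.Im (X w)) \in Lfun P q.

Definition same_mean_covariance (R : realType) (disp : measure_display)
    (Omega : measurableType disp) (P : probability Omega R)
    (X1 X2 Y1 Y2 : Omega -> R[i]) :=
  [/\ cexpectation P X1 = cexpectation P Y1,
      cexpectation P X2 = cexpectation P Y2,
      ccovariance P X1 X1 = ccovariance P Y1 Y1,
      ccovariance P X1 X2 = ccovariance P Y1 Y2 &
      ccovariance P X2 X2 = ccovariance P Y2 Y2].

(* u0 is F_0-measurable as a random integrable function on the torus, that is,
   each of its Fourier coefficients is; and its mean is finite. *)
Record initial_datum (R : realType) (d : nat) (disp : measure_display)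
    (Omega : measurableType disp) (P : probability Omega R)
    (F : R -> set (set Omega)) (u0 : Omega -> d.-tuple R -> R) : Prop :=
    InitialDatum {
  initial_integrable : \forall w \ae P, torus_integrable (u0 w);
  initial_measurable_Re : forall xi : 'rV[int]_d,
    measurable_wrt (F 0) (fun w => complex.Re (fourier (u0 w) xi));
  initial_measurable_Im : forall xi : 'rV[int]_d,
    measurable_wrt (F 0) (fun w => complex.Im (fourier (u0 w) xi));
  initial_mean : forall xi : 'rV[int]_d,
    cLfun P 1%E (fun w => fourier (u0 w) xi) }.

(** * Observed modes and equivalence of coefficients *)

Definition excited_modes (R : realType) (d : nat) (disp : measure_display)
    (Omega : measurableType disp) (P : probability Omega R) (nu : noise R d)
    (u0 : Omega -> d.-tuple R -> R) : set 'rV[int]_d :=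
  [set xi | if nu is AdditiveNoise r then fourier r xi != 0
            else cexpectation P (fun w => fourier (u0 w) xi) != 0].

(* msize p is the total degree of p plus one (and 0 for p = 0). *)
Definition on_hypersurface (R : realType) (d n : nat) (Q : set 'rV[int]_d) :=
  exists p : mpoly d R, [/\ p != 0, (msize p <= n.+1)%N &
    forall xi, Q xi -> meval (fun j => (xi 0 j)%:~R) p = 0].

Definition multiplicative_coef (R : realType) (d p : nat)
    (b : bmultinom d p.+1 -> R) (gamma : multinom d) : R[i] :=
  \sum_(beta : bmultinom d p.+1)
    \sum_(beta' : bmultinom d p.+1 | mnm_add beta beta' == gamma)
      'i%C ^+ (mdeg beta + mdeg beta') * (b beta * b beta')%:C.

Definition additive_coef (R : realType) (d p : nat)
    (b : bmultinom d p.+1 -> R) (gamma : multinom d) : R[i] :=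
  \sum_(beta : bmultinom d p.+1 | ~~ odd (mdeg beta))
    \sum_(beta' : bmultinom d p.+1 |
          ~~ odd (mdeg beta') && (mnm_add beta beta' == gamma))
      'i%C ^+ mdeg (mnm_add beta beta') * (b beta * b beta')%:C
  + \sum_(beta : bmultinom d p.+1 | odd (mdeg beta))
    \sum_(beta' : bmultinom d p.+1 |
          odd (mdeg beta') && (mnm_add beta beta' == gamma))
      'i%C ^ ((mdeg beta)%:Z - (mdeg beta')%:Z) * (b beta * b beta')%:C.

Definition equivalent_coefs (R : realType) (d p : nat) (nu : noise R d)
    (b b' : bmultinom d p.+1 -> R) : Prop :=
  forall gamma : multinom d, (mdeg gamma <= 2 * p)%N ->
  match nu with
  | AdditiveNoise _ =>
      ~~ odd (mdeg gamma) -> additive_coef b gamma = additive_coef b' gamma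
  | MultiplicativeNoise =>
      multiplicative_coef b gamma = multiplicative_coef b' gamma
  end.

(* Main.v *)
(* Each Fourier mode solves a scalar linear equation dX = A X dt + B G o dW, and
   a single well-chosen mode suffices: if b and b' are not equivalent, then a
   nonzero polynomial of degree at most 2 p2, with coefficients read off the
   quadratic expressions that define the equivalence, measures the difference of
   B^2 (multiplicative noise) or |B|^2 (additive noise), and it does not vanish
   on some excited mode.

   Multiplicative noise: the explicit process x0 exp(A t + B (W_t - W_0)) solves
   the Stratonovich equation (a second-order Taylor expansion along partitions,
   combined with the quadratic variation of W), hence is the solution when
   B <> 0; for B = 0 the equation is solved path by path.  The means at the two
   times determine E exp(B (W_t2 - W_t1)) = 1 + B^2 (t2 - t1) / 2 +
   O((t2 - t1)^(3/2)), hence B^2 when t2 - t1 is small.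

   Additive noise: Y = X_t2 - e^(A (t2 - t1)) X_t1 equals B r times a variable
   eta that depends only on A and W, and its variance is observed.  This gives
   |B|^2 unless eta is almost surely constant.  For a constant eta the variable
   W_t2 - W_t1 would be within O(int_t1^t2 |W_s - W_t1| ds) of a constant; its
   variance t2 - t1 would then be O((t2 - t1)^2), which is impossible for small
   t2 - t1. *)
Require Import Defs.
From HB Require Import structures.
From mathcomp Require Import all_boot all_order all_algebra complex.
From mathcomp Require Import all_classical all_reals all_analysis.
From mathcomp Require Import measurable_realfun ring lra.
From mathcomp Require mpoly.
Import -(notations) mpoly.

Set Implicit Arguments.
Unset Strict Implicit.
Unset Printing Implicit Defensive.

Import Order.TTheory GRing.Theory Num.Theory.
Import numFieldNormedType.Exports.
Import ComplexField.Normc.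

Local Open Scope classical_set_scope.
Local Open Scope ring_scope.
Local Open Scope complex_scope.

(** * Complex exponential *)

(** Stochastic integrals are specified only as limits in probability of partition sums, so these
    limits have to be produced for the explicit process. Apart from one input the argument is
    pathwise; the input is that weighted sums of [(dW)^2 - dt] vanish. Their variance is at most a
    constant times the mesh, hence summable along partitions with meshes below [2^-(n+1)], which
    gives almost sure convergence; a failure of convergence in probability would already occur along
    such partitions. The case [B != 0] is separate because the integral is found by solving the
    equation for it. With multiplicative noise [t1] need not be small, so the mean at [t2] carries
    an uncontrolled factor [E exp(B (W_t1 - W_0))]. Independence splits it off, the mean at [t1]
    shows that it agrees for both coefficients, and it cancels once it is known to be nonzero. With
    additive noise the degenerate case is tested against the increment itself: the correlation of
    [W_t2 - W_t1] with an error dominated by [int |W_s - W_t1| ds] is [O((t2 - t1)^2)]. *)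

Section complex_exponential.
Variable R : realType.
Implicit Types (x y z : R[i]) (s : R).
Notation Re := complex.Re.
Notation Im := complex.Im.

Lemma cReD x y : Re (x + y) = Re x + Re y.
Proof. by case: x y => ? ? []. Qed.

Lemma cImD x y : Im (x + y) = Im x + Im y.
Proof. by case: x y => ? ? []. Qed.

Lemma cReN x : Re (- x) = - Re x.
Proof. by case: x. Qed.

Lemma cImN x : Im (- x) = - Im x.
Proof. by case: x. Qed.

Lemma cReB x y : Re (x - y) = Re x - Re y.
Proof. by rewrite cReD cReN. Qed.

Lemma cImB x y : Im (x - y) = Im x - Im y.
Proof. by rewrite cImD cImN. Qed.

Lemma cReM x y : Re (x * y) = Re x * Re y - Im x * Im y.
Proof. by case: x y => ? ? []. Qed.

Lemma cImM x y : Im (x * y) = Re x * Im y + Im x * Re y.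
Proof. by case: x y => ? ? []. Qed.

Lemma cReMr z s : Re (z * s%:C) = Re z * s.
Proof. by rewrite cReM/= mulr0 subr0. Qed.

Lemma cImMr z s : Im (z * s%:C) = Im z * s.
Proof. by rewrite cImM/= mulr0 add0r. Qed.

Lemma cRe_sum (I : Type) (r : seq I) (Q : pred I) (F : I -> R[i]) :
  Re (\sum_(i <- r | Q i) F i) = \sum_(i <- r | Q i) Re (F i).
Proof. by elim/big_rec2: _ => // i a b _ <-; rewrite cReD. Qed.

Lemma cIm_sum (I : Type) (r : seq I) (Q : pred I) (F : I -> R[i]) :
  Im (\sum_(i <- r | Q i) F i) = \sum_(i <- r | Q i) Im (F i).
Proof. by elim/big_rec2: _ => // i a b _ <-; rewrite cImD. Qed.

Lemma complex_ext x y : Re x = Re y -> Im x = Im y -> x = y.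
Proof. by case: x y => ? ? [] /= ? ? -> ->. Qed.

Definition cReIm := (cReD, cImD, cReN, cImN, cReM, cImM).

Lemma normc_Re_le z : `|Re z| <= normc z.
Proof.
case: z => a b /=; rewrite -sqrtr_sqr ler_wsqrtr// lerDl; exact: sqr_ge0.
Qed.

Lemma normc_Im_le z : `|Im z| <= normc z.
Proof.
case: z => a b /=; rewrite -sqrtr_sqr ler_wsqrtr// lerDr; exact: sqr_ge0.
Qed.

Lemma normc_le_ReIm z : normc z <= `|Re z| + `|Im z|.
Proof.
case: z => a b /=; rewrite -[leRHS]ger0_norm ?addr_ge0// -sqrtr_sqr ler_wsqrtr//.
rewrite sqrrD !real_normK ?num_real// addrAC lerDl mulrn_wge0 ?mulr_ge0//.
Qed.

Lemma normc_ge0 z : 0 <= normc z.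
Proof. by case: z => a b; exact: sqrtr_ge0. Qed.

Lemma sqr_normcE z : normc z ^+ 2 = Re z ^+ 2 + Im z ^+ 2.
Proof. by case: z => a b /=; rewrite sqr_sqrtr// addr_ge0 ?sqr_ge0. Qed.

Lemma normc_real s : normc s%:C = `|s|.
Proof. by rewrite /= expr0n/= addr0 sqrtr_sqr. Qed.

Lemma le_normc_sum (I : Type) (r : seq I) (F : I -> R[i]) :
  normc (\sum_(i <- r) F i) <= \sum_(i <- r) normc (F i).
Proof.
elim: r => [|i r IH]; first by rewrite !big_nil normc0.
by rewrite !big_cons (le_trans (le_normcD _ _))// lerD2l.
Qed.

Definition cexp z : R[i] := (expR (Re z))%:C * (cos (Im z) +i* sin (Im z)).

Lemma Re_cexp z : Re (cexp z) = expR (Re z) * cos (Im z).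
Proof. by rewrite /cexp /=; ring. Qed.

Lemma Im_cexp z : Im (cexp z) = expR (Re z) * sin (Im z).
Proof. by rewrite /cexp /=; ring. Qed.

Lemma cexp0 : cexp 0 = 1.
Proof. by apply: complex_ext; rewrite ?Re_cexp ?Im_cexp/= expR0 ?cos0 ?sin0; ring. Qed.

Lemma cexpD x y : cexp (x + y) = cexp x * cexp y.
Proof.
apply: complex_ext;
rewrite ?(cReM, cImM, Re_cexp, Im_cexp) ?(cReD, cImD) expRD ?cosD ?sinD; ring.
Qed.

Lemma cexp_neq0 z : cexp z != 0.
Proof.
apply/eqP => z0; have : cexp (z - z) = 1 by rewrite subrr cexp0.
by rewrite cexpD z0 mul0r => /esym/eqP; rewrite oner_eq0.
Qed.

Lemma normc_cexp z : normc (cexp z) = expR (Re z).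
Proof.
rewrite /cexp normcM normc_real ger0_norm ?expR_ge0//=.
by rewrite cos2Dsin2 sqrtr1 mulr1.
Qed.

Lemma normc_cexp_le z : normc (cexp z) <= expR (normc z).
Proof.
by rewrite normc_cexp ler_expR (le_trans (ler_norm _))// normc_Re_le.
Qed.

(** Componentwise, so that the real differentiation rules and the real mean value theorem apply to
    each part. *)
Definition cderive (g : R -> R[i]) (s : R) (l : R[i]) :=
  is_derive s 1 (fun s => Re (g s)) (Re l) /\
  is_derive s 1 (fun s => Im (g s)) (Im l).

Lemma cderiveD f g s l m :
  cderive f s l -> cderive g s m -> cderive (fun s => f s + g s) s (l + m).
Proof.
move=> [f1 f2] [g1 g2]; split.
- have -> : (fun s => Re (f s + g s)) = (fun s => Re (f s) + Re (g s)).
    by apply/funext => u; rewrite cReD.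
  by rewrite cReD; apply: is_deriveD.
- have -> : (fun s => Im (f s + g s)) = (fun s => Im (f s) + Im (g s)).
    by apply/funext => u; rewrite cImD.
  by rewrite cImD; apply: is_deriveD.
Qed.

Lemma cderiveM f g s l m : cderive f s l -> cderive g s m ->
  cderive (fun s => f s * g s) s (l * g s + f s * m).
Proof.
move=> [f1 f2] [g1 g2]; split.
- have -> : (fun s => Re (f s * g s)) =
      (fun s => Re (f s) * Re (g s) - Im (f s) * Im (g s)).
    by apply/funext => u; rewrite cReM.
  apply: is_derive_eq; rewrite !cReIm /GRing.scale/=; ring.
- have -> : (fun s => Im (f s * g s)) =
      (fun s => Re (f s) * Im (g s) + Im (f s) * Re (g s)).
    by apply/funext => u; rewrite cImM.
  apply: is_derive_eq; rewrite !cReIm /GRing.scale/=; ring.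
Qed.

Lemma cderive_cst c s : cderive (fun=> c) s 0.
Proof. by split; exact: is_derive_cst. Qed.

Lemma cderive_real s : cderive (fun u => u%:C) s 1.
Proof. by split => /=; [exact: is_derive_id | exact: is_derive_cst]. Qed.

Lemma cderive_cexp z s : cderive (fun u => cexp (u%:C * z)) s (z * cexp (s%:C * z)).
Proof.
have reE u : Re (u%:C * z) = u * Re z by rewrite cReM/=; ring.
have imE u : Im (u%:C * z) = u * Im z by rewrite cImM/=; ring.
split.
- have -> : (fun u => Re (cexp (u%:C * z))) =
      (fun u : R => expR (u * Re z) * cos (u * Im z)).
    by apply/funext => u; rewrite Re_cexp reE imE.
  apply: is_derive_eq.
  rewrite cReM Re_cexp Im_cexp reE imE /GRing.scale/=; ring.
- have -> : (fun u => Im (cexp (u%:C * z))) =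
      (fun u : R => expR (u * Re z) * sin (u * Im z)).
    by apply/funext => u; rewrite Im_cexp reE imE.
  apply: is_derive_eq.
  rewrite cImM Re_cexp Im_cexp reE imE /GRing.scale/=; ring.
Qed.

(** The mean value theorem fails for complex values, so it is applied to [Re] and [Im] separately;
    the factor 2 is the price. *)
Lemma cderive_bound (g g' : R -> R[i]) (C : R) :
  (forall s, cderive g s (g' s)) ->
  (forall s, 0 <= s <= 1 -> normc (g' s) <= C) ->
  normc (g 1 - g 0) <= 2 * C.
Proof.
move=> dg bg.
have mvt (f f' : R -> R) : (forall s : R, is_derive s 1 f (f' s)) ->
    (forall s, 0 <= s <= 1 -> `|f' s| <= C) -> `|f 1 - f 0| <= C.
  move=> df bf; have cf : {within `[0%R, 1%R], continuous f}.
    apply: derivable_within_continuous => x _; by have [] := df x.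
  have [c c01 ->] := MVT ltr01 (fun s _ => df s) cf.
  rewrite subr0 mulr1; apply: bf.
  by move: c01; rewrite in_itv/= => /andP[/ltW -> /ltW ->].
apply: (le_trans (normc_le_ReIm _)); rewrite mulr2n mulrDl mul1r.
rewrite cReB cImB; apply: lerD.
- apply: (mvt (fun s => Re (g s)) (fun s => Re (g' s))).
    by move=> s; have [] := dg s.
  by move=> s /bg; apply: le_trans; exact: normc_Re_le.
- apply: (mvt (fun s => Im (g s)) (fun s => Im (g' s))).
    by move=> s; have [] := dg s.
  by move=> s /bg; apply: le_trans; exact: normc_Im_le.
Qed.

Let expbound n (s : R) z : 0 <= s <= 1 ->
  normc (s%:C * z) ^+ n * expR (normc (s%:C * z)) <= normc z ^+ n * expR (normc z).
Proof.
case/andP => s0 s1; rewrite normcM normc_real ger0_norm//.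
have szz : s * normc z <= normc z by rewrite ler_piMl// normc_ge0.
apply: ler_pM; rewrite ?exprn_ge0 ?mulr_ge0 ?expR_ge0 ?normc_ge0//.
- by apply: lerXn2r; rewrite ?nnegrE ?mulr_ge0 ?normc_ge0.
- by rewrite ler_expR.
Qed.

(** In [s], the function [exp(s z)] has derivative [z exp(s z)]. The next two expansions repeat the
    argument: each remainder at [s z] has as derivative [z] times the preceding remainder, so every
    order adds a power of [|z|] and doubles the constant. *)
Lemma cexp_taylor0 z : normc (cexp z - 1) <= 2 * (normc z * expR (normc z)).
Proof.
have := @cderive_bound (fun s => cexp (s%:C * z)) (fun s => z * cexp (s%:C * z))
  (normc z * expR (normc z)) (cderive_cexp z).
rewrite mul0r cexp0 mul1r; apply => s s01.
rewrite normcM ler_wpM2l ?normc_ge0// (le_trans (normc_cexp_le _))//.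
by have := expbound 0 z s01; rewrite !mul1r.
Qed.

Lemma cexp_taylor1 z :
  normc (cexp z - 1 - z) <= 4 * (normc z ^+ 2 * expR (normc z)).
Proof.
pose g (s : R) := cexp (s%:C * z) + (- 1) + s%:C * (- z).
(* Written with its zero terms exactly as [cderiveD] and [cderiveM] produce them; it is simplified
   afterwards. *)
pose g' (s : R) := z * cexp (s%:C * z) + 0 + (1 * (- z) + s%:C * 0).
have := @cderive_bound g g' (2 * (normc z ^+ 2 * expR (normc z))).
have -> : g 1 - g 0 = cexp z - 1 - z.
  by rewrite /g !mul0r !mul1r cexp0 addr0 subrr subr0.
have -> : 4 * (normc z ^+ 2 * expR (normc z)) =
  2 * (2 * (normc z ^+ 2 * expR (normc z))) by ring.
apply => [s|s s01].
  apply: cderiveD; first by apply: cderiveD; [exact: cderive_cexp|exact: cderive_cst].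
  by apply: cderiveM; [exact: cderive_real|exact: cderive_cst].
have -> : g' s = z * (cexp (s%:C * z) - 1) by rewrite /g'; ring.
rewrite normcM exprS expr1 -mulrA mulrCA ler_wpM2l ?normc_ge0//.
rewrite (le_trans (cexp_taylor0 _))// ler_wpM2l//.
by have := expbound 1 z s01; rewrite !expr1.
Qed.

Lemma cexp_taylor2 z :
  normc (cexp z - 1 - z - z ^+ 2 / 2) <= 8 * (normc z ^+ 3 * expR (normc z)).
Proof.
pose g (s : R) := cexp (s%:C * z) + (- 1) + s%:C * (- z) + s%:C * (s%:C * (- (z ^+ 2 / 2))).
pose g' (s : R) := z * cexp (s%:C * z) + 0 + (1 * (- z) + s%:C * 0) +
  (1 * (s%:C * (- (z ^+ 2 / 2))) + s%:C * (1 * (- (z ^+ 2 / 2)) + s%:C * 0)).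
have := @cderive_bound g g' (4 * (normc z ^+ 3 * expR (normc z))).
have -> : g 1 - g 0 = cexp z - 1 - z - z ^+ 2 / 2.
  by rewrite /g !mul0r !mul1r cexp0 !addr0 subrr subr0.
have -> : 8 * (normc z ^+ 3 * expR (normc z)) =
  2 * (4 * (normc z ^+ 3 * expR (normc z))) by ring.
apply => [s|s s01].
  apply: cderiveD.
    apply: cderiveD; first by apply: cderiveD; [exact: cderive_cexp|exact: cderive_cst].
    by apply: cderiveM; [exact: cderive_real|exact: cderive_cst].
  apply: cderiveM; first exact: cderive_real.
  by apply: cderiveM; [exact: cderive_real|exact: cderive_cst].
have -> : g' s = z * (cexp (s%:C * z) - 1 - s%:C * z) by rewrite /g'; field.
rewrite normcM exprS -mulrA mulrCA ler_wpM2l ?normc_ge0//.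
by rewrite (le_trans (cexp_taylor1 _))// ler_wpM2l// (expbound 2).
Qed.

End complex_exponential.

(** * Riemann sums *)

Section uniform_continuity.
Variable R : realType.
Implicit Types (f g : R -> R) (a b : R).

(** Precomposition with the projection onto [[a, b]] extends the function continuously to the line,
    so that plain neighbourhoods can be used. The projection is 1-Lipschitz, hence the same radius
    serves. *)
Lemma within_continuous_clamp f a b : a <= b ->
  {within `[a, b], continuous f} ->
  continuous (fun x => f (Num.max a (Num.min x b))).
Proof.
move=> ab /subspace_continuousP cf x.
have cb y : `[a, b]%classic (Num.max a (Num.min y b)).
  by rewrite /= in_itv/= le_max lexx/= ge_max ab ge_min lexx orbT.
have := cf _ (cb x); apply: cvg_comp => A [e /= e0 eA].
exists e => //= y /= xy; apply: eA; last exact: cb.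
apply: le_lt_trans xy => /=.
have /= maxL (u v w : R) : `|Num.max u v - Num.max u w| <= `|v - w|.
  rewrite /Num.max; have := ler_norm (v - w); have := ler_norm (w - v).
  rewrite (distrC w) ler_norml; case: ltP => ?; case: ltP => ?; lra.
have /= minL (u v w : R) : `|Num.min v u - Num.min w u| <= `|v - w|.
  rewrite /Num.min; have := ler_norm (v - w); have := ler_norm (w - v).
  rewrite (distrC w) ler_norml; case: ltP => ?; case: ltP => ?; lra.
exact: le_trans (maxL _ _ _) (minL _ _ _).
Qed.

Lemma clamp_id a b (x : R) : a <= x <= b -> Num.max a (Num.min x b) = x.
Proof. by case/andP => ax xb; rewrite min_l// max_r. Qed.

Lemma within_unif_continuous f a b : {within `[a, b], continuous f} ->
  forall e : R, 0 < e -> exists2 m : R, 0 < m &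
    forall x y, a <= x <= b -> a <= y <= b -> `|x - y| <= m -> `|f x - f y| <= e.
Proof.
move=> cf e e0; have [ab|ba] := leP a b; last first.
  exists 1 => // x y /andP[ax xb]; by move: (le_lt_trans (le_trans ax xb) ba); rewrite ltxx.
have cg := within_continuous_clamp ab cf.
set g := (fun x => _) in cg.
(* Heine-Cantor in the covering form of compactness: near each [x] one bound on the distance works
   for a whole ball, and compactness makes it uniform in [x]. The halves below leave room for the
   triangle inequality. *)
have /compact_near_coveringP/(_ R (0^'+) (fun m x => forall y, `|x - y| <= m -> `|g x - g y| < e)) :=
  @segment_compact _ a b.
case=> [x xab|m /= m0 H].
- have [r /= r0 hr] : \forall y \near x, `|g x - g y| < e / 2.
    have /cvgrPdist_lt := cg x; apply; exact: divr_gt0.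
  have r2 : 0 < r / 2 by rewrite divr_gt0.
  exists (ball x (r / 2), [set m : R | m < r / 2]) => /=.
    split; first exact: nbhsx_ballx.
    exact: nbhs_right_lt.
  case=> x' m /= [xx' mr] y x'y.
  have -> : g x' - g y = (g x' - g x) + (g x - g y) by ring.
  rewrite (le_lt_trans (ler_normD _ _))// [ltRHS](splitr e) ltrD//.
    rewrite distrC; apply: hr => /=; apply: lt_trans xx' _; lra.
  apply: hr => /=.
  have -> : x - y = (x - x') + (x' - y) by ring.
  rewrite (le_lt_trans (ler_normD _ _))// [ltRHS](splitr r) ltrD//.
  exact: le_lt_trans x'y mr.
exists (m / 2) => [|x y xab yab xy]; first by rewrite divr_gt0.
have := H (m / 2) _ _ x _ y; rewrite /g !clamp_id//= => h; apply/ltW/h => //.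
- by rewrite /= sub0r normrN gtr0_norm ?divr_gt0// ltr_pdivrMr// ltr_pMr// ltr1n.
- by rewrite divr_gt0.
Qed.

Lemma within_continuous_bounded f a b : {within `[a, b], continuous f} ->
  exists2 M : R, 0 <= M & forall x, a <= x <= b -> `|f x| <= M.
Proof.
move=> cf; have [ab|ba] := leP a b; last first.
  exists 0 => // x /andP[ax xb]; by move: (le_lt_trans (le_trans ax xb) ba); rewrite ltxx.
have cnf : {within `[a, b], continuous (fun x => `|f x|)}.
  by move=> x; apply: cvg_norm; exact: cf.
have [c _ H] := EVT_max ab cnf.
exists `|f c| => // x xab; apply: (H x); rewrite in_itv/=.
Qed.

Lemma within_continuous_integrable f a b : {within `[a, b], continuous f} ->
  lebesgue_measure.-integrable `[a, b] (EFin \o f).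
Proof. by move=> cf; apply: continuous_compact_integrable => //; exact: segment_compact. Qed.

Lemma Rintegral_itv_add f a (u v b : R) : {within `[a, b], continuous f} ->
  a <= u -> u <= v -> v <= b ->
  \int[lebesgue_measure]_(s in `[a, v]) f s - \int[lebesgue_measure]_(s in `[a, u]) f s
  = \int[lebesgue_measure]_(s in `]u, v]) f s.
Proof.
move=> cf au uv vb; rewrite Rintegral_itvB//= ?bnd_simp//.
by apply: integrableS (within_continuous_integrable cf) => //; apply: subset_itvl; rewrite bnd_simp.
Qed.

Lemma lebesgue_fine_itv_oc (u v : R) : u <= v ->
  fine (lebesgue_measure (`]u, v] : set R)) = v - u.
Proof.
move=> uv; rewrite lebesgue_measure_itv/= lte_fin; case: ltP => [//|vu]/=.
have -> : v = u by apply/eqP; rewrite eq_le uv vu.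
by rewrite subrr.
Qed.

Lemma Rintegral_osc f a b (u v e : R) : {within `[a, b], continuous f} ->
  a <= u -> u <= v -> v <= b -> (forall x, u <= x <= v -> `|f x - f u| <= e) ->
  `|\int[lebesgue_measure]_(s in `]u, v]) f s - f u * (v - u)| <= e * (v - u).
Proof.
move=> cf au uv vb osc.
have intf : lebesgue_measure.-integrable `]u, v] (EFin \o f).
  apply: integrableS (within_continuous_integrable cf) => //.
  by apply: subset_itvScc; rewrite bnd_simp.
have intc c : lebesgue_measure.-integrable `]u, v] (EFin \o cst c : R -> \bar R).
  apply: integrableS (within_continuous_integrable (f := cst c) (a := u) (b := v) _) => //.
  - by apply: subset_itv_oc_cc.
  - by move=> x; exact: cvg_cst.
have -> : f u * (v - u) = \int[lebesgue_measure]_(s in `]u, v]) f u.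
  by rewrite Rintegral_cst// lebesgue_fine_itv_oc.
rewrite -RintegralB//; last exact: intc.
have intB : lebesgue_measure.-integrable `]u, v] (EFin \o (fun s => f s - f u)).
  by apply: eq_integrable (integrableB _ intf (intc (f u))).
apply: (le_trans (le_normr_Rintegral _ _)) => //.
rewrite -(lebesgue_fine_itv_oc uv) -Rintegral_cst//.
apply: le_Rintegral => //; last 1 first.
- move=> x; rewrite /= in_itv/= => /andP[/ltW ux xv]; apply: osc; exact/andP.
- exact: (integrable_norm intB).
- exact: intc.
Qed.

(** On each cell the oscillation costs at most [e] times the length of the cell, and the lengths add
    up to [b - a]. *)
Lemma riemann_sum_close f a b (p : nat -> R) N (m e : R) :
  {within `[a, b], continuous f} ->
  p 0%N = a -> p N = b ->
  (forall k, (k < N)%N -> p k <= p k.+1 <= p k + m) ->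
  (forall x y, a <= x <= b -> a <= y <= b -> `|x - y| <= m -> `|f x - f y| <= e) ->
  `|\sum_(0 <= k < N) f (p k) * (p k.+1 - p k)
    - \int[lebesgue_measure]_(s in `[a, b]) f s| <= e * (b - a).
Proof.
move=> cf p0 pN dp osc.
have ple k l : (k <= l)%N -> (l <= N)%N -> p k <= p l.
  elim: l => [|l IH]; first by rewrite leqn0 => /eqP ->.
  rewrite leq_eqVlt => /predU1P[->//|kl lN].
  by rewrite (le_trans (IH kl (ltnW lN)))//; have /andP[] := dp _ lN.
suff H n : (n <= N)%N -> `|\sum_(0 <= k < n) f (p k) * (p k.+1 - p k)
    - \int[lebesgue_measure]_(s in `[a, p n]) f s| <= e * (p n - a).
  by have := H N (leqnn N); rewrite pN.
elim: n => [_|n IH nN].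
  by rewrite big_geq// p0 set_itv1 Rintegral_set1 !subrr mulr0 normr0.
have pna : a <= p n by rewrite -p0 ple// ltnW.
have pnb : p n.+1 <= b by rewrite -pN ple.
have /andP[pp pm] := dp _ nN.
rewrite big_nat_recr//=.
have -> : \int[lebesgue_measure]_(s in `[a, p n.+1]) f s =
    \int[lebesgue_measure]_(s in `[a, p n]) f s +
    \int[lebesgue_measure]_(s in `]p n, p n.+1]) f s.
  by rewrite -(Rintegral_itv_add cf pna pp pnb); ring.
set S := \sum_(_ <= _ < _) _; set I := Rintegral _ _ _; set J := Rintegral _ _ _.
have -> : S + f (p n) * (p n.+1 - p n) - (I + J) =
   (S - I) - (J - f (p n) * (p n.+1 - p n)) by ring.
rewrite (le_trans (ler_normB _ _))//.
have -> : e * (p n.+1 - a) = e * (p n - a) + e * (p n.+1 - p n) by ring.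
apply: lerD; first exact: IH (ltnW nN).
apply: (Rintegral_osc cf) => // x /andP[px xp]; apply: osc.
- by rewrite (le_trans pna px) (le_trans xp pnb).
- by rewrite pna (le_trans pp pnb).
- by rewrite ger0_norm ?subr_ge0// lerBlDl (le_trans xp).
Qed.

Lemma riemann_sum_cvg f a b (p : nat -> nat -> R) (N : nat -> nat) (m : nat -> R) :
  {within `[a, b], continuous f} ->
  (forall n, p n 0%N = a) -> (forall n, p n (N n) = b) ->
  (forall n k, (k < N n)%N -> p n k <= p n k.+1 <= p n k + m n) ->
  m n @[n --> \oo] --> (0 : R) ->
  \sum_(0 <= k < N n) f (p n k) * (p n k.+1 - p n k) @[n --> \oo] -->
    \int[lebesgue_measure]_(s in `[a, b]) f s.
Proof.
move=> cf p0 pN dp m0.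
apply/cvgrPdist_le => e e0.
have d0 : 0 < `|b - a| + 1 by rewrite ltr_wpDl.
have e'0 : 0 < e / (`|b - a| + 1) by rewrite divr_gt0.
have [d dpos hd] := within_unif_continuous cf e'0.
have /cvgrPdist_le/(_ _ dpos) := m0; apply: filterS => n; rewrite sub0r normrN => mn.
rewrite distrC.
apply: le_trans (riemann_sum_close (m := m n) (e := e / (`|b - a| + 1)) cf (p0 n) (pN n) (dp n) _) _.
  move=> x y xab yab xy; apply: hd => //; apply: le_trans xy _.
  exact: le_trans (ler_norm _) mn.
rewrite mulrAC ler_pdivrMr// ler_pM2l//.
by rewrite (le_trans (ler_norm _))// lerDl.
Qed.

End uniform_continuity.

(** * Pathwise second-order expansion *)

Section complex_limits.
Variable R : realType.
Implicit Types (u v : nat -> R[i]) (l m c : R[i]).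
Notation Re := complex.Re.
Notation Im := complex.Im.

Definition ccvg u l := normc (u n - l) @[n --> \oo] --> (0 : R).

Lemma ccvg_Re u l : ccvg u l -> Re (u n) @[n --> \oo] --> Re l.
Proof.
move=> ul; apply/cvgrPdist_le => e e0; move/cvgrPdist_le: ul => /(_ _ e0).
apply: filterS => n; rewrite sub0r normrN; apply: le_trans.
by rewrite distrC -cReB (le_trans (normc_Re_le _))// ler_norm.
Qed.

Lemma ccvg_Im u l : ccvg u l -> Im (u n) @[n --> \oo] --> Im l.
Proof.
move=> ul; apply/cvgrPdist_le => e e0; move/cvgrPdist_le: ul => /(_ _ e0).
apply: filterS => n; rewrite sub0r normrN; apply: le_trans.
by rewrite distrC -cImB (le_trans (normc_Im_le _))// ler_norm.
Qed.

Lemma ccvg_squeeze u l (w : nat -> R) : (forall n, normc (u n - l) <= w n) ->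
  w n @[n --> \oo] --> (0 : R) -> ccvg u l.
Proof.
move=> uw w0; apply: (@squeeze_cvgr _ _ _ _ (fun=> 0) w) => //.
  by near=> n; rewrite normc_ge0 uw.
exact: cvg_cst.
Unshelve. all: by end_near. Qed.

Lemma ccvg_ReIm u l : Re (u n) @[n --> \oo] --> Re l ->
  Im (u n) @[n --> \oo] --> Im l -> ccvg u l.
Proof.
move=> ul1 ul2; apply: (@ccvg_squeeze _ _ (fun n => `|Re (u n) - Re l| + `|Im (u n) - Im l|)).
  by move=> n; rewrite (le_trans (normc_le_ReIm _))// cReB cImB.
rewrite -[0 in X in _ --> X]addr0; apply: cvgD.
- by apply/norm_cvg0P/subr_cvg0.
- by apply/norm_cvg0P/subr_cvg0.
Qed.

Lemma ccvgD u v l m : ccvg u l -> ccvg v m -> ccvg (fun n => u n + v n) (l + m).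
Proof.
move=> ul vm; apply: (@ccvg_squeeze _ _ (fun n => normc (u n - l) + normc (v n - m))).
  by move=> n; rewrite opprD addrACA le_normcD.
by rewrite -[0 in X in _ --> X]addr0; apply: cvgD.
Qed.

Lemma ccvgZ c u l : ccvg u l -> ccvg (fun n => c * u n) (c * l).
Proof.
move=> ul; apply: (@ccvg_squeeze _ _ (fun n => normc c * normc (u n - l))).
  by move=> n; rewrite -mulrBr normcM.
by rewrite -[0 in X in _ --> X](mulr0 (normc c)); apply: cvgM; [exact: cvg_cst|].
Qed.

Lemma ccvg_cst c : ccvg (fun=> c) c.
Proof. by apply: (@ccvg_squeeze _ _ (fun=> 0)) => [n|]; [rewrite subrr normc0|exact: cvg_cst]. Qed.

(** The restriction [e <= 1] matches the one-step estimates, in which higher powers of [e] are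
    absorbed by [e]. The sign of [K] is free, hence [|K| + 1] in the threshold. *)
Lemma ccvg0_linear_bound u (K : R) :
  (forall e : R, 0 < e <= 1 -> \forall n \near \oo, normc (u n) <= K * e) -> ccvg u 0.
Proof.
move=> H; apply/cvgrPdist_le => e e0.
have K0 : 0 < `|K| + 1 by rewrite ltr_wpDl.
pose d := Num.min 1 (e / (`|K| + 1)).
have d0 : 0 < d by rewrite lt_min ltr01 divr_gt0.
have /H : 0 < d <= 1 by rewrite d0 ge_min lexx.
apply: filterS => n nK; rewrite sub0r normrN subr0 ger0_norm ?normc_ge0//.
apply: (le_trans nK); apply: (@le_trans _ _ ((`|K| + 1) * d)).
  rewrite ler_pM2r// (le_trans (ler_norm K))// lerDl//.
by rewrite mulrC -ler_pdivlMr// /d ge_min lexx orbT.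
Qed.

End complex_limits.

Section pathwise_ito.
Variable R : realType.
Notation Re := complex.Re.
Notation Im := complex.Im.

(* The solution of dX = A X dt + B X o df along a path f. *)
Definition geometric_path (A B x0 : R[i]) (f : R -> R) (s : R) : R[i] :=
  x0 * cexp (A * s%:C + B * (f s - f 0)%:C).

Definition cRintegral (Z : R -> R[i]) (t : R) : R[i] :=
  Complex (\int[lebesgue_measure]_(s in `[0, t]) Re (Z s))
          (\int[lebesgue_measure]_(s in `[0, t]) Im (Z s)).

Lemma geometric_path_continuous A B x0 f (t : R) : {within `[0, t], continuous f} ->
  {within `[0, t], continuous (fun s => Re (geometric_path A B x0 f s))} /\
  {within `[0, t], continuous (fun s => Im (geometric_path A B x0 f s))}.
Proof.
move=> cf.
have cid : {within `[0, t], continuous (fun s : R => s)}.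
  by apply: continuous_subspaceT => s; exact: cvg_id.
have lin a b : {within `[0, t], continuous (fun s => a * s + b * (f s - f 0))}.
  move=> s; apply: cvgD; first by apply: cvgM; [exact: cvg_cst|exact: cid].
  by apply: cvgM; [exact: cvg_cst|]; apply: cvgB; [exact: cf|exact: cvg_cst].
have reE s : Re (A * s%:C + B * (f s - f 0)%:C) = Re A * s + Re B * (f s - f 0).
  by rewrite cReD !cReM/=; ring.
have imE s : Im (A * s%:C + B * (f s - f 0)%:C) = Im A * s + Im B * (f s - f 0).
  by rewrite cImD !cImM/=; ring.
have cR : {within `[0, t], continuous (fun s => Re (cexp (A * s%:C + B * (f s - f 0)%:C)))}.
  have -> : (fun s => Re (cexp (A * s%:C + B * (f s - f 0)%:C))) = (fun s =>
      expR (Re A * s + Re B * (f s - f 0)) * cos (Im A * s + Im B * (f s - f 0))).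
    by apply/funext => s; rewrite Re_cexp reE imE.
  move=> s.
  apply: cvgM.
    by apply: continuous_comp; [exact: lin|exact: continuous_expR].
  by apply: continuous_comp; [exact: lin|exact: continuous_cos].
have cI : {within `[0, t], continuous (fun s => Im (cexp (A * s%:C + B * (f s - f 0)%:C)))}.
  have -> : (fun s => Im (cexp (A * s%:C + B * (f s - f 0)%:C))) = (fun s =>
      expR (Re A * s + Re B * (f s - f 0)) * sin (Im A * s + Im B * (f s - f 0))).
    by apply/funext => s; rewrite Im_cexp reE imE.
  move=> s.
  apply: cvgM.
    by apply: continuous_comp; [exact: lin|exact: continuous_expR].
  by apply: continuous_comp; [exact: lin|exact: continuous_sin].
have -> : (fun s => Re (geometric_path A B x0 f s)) = (fun s =>
    Re x0 * Re (cexp (A * s%:C + B * (f s - f 0)%:C)) -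
    Im x0 * Im (cexp (A * s%:C + B * (f s - f 0)%:C))).
  by apply/funext => s; rewrite /geometric_path cReM.
have -> : (fun s => Im (geometric_path A B x0 f s)) = (fun s =>
    Re x0 * Im (cexp (A * s%:C + B * (f s - f 0)%:C)) +
    Im x0 * Re (cexp (A * s%:C + B * (f s - f 0)%:C))).
  by apply/funext => s; rewrite /geometric_path cImM.
split => s.
- by apply: cvgB; (apply: cvgM; first exact: cvg_cst); [exact: cR|exact: cI].
- by apply: cvgD; (apply: cvgM; first exact: cvg_cst); [exact: cI|exact: cR].
Qed.

Lemma geometric_path_step A B x0 f s t :
  geometric_path A B x0 f t =
  geometric_path A B x0 f s * cexp (A * (t - s)%:C + B * (f t - f s)%:C).
Proof.
rewrite /geometric_path -mulrA -cexpD; congr (_ * cexp _).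
rewrite !rmorphB/=; ring.
Qed.

Section step_estimates.
Variables (A B : R[i]) (tau D e : R).
Hypotheses (e01 : 0 < e <= 1) (tau0 : 0 <= tau <= e) (De : `|D| <= e).
Let a := normc A.
Let b := normc B.
(** The gauge of one step: its sum stays bounded along partitions of a path with finite quadratic
    variation, so an error [e * q] per step is negligible as [e] tends to 0. *)
Let q := tau + D ^+ 2.
Let z := A * tau%:C + B * D%:C.
Let L := a + b.
Let c := 2 * (a ^+ 2 + b ^+ 2).

Let e0 : 0 <= e. Proof. by case/andP: e01 => /ltW. Qed.
Let e1 : e <= 1. Proof. by case/andP: e01. Qed.
Let t0 : 0 <= tau. Proof. by case/andP: tau0. Qed.
Let te : tau <= e. Proof. by case/andP: tau0. Qed.
Let a0 : 0 <= a. Proof. exact: normc_ge0. Qed.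
Let b0 : 0 <= b. Proof. exact: normc_ge0. Qed.
Let L0 : 0 <= L. Proof. exact: addr_ge0. Qed.
Let c0 : 0 <= c. Proof. by rewrite mulr_ge0// addr_ge0 ?sqr_ge0. Qed.

Let normz : normc z <= a * tau + b * `|D|.
Proof.
rewrite (le_trans (le_normcD _ _))// !normcM !normc_real.
by rewrite (ger0_norm t0).
Qed.

Let normz_Le : normc z <= L * e.
Proof.
rewrite (le_trans normz)// mulrDl lerD// ler_wpM2l//.
Qed.

Let normz_L : normc z <= L.
Proof. by rewrite (le_trans normz_Le)// ler_piMr. Qed.

Let tauq : tau <= q. Proof. by rewrite lerDl sqr_ge0. Qed.

Let tau2 : tau ^+ 2 <= tau.
Proof. by rewrite expr2 ler_piMr// (le_trans te). Qed.

Let normz2 : normc z ^+ 2 <= c * q.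
Proof.
apply: (@le_trans _ _ ((a * tau + b * `|D|) ^+ 2)).
  by apply: lerXn2r; rewrite ?nnegrE ?normc_ge0 ?addr_ge0 ?mulr_ge0.
apply: (@le_trans _ _ (2 * (a ^+ 2 * tau ^+ 2 + b ^+ 2 * D ^+ 2))).
  rewrite -(real_normK (num_real D)) -subr_ge0.
  have -> : 2 * (a ^+ 2 * tau ^+ 2 + b ^+ 2 * `|D| ^+ 2) -
    (a * tau + b * `|D|) ^+ 2 = (a * tau - b * `|D|) ^+ 2 by ring.
  exact: sqr_ge0.
rewrite /c -mulrA ler_pM2l// mulrDl; apply: lerD; rewrite ler_wpM2l ?sqr_ge0//.
  exact: le_trans tau2 tauq.
by rewrite lerDr.
Qed.

Let tauD : tau * `|D| <= e * q.
Proof. by rewrite mulrC ler_pM. Qed.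

(** In units of [e * q], the summands bound the third-order Taylor remainder and the second-order
    terms [A B tau D] and [A^2 tau^2 / 2], which disappear in the limit, unlike [B^2 D^2 / 2]. *)
Definition ito_error_cst1 (A B : R[i]) : R := let a := normc A in let b := normc B in
  8 * ((a + b) * (2 * (a ^+ 2 + b ^+ 2)) * expR (a + b)) + a * b + a ^+ 2.

Definition ito_error_cst2 (A B : R[i]) : R := let a := normc A in let b := normc B in
  4 * (2 * (a ^+ 2 + b ^+ 2) * expR (a + b)) + a.

Lemma ito_step1 : normc (cexp z - 1 - z - B ^+ 2 / 2 * (D ^+ 2)%:C) <=
  ito_error_cst1 A B * (e * q).
Proof.
have -> : cexp z - 1 - z - B ^+ 2 / 2 * (D ^+ 2)%:C =
    (cexp z - 1 - z - z ^+ 2 / 2) +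
    (A * B * (tau * D)%:C + A ^+ 2 / 2 * (tau ^+ 2)%:C).
  rewrite /z ?(rmorphXn, rmorphM)/=; by field.

rewrite /ito_error_cst1 -(addrA (8 * _)) mulrDl (le_trans (le_normcD _ _))// lerD//.
  have -> : 8 * ((normc A + normc B) * (2 * (normc A ^+ 2 + normc B ^+ 2)) *
    expR (normc A + normc B)) * (e * q) = 8 * ((L * e) * (c * q) * expR L).
    by rewrite -/a -/b -/L -/c; ring.
  rewrite (le_trans (cexp_taylor2 _))// ler_pM2l//.
  apply: ler_pM; rewrite ?exprn_ge0 ?normc_ge0 ?expR_ge0 ?ler_expR//.
  by rewrite exprS ler_pM ?exprn_ge0 ?normc_ge0.
rewrite (le_trans (le_normcD _ _))// mulrDl !normcM !normc_real lerD//.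
  by rewrite ler_wpM2l ?mulr_ge0// normrM (ger0_norm t0).
rewrite -expr2 -/a -mulrA ler_wpM2l ?sqr_ge0// (ger0_norm (sqr_ge0 _)).
rewrite -[leRHS]mul1r ler_pM ?normc_ge0 ?sqr_ge0//.
  by rewrite normcV (_ : 2 = 2%:R%:C) ?normc_real ?rmorph_nat// ger0_norm// invf_le1// ler1n.
by rewrite expr2 ler_pM.
Qed.

(** One order less of the exponential suffices, since the extra factor [D] is itself at most [e];
    the only second-order product discarded is [A tau D]. *)
Lemma ito_step2 : normc ((cexp z - 1) * D%:C - B * (D ^+ 2)%:C) <=
  ito_error_cst2 A B * (e * q).
Proof.
have -> : (cexp z - 1) * D%:C - B * (D ^+ 2)%:C =
    (cexp z - 1 - z) * D%:C + A * (tau * D)%:C.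
  rewrite /z ?(rmorphXn, rmorphM)/=; ring.
rewrite (le_trans (le_normcD _ _))// /ito_error_cst2 [leRHS]mulrDl.
rewrite !normcM !normc_real lerD//.
  rewrite (_ : 4 * (_ * _) * (e * q) = (4 * (c * q * expR L)) * e); last first.
    by rewrite -/a -/b -/c -/L; ring.
  rewrite ler_pM ?normc_ge0// (le_trans (cexp_taylor1 _))// ler_pM2l//.
  by rewrite ler_pM ?exprn_ge0 ?normc_ge0 ?expR_ge0// ler_expR.
by rewrite ler_wpM2l ?normc_ge0// normrM (ger0_norm t0).
Qed.

End step_estimates.
End pathwise_ito.

(** * Limits of Ito sums and covariation sums along one path *)

Section pathwise_ito_limit.
Variable R : realType.
Notation Re := complex.Re.
Notation Im := complex.Im.
Variables (A B x0 : R[i]) (f : R -> R) (t : R).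
Variables (p : nat -> nat -> R) (N : nat -> nat) (m : nat -> R).
Hypothesis cf : {within `[0, t], continuous f}.
Hypotheses (p0 : forall n, p n 0%N = 0) (pN : forall n, p n (N n) = t).
Hypothesis pm : forall n k, (k < N n)%N -> p n k <= p n k.+1 <= p n k + m n.
Hypothesis m0 : m n @[n --> \oo] --> (0 : R).
Let Z := geometric_path A B x0 f.
Let D n k := f (p n k.+1) - f (p n k).
Let tau n k := p n k.+1 - p n k.
(** These three limits carry all the Brownian character of the path; the rest of the section is
    deterministic. *)
Hypothesis qv : \sum_(0 <= k < N n) (D n k ^+ 2 - tau n k) @[n --> \oo] --> (0 : R).
Hypothesis qvRe :
  \sum_(0 <= k < N n) Re (Z (p n k)) * (D n k ^+ 2 - tau n k) @[n --> \oo] --> (0 : R).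
Hypothesis qvIm :
  \sum_(0 <= k < N n) Im (Z (p n k)) * (D n k ^+ 2 - tau n k) @[n --> \oo] --> (0 : R).

Let ple n k l : (k <= l)%N -> (l <= N n)%N -> p n k <= p n l.
Proof.
elim: l => [|l IH]; first by rewrite leqn0 => /eqP ->.
rewrite leq_eqVlt => /predU1P[->//|kl lN].
by rewrite (le_trans (IH kl (ltnW lN)))//; have /andP[] := pm lN.
Qed.

Let pitv n k : (k <= N n)%N -> 0 <= p n k <= t.
Proof. by move=> kN; rewrite -{1}(p0 n) ple//= -(pN n) ple. Qed.

Let cZ : {within `[0, t], continuous (fun s => Re (Z s))} /\
  {within `[0, t], continuous (fun s => Im (Z s))}.
Proof. exact: geometric_path_continuous. Qed.

Let riemannZ : ccvg (fun n => \sum_(0 <= k < N n) Z (p n k) * (tau n k)%:C)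
  (cRintegral Z t).
Proof.
have [cR cI] := cZ.
apply: ccvg_ReIm => /=.
- under eq_fun do rewrite cRe_sum.
  apply: cvg_trans (riemann_sum_cvg cR p0 pN pm m0).
  apply: near_eq_cvg; near=> n; apply: eq_bigr => k _.
  by rewrite cReMr.
- under eq_fun do rewrite cIm_sum.
  apply: cvg_trans (riemann_sum_cvg cI p0 pN pm m0).
  apply: near_eq_cvg; near=> n; apply: eq_bigr => k _.
  by rewrite cImMr.
Unshelve. all: by end_near. Qed.

(** Replacing [(df)^2] by [dt] costs the assumed null sums and leaves Riemann sums. *)
Let weighted_qv : ccvg (fun n => \sum_(0 <= k < N n) Z (p n k) * (D n k ^+ 2)%:C)
  (cRintegral Z t).
Proof.
have -> : (fun n => \sum_(0 <= k < N n) Z (p n k) * (D n k ^+ 2)%:C) =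
  (fun n => \sum_(0 <= k < N n) Z (p n k) * (D n k ^+ 2 - tau n k)%:C +
            \sum_(0 <= k < N n) Z (p n k) * (tau n k)%:C).
  apply/funext => n; rewrite -big_split/=; apply: eq_bigr => k _.
  by rewrite -mulrDr -rmorphD/= subrK.
rewrite -[cRintegral Z t]add0r; apply: ccvgD => //; apply: ccvg_ReIm => /=.
- under eq_fun do rewrite cRe_sum.
  apply: cvg_trans qvRe; apply: near_eq_cvg; near=> n; apply: eq_bigr => k _.
  by rewrite cReMr.
- under eq_fun do rewrite cIm_sum.
  apply: cvg_trans qvIm; apply: near_eq_cvg; near=> n; apply: eq_bigr => k _.
  by rewrite cImMr.
Unshelve. all: by end_near. Qed.

Let small_steps e : 0 < e -> \forall n \near \oo, forall k, (k < N n)%N ->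
  0 <= tau n k <= e /\ `|D n k| <= e.
Proof.
move=> e0; have [r r0 hr] := within_unif_continuous cf e0.
have /cvgrPdist_le := m0 => m0'.
have := m0' _ r0; apply: filter_app; have := m0' _ e0; apply: filterS.
move=> n; rewrite sub0r normrN => me mr k kN.
have /andP[pp ppm] := pm kN.
have tm : tau n k <= m n by rewrite lerBlDl.
split; first by rewrite subr_ge0 pp (le_trans tm)// (le_trans (ler_norm _) me).
rewrite hr ?pitv//; first exact: ltnW.
by rewrite ger0_norm ?subr_ge0// (le_trans tm)// (le_trans (ler_norm _) mr).
Qed.

(** The time steps sum to [t] and the squared increments to [t + o(1)]. *)
Let total_bounded : \forall n \near \oo,
  \sum_(0 <= k < N n) (tau n k + D n k ^+ 2) <= 2 * t + 1.
Proof.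
have /cvgrPdist_le/(_ _ ltr01) := qv; apply: filterS => n.
rewrite sub0r normrN => h.
have -> : \sum_(0 <= k < N n) (tau n k + D n k ^+ 2) =
   2 * t + \sum_(0 <= k < N n) (D n k ^+ 2 - tau n k).
  have <- : \sum_(0 <= k < N n) tau n k = t by rewrite telescope_sumr// pN p0 subr0.
  rewrite mulr_sumr -big_split/=; apply: eq_bigr => k _; ring.
by rewrite lerD2l (le_trans (ler_norm _) h).
Qed.

Let sum_error (E : nat -> nat -> R[i]) (K : R) : 0 <= K ->
  (forall e n k, 0 < e <= 1 -> (k < N n)%N -> 0 <= tau n k <= e -> `|D n k| <= e ->
    normc (E n k) <= K * (e * (tau n k + D n k ^+ 2))) ->
  ccvg (fun n => \sum_(0 <= k < N n) E n k) 0.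
Proof.
move=> K0 HE; apply: (@ccvg0_linear_bound _ _ (K * (2 * t + 1))) => e e01.
have /small_steps : 0 < e by case/andP: e01.
apply: filter_app; have := total_bounded; apply: filterS => n tb st.
apply: (le_trans (le_normc_sum _ _)).
apply: (@le_trans _ _ (\sum_(0 <= k < N n) (K * e) * (tau n k + D n k ^+ 2))).
  rewrite big_nat_cond [leRHS]big_nat_cond; apply: ler_sum => k /andP[/andP[_ kN] _].
  by have [h1 h2] := st k kN; rewrite -mulrA; apply: HE.
rewrite -mulr_sumr [leRHS]mulrAC ler_wpM2l// mulr_ge0//.
by case/andP: e01 => /ltW.
Qed.

Let Zbounded : exists2 M : R, 0 <= M & forall s, 0 <= s <= t -> normc (Z s) <= M.
Proof.
have [cR cI] := cZ.
have [M1 M10 h1] := within_continuous_bounded cR.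
have [M2 M20 h2] := within_continuous_bounded cI.
exists (M1 + M2); first exact: addr_ge0.
by move=> s st; rewrite (le_trans (normc_le_ReIm _))// lerD ?h1 ?h2.
Qed.

Let Zstep n k : Z (p n k.+1) =
  Z (p n k) * cexp (A * (tau n k)%:C + B * (D n k)%:C).
Proof. exact: geometric_path_step. Qed.

(** To first order an increment of [Z] is [B Z df], which turns the sums into [B] times the weighted
    quadratic variation. Half of the limit is the Stratonovich correction. *)
Lemma pathwise_covariation :
  ccvg (fun n => \sum_(0 <= k < N n) (Z (p n k.+1) - Z (p n k)) * (D n k)%:C)
    (B * cRintegral Z t).
Proof.
have [M M0 ZM] := Zbounded.
pose E n k := (Z (p n k.+1) - Z (p n k)) * (D n k)%:C -
  B * (Z (p n k) * (D n k ^+ 2)%:C).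
have -> : (fun n => \sum_(0 <= k < N n) (Z (p n k.+1) - Z (p n k)) * (D n k)%:C) =
  (fun n => \sum_(0 <= k < N n) E n k +
     B * \sum_(0 <= k < N n) Z (p n k) * (D n k ^+ 2)%:C).
  apply/funext => n; rewrite mulr_sumr -big_split/=; apply: eq_bigr => k _.
  by rewrite /E subrK.
rewrite -[B * cRintegral Z t]add0r; apply: ccvgD; last exact: ccvgZ.
apply: (@sum_error _ (M * ito_error_cst2 A B)).
  by rewrite mulr_ge0// !(addr_ge0, mulr_ge0) ?sqr_ge0 ?normc_ge0 ?expR_ge0.
move=> e n k e01 kN te De.
have -> : E n k = Z (p n k) * ((cexp (A * (tau n k)%:C + B * (D n k)%:C) - 1) *
    (D n k)%:C - B * (D n k ^+ 2)%:C).
  by rewrite /E Zstep; ring.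
rewrite normcM -(mulrA M); apply: ler_pM; rewrite ?normc_ge0 ?ZM ?pitv ?(ltnW kN)//.
exact: ito_step2.
Qed.

(** The expansion [dZ = A Z dt + B Z df + B^2 Z (df)^2 / 2] is telescoped over the partition and
    solved for the middle sum: Ito's formula for the exponential, read backwards as the value of the
    Ito integral. *)
Lemma pathwise_ito : B != 0 ->
  ccvg (fun n => \sum_(0 <= k < N n) Z (p n k) * (D n k)%:C)
    ((Z t - x0 - A * cRintegral Z t) / B - B / 2 * cRintegral Z t).
Proof.
move=> B0; have [M M0 ZM] := Zbounded.
pose E n k := Z (p n k.+1) - Z (p n k) - A * (Z (p n k) * (tau n k)%:C)
  - B * (Z (p n k) * (D n k)%:C) - B ^+ 2 / 2 * (Z (p n k) * (D n k ^+ 2)%:C).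
have cE : ccvg (fun n => \sum_(0 <= k < N n) E n k) 0.
  apply: (@sum_error _ (M * ito_error_cst1 A B)).
    by rewrite mulr_ge0// !(addr_ge0, mulr_ge0) ?sqr_ge0 ?normc_ge0 ?expR_ge0.
  move=> e n k e01 kN te De.
  have -> : E n k = Z (p n k) * (cexp (A * (tau n k)%:C + B * (D n k)%:C) - 1 -
      (A * (tau n k)%:C + B * (D n k)%:C) - B ^+ 2 / 2 * (D n k ^+ 2)%:C).
    by rewrite /E Zstep; field.
  rewrite normcM -(mulrA M); apply: ler_pM; rewrite ?normc_ge0 ?ZM ?pitv ?(ltnW kN)//.
  exact: ito_step1.
have -> : (fun n => \sum_(0 <= k < N n) Z (p n k) * (D n k)%:C) =
  (fun n => (Z t - x0) / B + (- (A / B) * \sum_(0 <= k < N n) Z (p n k) * (tau n k)%:C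
    + (- (B / 2) * \sum_(0 <= k < N n) Z (p n k) * (D n k ^+ 2)%:C
    + (- B^-1) * \sum_(0 <= k < N n) E n k))).
  apply/funext => n.
  have -> : Z t - x0 = \sum_(0 <= k < N n) (Z (p n k.+1) - Z (p n k)).
    rewrite telescope_sumr// pN p0; congr (_ - _).
    by rewrite /Z /geometric_path subrr !mulr0 addr0 cexp0 mulr1.
  rewrite mulr_suml !mulr_sumr -!big_split/=; apply: eq_bigr => k _.
  by rewrite /E; field.
have -> : (Z t - x0 - A * cRintegral Z t) / B - B / 2 * cRintegral Z t =
  (Z t - x0) / B + (- (A / B) * cRintegral Z t
    + (- (B / 2) * cRintegral Z t + (- B^-1) * 0)) by field.
apply: ccvgD; first exact: ccvg_cst.
apply: ccvgD; first exact: ccvgZ.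
by apply: ccvgD; exact: ccvgZ.
Qed.

End pathwise_ito_limit.

(** * Moments of normal variables *)

Section real_integrands.
Context (R : realType) (d : measure_display) (T : measurableType d).
Variable P : probability T R.
Implicit Types f g : T -> R.

Lemma ge0_le_integral_EFin f g :
  measurable_fun setT f -> measurable_fun setT g ->
  (forall w, 0 <= f w) -> (forall w, f w <= g w) ->
  (\int[P]_w (f w)%:E <= \int[P]_w (g w)%:E)%E.
Proof.
move=> mf mg f0 fg.
have mf' : measurable_fun setT (fun w => (f w)%:E) by exact/measurable_EFinP.
have mg' : measurable_fun setT (fun w => (g w)%:E) by exact/measurable_EFinP.
by apply: (ge0_le_integral P measurableT _ mf' mg') => w _; rewrite lee_fin.
Qed.

Lemma ge0_integralZl_EFin (k : R) f :
  measurable_fun setT f -> 0 <= k -> (forall w, 0 <= f w) ->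
  (\int[P]_w (k * f w)%:E = k%:E * \int[P]_w (f w)%:E)%E.
Proof.
move=> mf k0 f0.
have mf' : measurable_fun setT (fun w => (f w)%:E) by exact/measurable_EFinP.
rewrite -(ge0_integralZl P measurableT mf' (k := k%:E)) ?lee_fin// => w _.
by rewrite lee_fin.
Qed.

Lemma ge0_integralD_EFin f g :
  measurable_fun setT f -> measurable_fun setT g ->
  (forall w, 0 <= f w) -> (forall w, 0 <= g w) ->
  (\int[P]_w (f w + g w)%:E = \int[P]_w (f w)%:E + \int[P]_w (g w)%:E)%E.
Proof.
move=> mf mg f0 g0.
have mf' : measurable_fun setT (fun w => (f w)%:E) by exact/measurable_EFinP.
have mg' : measurable_fun setT (fun w => (g w)%:E) by exact/measurable_EFinP.
rewrite -(ge0_integralD P measurableT _ mf' _ mg')// => w _;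
by rewrite lee_fin.
Qed.

Lemma integrable_EFin_bound f (C : R) : measurable_fun setT f ->
  (\int[P]_w (`|f w|)%:E <= C%:E)%E -> P.-integrable setT (EFin \o f).
Proof.
move=> mf fC; apply/integrableP; split; first exact/measurable_EFinP.
by apply: le_lt_trans fC _; rewrite ltry.
Qed.

Lemma Rintegral_norm_le f (C : R) : measurable_fun setT f ->
  (\int[P]_w (`|f w|)%:E <= C%:E)%E -> `|\int[P]_w f w| <= C.
Proof.
move=> mf fC; have i := integrable_EFin_bound mf fC.
rewrite -lee_fin (EFin_normr_Rintegral _ i)//.
by apply: le_trans fC; apply: le_abse_integral => //; exact/measurable_EFinP.
Qed.

Lemma Rintegral_prob_cst (c : R) : \int[P]_w c = c.
Proof. by have := expectation_cst P c; rewrite unlock /Rintegral/= => ->. Qed.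

Lemma integrable_fin_measurable f : P.-integrable setT (EFin \o f) ->
  measurable_fun setT f.
Proof. by move/integrableP => [/measurable_EFinP]. Qed.

End real_integrands.

Section normal_moments.
Variable R : realType.

Lemma cexp_real (x : R) : cexp x%:C = (expR x)%:C.
Proof.
by apply: complex_ext; rewrite ?Re_cexp ?Im_cexp/= ?cos0 ?sin0 ?mulr1 ?mulr0.
Qed.

Lemma expR_taylor1 (x : R) : `|expR x - 1 - x| <= 4 * (`|x| ^+ 2 * expR `|x|).
Proof.
have := cexp_taylor1 x%:C.
have -> : cexp x%:C - 1 - x%:C = (expR x - 1 - x)%:C.
  by rewrite cexp_real !rmorphB.
by rewrite !normc_real.
Qed.

Lemma expR_taylor2 (x : R) :
  `|expR x - 1 - x - x ^+ 2 / 2| <= 8 * (`|x| ^+ 3 * expR `|x|).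
Proof.
have := cexp_taylor2 x%:C.
have -> : cexp x%:C - 1 - x%:C - x%:C ^+ 2 / 2 =
    (expR x - 1 - x - x ^+ 2 / 2)%:C.
  by rewrite cexp_real !rmorphB/= rmorphM rmorphXn fmorphV/= rmorph_nat.
by rewrite !normc_real.
Qed.

(** The Radon-Nikodym derivative of [normal_prob] agrees almost everywhere with [normal_pdf],
    because both have the same integrals over measurable sets. *)
Lemma ge0_integral_normal_prob (m s : R) (f : measurableTypeR R -> \bar R) :
  measurable_fun setT f -> (forall x, (0 <= f x)%E) ->
  (\int[normal_prob m s]_x f x =
   \int[lebesgue_measure]_x (f x * (normal_pdf m s x)%:E))%E.
Proof.
move=> mf f0; have dom := normal_prob_dominates m s.
rewrite -(Radon_Nikodym_SigmaFinite.change_of_variables dom)//.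
have mpdf : measurable_fun setT (fun x => (normal_pdf m s x)%:E).
  by apply/measurable_EFinP; exact: measurable_normal_pdf.
have int_RN := Radon_Nikodym_SigmaFinite.f_integrable dom.
apply: ae_eq_integral => //.
- by apply: emeasurable_funM => //; exact: measurable_int int_RN.
- exact: emeasurable_funM.
- apply: ae_eqe_mul2l; apply: integral_ae_eq => // E _ mE.
  by rewrite -(Radon_Nikodym_SigmaFinite.f_integral dom).
Qed.

Section normal_variable.
Context (d : measure_display) (T : measurableType d) (P : probability T R).
Variables (X : T -> R) (s : R).
Hypotheses (mX : measurable_fun setT X) (s0 : 0 < s).
Hypothesis law : forall B : set R, measurable B -> P (X @^-1` B) = normal_prob 0 s B.

Lemma ge0_expectation_normal (g : R -> R) : measurable_fun setT g ->
  (forall x, 0 <= g x) ->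
  (\int[P]_w (g (X w))%:E =
   \int[lebesgue_measure]_x (g x * normal_pdf 0 s x)%:E)%E.
Proof.
move=> mg g0.
have mEg : measurable_fun setT (EFin \o g : measurableTypeR R -> \bar R).
  exact/measurable_EFinP.
have mX' : measurable_fun setT (X : T -> measurableTypeR R) by exact: mX.
rewrite -(ge0_integral_normal_prob 0 s mEg)//=.
rewrite (eq_measure_integral (pushforward P (X : T -> measurableTypeR R)))/=.
  by rewrite (ge0_integral_pushforward mX')//= => x _; rewrite lee_fin.
by move=> A mA _; rewrite /pushforward law.
Qed.

(** Completing the square: [expR (l x)] times the centred density is [expR (l^2 s^2 / 2)] times the
    density with mean [l s^2], of total mass 1. *)
Lemma normal_mgf (l : R) :
  (\int[P]_w (expR (l * X w))%:E = (expR (l ^+ 2 * s ^+ 2 / 2))%:E)%E.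
Proof.
have ml : measurable_fun setT (fun x : R => expR (l * x)).
  by apply: measurableT_comp => //; exact: measurable_funM.
rewrite (ge0_expectation_normal ml) => [|x]; last exact: expR_ge0.
have sn0 : s != 0 by rewrite gt_eqF.
transitivity (\int[lebesgue_measure]_x
    ((expR (l ^+ 2 * s ^+ 2 / 2))%:E * (normal_pdf (l * s ^+ 2) s x)%:E))%E.
  apply: eq_integral => x _; rewrite -EFinM; congr EFin.
  rewrite !normal_pdfE// mulrCA [RHS]mulrCA; congr (_ * _).
  rewrite /normal_fun -!expRD; congr expR; field.
  exact: sn0.
rewrite ge0_integralZl//; last first.
- by move=> x _; rewrite lee_fin normal_pdf_ge0.
- by apply/measurable_EFinP; exact: measurable_normal_pdf.
by rewrite integral_normal_pdf mule1.
Qed.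


(** By [y^n <= n! e^y] at [y = |x| / s], the integrand [|x|^n e^(c |x|)] is at most
    [n! s^n e^(l |x|)] with [l = c + 1/s]; both [e^(l x)] and [e^(- l x)] have mean
    [exp((c s + 1)^2 / 2)]. The factor [s ^+ n] later becomes the power [n / 2] of a time step. *)
Definition normal_abs_cst (n : nat) (c s : R) : R :=
  n`!%:R * s ^+ n * (2 * expR ((c * s + 1) ^+ 2 / 2)).

Lemma normal_abs_cst_ge0 n c : 0 <= normal_abs_cst n c s.
Proof. by rewrite !mulr_ge0 ?exprn_ge0 ?expR_ge0 ?(ltW s0). Qed.

Lemma pow_le_fact_expR n (y : R) : 0 <= y -> y ^+ n <= n`!%:R * expR y.
Proof.
case: n => [|n] y0; first by rewrite expr0 mul1r -expR0 ler_expR.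
have := expR_ge1Dxn n y0; rewrite -ler_pdivrMl ?ltr0n ?fact_gt0//.
by apply: le_trans; rewrite mulrC lerDr.
Qed.

Lemma expR_abs_le (y : R) : expR `|y| <= expR y + expR (- y).
Proof. by case: (ger0P y) => _; rewrite ?lerDl ?lerDr expR_ge0. Qed.

Lemma normal_abs_bound n c : 0 <= c ->
  (\int[P]_w (`|X w| ^+ n * expR (c * `|X w|))%:E <= (normal_abs_cst n c s)%:E)%E.
Proof.
move=> c0; pose l := c + s^-1; pose C : R := n`!%:R * s ^+ n.
have C0 : 0 <= C by rewrite mulr_ge0// exprn_ge0// ltW.
have l0 : 0 <= l by rewrite addr_ge0// invr_ge0 ltW.
have mexp k : measurable_fun setT (fun w => expR (k * X w)).
  by apply: measurableT_comp => //; exact: measurable_funM.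
have pw w : `|X w| ^+ n * expR (c * `|X w|) <=
    C * (expR (l * X w) + expR (- l * X w)).
  have Xs0 : 0 <= `|X w| / s by rewrite divr_ge0// ltW.
  have := pow_le_fact_expR n Xs0; rewrite expr_div_n ler_pdivrMr ?exprn_gt0// => h.
  apply: (@le_trans _ _ (n`!%:R * expR (`|X w| / s) * s ^+ n * expR (c * `|X w|))).
    by rewrite ler_wpM2r ?expR_ge0.
  have -> : n`!%:R * expR (`|X w| / s) * s ^+ n * expR (c * `|X w|) =
      C * expR `|l * X w|.
    rewrite normrM (ger0_norm l0) /l mulrDl expRD /C (mulrC `|X w|); ring.
  by rewrite ler_wpM2l// mulNr expR_abs_le.
have mD : measurable_fun setT (fun w => expR (l * X w) + expR (- l * X w)).
  exact: measurable_funD.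
have D0 w : 0 <= expR (l * X w) + expR (- l * X w) by rewrite addr_ge0 ?expR_ge0.
apply: (le_trans (ge0_le_integral_EFin P _ _ _ pw)).
- apply: measurable_funM; first by apply: measurable_funX; exact: measurableT_comp.
  by apply: measurableT_comp => //; apply: measurable_funM => //; exact: measurableT_comp.
- exact: measurable_funM.
- by move=> w; rewrite mulr_ge0 ?exprn_ge0 ?expR_ge0.
rewrite ge0_integralZl_EFin// ge0_integralD_EFin//; try by move=> w; exact: expR_ge0.
rewrite !normal_mgf -EFinD -EFinM lee_fin sqrrN /normal_abs_cst -/C.
have -> : (c * s + 1) ^+ 2 / 2 = l ^+ 2 * s ^+ 2 / 2.
  by rewrite /l; field; rewrite gt_eqF.
by rewrite (mulrDl 1 1) mul1r.
Qed.

Section bounded_by_exponential.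
Variables (g : R -> R) (n : nat) (C c : R).
Hypotheses (mg : measurable_fun setT g) (c0 : 0 <= c) (C0 : 0 <= C).
Hypothesis gC : forall x, `|g x| <= C * (`|x| ^+ n * expR (c * `|x|)).

Lemma normal_norm_integral_le :
  (\int[P]_w (`|g (X w)|)%:E <= (C * normal_abs_cst n c s)%:E)%E.
Proof.
have mgX : measurable_fun setT (fun w => g (X w)) by exact: measurableT_comp.
have mb : measurable_fun setT (fun w => `|X w| ^+ n * expR (c * `|X w|)).
  apply: measurable_funM; first by apply: measurable_funX; exact: measurableT_comp.
  by apply: measurableT_comp => //; apply: measurable_funM => //; exact: measurableT_comp.
have pw w := gC (X w).
apply: (le_trans (ge0_le_integral_EFin P _ _ _ pw)) => //.
- exact: measurableT_comp.
- exact: measurable_funM.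
by rewrite ge0_integralZl_EFin// EFinM lee_wpmul2l ?lee_fin// normal_abs_bound.
Qed.

Lemma normal_integrable : P.-integrable setT (EFin \o (fun w => g (X w))).
Proof. by apply: integrable_EFin_bound normal_norm_integral_le; exact: measurableT_comp. Qed.

Lemma normal_integral_le : `|\int[P]_w g (X w)| <= C * normal_abs_cst n c s.
Proof. by apply: Rintegral_norm_le normal_norm_integral_le; exact: measurableT_comp. Qed.

End bounded_by_exponential.

Lemma normal_pow_integrable n : P.-integrable setT (EFin \o (fun w => X w ^+ n)).
Proof.
have mg : measurable_fun setT (fun x : R => x ^+ n) by exact: measurable_funX.
apply: (normal_integrable (n := n) mg (lexx 0) ler01) => x.
by rewrite mul0r expR0 mulr1 mul1r normrX.
Qed.

Lemma normal_expR_integrable (l : R) :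
  P.-integrable setT (EFin \o (fun w => expR (l * X w))).
Proof.
have mg : measurable_fun setT (fun x : R => expR (l * x)).
  by apply: measurableT_comp => //; exact: measurable_funM.
apply: (normal_integrable (n := 0) mg (normr_ge0 l) ler01) => x.
by rewrite mul1r expr0 mul1r ger0_norm ?expR_ge0// ler_expR -normrM ler_norm.
Qed.

(** Both moments are read off the generating function: comparing the expansions of [E exp(l X)] and
    [exp(l^2 s^2 / 2)] bounds a polynomial in [l] of degree 2 by [C l^3], so its coefficients vanish
    one after the other. *)
Lemma normal_mean_variance : \int[P]_w X w = 0 /\ \int[P]_w X w ^+ 2 = s ^+ 2.
Proof.
pose m := \int[P]_w X w; pose v := \int[P]_w X w ^+ 2.
(* The first summand controls the third-order remainder of [E exp(l X)]; the second controls the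
   remainder of [exp(l^2 s^2 / 2)], which is of order [l^4]. *)
pose C : R := 8 * normal_abs_cst 3 1 s + (s ^+ 2) ^+ 2 * expR (s ^+ 2).
have main (l : R) : 0 < l <= 1 -> `|l * m + l ^+ 2 * ((v - s ^+ 2) / 2)| <= C * l ^+ 3.
  case/andP => l0 l1.
  pose r x := expR (l * x) - 1 - l * x - (l * x) ^+ 2 / 2.
  have mr : measurable_fun setT r.
    have ml : measurable_fun setT (fun x : R => l * x) by exact: measurable_funM.
    apply: measurable_funB; last by apply: measurable_funM => //; exact: measurable_funX.
    apply: measurable_funB => //; apply: measurable_funB => //.
    exact: measurableT_comp.
  have rb x : `|r x| <= (8 * l ^+ 3) * (`|x| ^+ 3 * expR (1 * `|x|)).
    rewrite (le_trans (expR_taylor2 _))// normrM (gtr0_norm l0).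
    have -> : 8 * l ^+ 3 * (`|x| ^+ 3 * expR (1 * `|x|)) =
      8 * ((l * `|x|) ^+ 3 * expR `|x|) by rewrite mul1r; ring.
    by rewrite ler_pM2l// ler_wpM2l ?exprn_ge0 ?mulr_ge0 ?(ltW l0)// ler_expR ler_piMl.
  have C0 : 0 <= 8 * l ^+ 3 by rewrite mulr_ge0// exprn_ge0// ltW.
  have Ir := normal_integral_le mr ler01 C0 rb.
  have i1 : P.-integrable setT (EFin \o (fun w => X w)).
    by have := normal_pow_integrable 1; under eq_fun do rewrite expr1.
  have i2 := normal_pow_integrable 2.
  have ie := normal_expR_integrable l.
  have Er : \int[P]_w r (X w) = expR (l ^+ 2 * s ^+ 2 / 2) - 1 - l * m - l ^+ 2 / 2 * v.
    have ic : P.-integrable setT (EFin \o (fun=> 1 : R) : T -> \bar R).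
      by have := normal_pow_integrable 0; under eq_fun do rewrite expr0.
    have i1' : P.-integrable setT (EFin \o (fun w => l * X w)).
      by have := integrableZl measurableT l i1; apply: eq_integrable.
    have i2' : P.-integrable setT (EFin \o (fun w => l ^+ 2 / 2 * X w ^+ 2)).
      by have := integrableZl measurableT (l ^+ 2 / 2) i2; apply: eq_integrable.
    have ie1 : P.-integrable setT (EFin \o (fun w => expR (l * X w) - 1)).
      by have := integrableB measurableT ie ic; apply: eq_integrable.
    have ie2 : P.-integrable setT (EFin \o (fun w => expR (l * X w) - 1 - l * X w)).
      by have := integrableB measurableT ie1 i1'; apply: eq_integrable.
    transitivity (\int[P]_w (expR (l * X w) - 1 - l * X w - l ^+ 2 / 2 * X w ^+ 2)).
      by apply: eq_Rintegral => w _; rewrite /r exprMn; ring.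
    rewrite !RintegralB// !RintegralZl// Rintegral_prob_cst.
    by rewrite /Rintegral normal_mgf.
  have := expR_taylor1 (l ^+ 2 * s ^+ 2 / 2).
  set y := l ^+ 2 * s ^+ 2 / 2.
  have y0 : 0 <= y by exact: divr_ge0 (mulr_ge0 (sqr_ge0 _) (sqr_ge0 _)) (ler0n _ 2).
  rewrite (ger0_norm y0) => ey.
  have ys : y <= s ^+ 2.
    have l21 : l ^+ 2 <= 1 by rewrite exprn_ile1// ltW.
    rewrite /y mulrAC ler_piMl ?sqr_ge0//; lra.
  have eyb : 4 * (y ^+ 2 * expR y) <= (s ^+ 2) ^+ 2 * expR (s ^+ 2) * l ^+ 3.
    have -> : 4 * (y ^+ 2 * expR y) = (s ^+ 2) ^+ 2 * (l ^+ 4 * expR y) by rewrite /y; field.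
    rewrite -mulrA ler_wpM2l ?sqr_ge0// [leRHS]mulrC ler_pM ?exprn_ge0 ?expR_ge0 ?ler_expR ?(ltW l0)//.
    by rewrite exprS ler_piMl// exprn_ge0// ltW.
  have -> : l * m + l ^+ 2 * ((v - s ^+ 2) / 2) =
      (expR y - 1 - y) - (expR y - 1 - l * m - l ^+ 2 / 2 * v) by rewrite /y; field.
  rewrite (le_trans (ler_normB _ _))// /C mulrDl addrC lerD//.
    by rewrite -Er (le_trans Ir)// mulrAC.
  exact: le_trans ey eyb.
(* If [k] were nonzero, the choice of [l] as the minimum of 1 and [|k| / (2 K)] would give
   [|k| <= |k| / 2]. *)
have small (k K : R) : (forall l, 0 < l <= 1 -> `|k| <= K * l) -> k = 0.
  move=> H; apply/eqP; rewrite -normr_le0 leNgt; apply/negP => k0.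
  have K0 : 0 < K by have := H 1; rewrite mulr1 ltr01 lexx => /(_ isT); exact: lt_le_trans.
  have := H (Num.min 1 (`|k| / (2 * K))).
  rewrite lt_min ltr01 divr_gt0 ?mulr_gt0// ge_min lexx => /(_ isT).
  apply/negP; rewrite -ltNge; apply: (@le_lt_trans _ _ (K * (`|k| / (2 * K)))).
    by rewrite ler_pM2l// ge_min lexx orbT.
  have -> : K * (`|k| / (2 * K)) = `|k| / 2 by field; rewrite gt_eqF.
  by rewrite ltr_pdivrMr// ltr_pMr// ltr1n.
have m0 : m = 0.
  apply: (small _ (C + `|(v - s ^+ 2) / 2|)) => l /[dup] l01 /andP[l0 l1].
  rewrite -(ler_pM2l l0) -[X in X * `|m|](gtr0_norm l0) -normrM.
  have -> : l * m = (l * m + l ^+ 2 * ((v - s ^+ 2) / 2)) - l ^+ 2 * ((v - s ^+ 2) / 2) by ring.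
  rewrite (le_trans (ler_normB _ _))//.
  have -> : l * ((C + `|(v - s ^+ 2) / 2|) * l) = C * l ^+ 2 + l ^+ 2 * `|(v - s ^+ 2) / 2| by ring.
  apply: lerD; last by rewrite normrM ger0_norm// sqr_ge0.
  rewrite (le_trans (main l l01))// ler_wpM2l//.
    by rewrite addr_ge0// mulr_ge0 ?normal_abs_cst_ge0 ?expR_ge0 ?sqr_ge0.
  by rewrite exprS ler_piMl// sqr_ge0.
split=> //; apply/eqP; rewrite -subr_eq0; apply/eqP.
suff : (v - s ^+ 2) / 2 = 0 by move=> /(congr1 (fun x => x * 2)); rewrite mulfVK ?mul0r.
apply: (small _ C) => l /[dup] l01 /andP[l0 l1].
have := main l l01; rewrite m0 mulr0 add0r normrM (ger0_norm (sqr_ge0 l)).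
have -> : C * l ^+ 3 = l ^+ 2 * (C * l) by ring.
by rewrite ler_pM2l// exprn_gt0.
Qed.

End normal_variable.
End normal_moments.

(** * Brownian increments *)

Section independence.
Context (R : realType) (d : measure_display) (T : measurableType d).
Variable P : probability T R.
Implicit Types X Y : T -> R.

Lemma measurable_fun_mulp : measurable_fun setT (fun z : R * R => z.1 * z.2).
Proof. by apply: measurable_funM; [exact: measurable_fst|exact: measurable_snd]. Qed.

(** Factorization on rectangles identifies the joint law with the product of the two laws, and
    Fubini splits the mean. The computation with absolute values comes first, since it supplies the
    integrability that Fubini requires. *)
Lemma independent_integralM X Y :
  P.-integrable setT (EFin \o X) -> P.-integrable setT (EFin \o Y) ->
  (forall A B : set R, measurable A -> measurable B ->
    P (X @^-1` A `&` Y @^-1` B) = (P (X @^-1` A) * P (Y @^-1` B))%E) ->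
  P.-integrable setT (EFin \o (fun w => X w * Y w)) /\
  \int[P]_w (X w * Y w) = \int[P]_w X w * \int[P]_w Y w.
Proof.
move=> iX iY indep.
have mX := integrable_fin_measurable iX; have mY := integrable_fin_measurable iY.
pose X' : {mfun T >-> R} := mfun_Sub (mem_set mX).
pose Y' : {mfun T >-> R} := mfun_Sub (mem_set mY).
have mXY : measurable_fun setT (fun w => (X w, Y w)) by exact: measurable_fun_pair.
pose Z' : {mfun T >-> (R * R)%type} := mfun_Sub (mem_set mXY).
pose mu := distribution P X'; pose nu := distribution P Y'.
have prodE A : measurable A -> (mu \x nu)%E A = distribution P Z' A.
  by apply: product_measure_unique => B C mB mC; exact: indep.
pose f (z : R * R) := (z.1 * z.2)%:E.
have mf : measurable_fun setT f.
  by apply/measurable_EFinP; exact: measurable_fun_mulp.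
have absf : (\int[P]_w (`|X w * Y w|)%:E =
    \int[P]_w (`|X w|)%:E * \int[P]_w (`|Y w|)%:E)%E.
  have mnf : measurable_fun setT (fun z => `|f z|)%E by exact: measurableT_comp.
  transitivity (\int[distribution P Z']_z `|f z|)%E.
    by rewrite ge0_integral_distribution.
  rewrite (@eq_measure_integral _ _ _ _ (mu \x nu)%E)//; last first.
    by move=> A mA _; exact/esym/prodE.
  rewrite (fubini_tonelli1 (fun z => `|f z|)%E)//=.
  rewrite /fubini_F/=.
  have mn : measurable_fun setT (fun x : R => (`|x|)%:E).
    by apply/measurable_EFinP; exact: normr_measurable.
  under eq_integral => x _.
    under eq_integral => y _ do rewrite normrM EFinM.
    rewrite ge0_integralZl//=.
    over.
  rewrite /=.
  rewrite (ge0_integral_distribution Y' mn)//.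
  have Y0 : (0 <= \int[P]_w (`|Y w|)%:E)%E by apply: integral_ge0 => w _; rewrite lee_fin.
  rewrite ge0_integralZr//=.
  by rewrite (ge0_integral_distribution X' mn).
have iXY : P.-integrable setT (EFin \o (fun w => X w * Y w)).
  apply/integrableP; split; first by apply/measurable_EFinP; exact: measurable_funM.
  rewrite /= absf; move/integrableP: iX => [_ iX]; move/integrableP: iY => [_ iY].
  by rewrite lte_mul_pinfty// ?ge0_fin_numE//; apply: integral_ge0 => w _; rewrite lee_fin.
split => //.
have iD : (distribution P Z').-integrable setT f.
  apply/integrableP; split => //.
  rewrite ge0_integral_distribution//; last exact: measurableT_comp.
  by move/integrableP: iXY => [].
have imn : (mu \x nu)%E.-integrable setT f.
  apply/integrableP; split => //.
  rewrite (@eq_measure_integral _ _ _ _ (distribution P Z'))//; last first.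
    by move=> A mA _; exact: prodE.
  by move/integrableP: iD => [].
have mid : measurable_fun setT (fun x : R => x%:E) by exact/measurable_EFinP.
have fX : (\int[P]_w (X w)%:E)%E \is a fin_num by exact: integrable_fin_num iX.
have fY : (\int[P]_w (Y w)%:E)%E \is a fin_num by exact: integrable_fin_num iY.
have inu : nu.-integrable setT (fun x : R => x%:E).
  apply/integrableP; split => //; rewrite ge0_integral_distribution//; last exact: measurableT_comp.
  by move/integrableP: iY => [].
have imu : mu.-integrable setT (fun x : R => x%:E).
  apply/integrableP; split => //; rewrite ge0_integral_distribution//; last exact: measurableT_comp.
  by move/integrableP: iX => [].
rewrite /Rintegral -fineM//; congr fine.
transitivity (\int[distribution P Z']_z f z)%E; first by rewrite integral_distribution.
rewrite (@eq_measure_integral _ _ _ _ (mu \x nu)%E)//; last first.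
  by move=> A mA _; exact/esym/prodE.
rewrite -integral12_prod_meas1// /fubini_F/=.
under eq_integral => x _.
  under eq_integral => y _ do rewrite /f EFinM.
  rewrite integralZl//= (integral_distribution (P := P) (X := Y') mid)//.
  over.
rewrite /= -(fineK fY) integralZr//.
by rewrite (integral_distribution (X := X') mid).
Qed.

End independence.

Section measurable_wrt_closure.
Context (R : realType) (d : measure_display) (T : measurableType d).
Variable G : set (set T).
Hypothesis sG : sigma_algebra setT G.
Implicit Types X Y : T -> R.

(** As [G] is already a sigma-algebra, generating one from it adds nothing; closure properties of
    measurable functions on the generated type thus transfer to [measurable_wrt]. *)
Lemma measurable_wrtP X :
  measurable_wrt G X <-> measurable_fun setT (X : g_sigma_algebraType G -> R).
Proof.
split=> [mX _ B mB|mX B mB].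
  by rewrite setTI /measurable/= sigma_algebra_id//; exact: mX.
have := mX measurableT B mB.
by rewrite setTI /measurable/= sigma_algebra_id.
Qed.

Lemma measurable_wrt_cst (c : R) : measurable_wrt G (fun=> c).
Proof. by apply/measurable_wrtP. Qed.

Lemma measurable_wrt_comp X (g : R -> R) : measurable_fun setT g ->
  measurable_wrt G X -> measurable_wrt G (fun w => g (X w)).
Proof.
by move=> mg /measurable_wrtP mX; apply/measurable_wrtP; exact: measurableT_comp.
Qed.

Lemma measurable_wrtD X Y : measurable_wrt G X -> measurable_wrt G Y ->
  measurable_wrt G (fun w => X w + Y w).
Proof.
move=> /measurable_wrtP mX /measurable_wrtP mY; apply/measurable_wrtP.
exact: measurable_funD.
Qed.

Lemma measurable_wrtB X Y : measurable_wrt G X -> measurable_wrt G Y ->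
  measurable_wrt G (fun w => X w - Y w).
Proof.
move=> /measurable_wrtP mX /measurable_wrtP mY; apply/measurable_wrtP.
exact: measurable_funB.
Qed.

Lemma measurable_wrtM X Y : measurable_wrt G X -> measurable_wrt G Y ->
  measurable_wrt G (fun w => X w * Y w).
Proof.
move=> /measurable_wrtP mX /measurable_wrtP mY; apply/measurable_wrtP.
exact: measurable_funM.
Qed.

Lemma measurable_wrt_sum (X_ : nat -> T -> R) n :
  (forall k, (k < n)%N -> measurable_wrt G (X_ k)) ->
  measurable_wrt G (fun w => \sum_(0 <= k < n) X_ k w).
Proof.
elim: n => [_|n IH mX].
  under eq_fun do rewrite big_geq//.
  exact: measurable_wrt_cst.
under eq_fun do rewrite big_nat_recr//=.
by apply: measurable_wrtD; [apply: IH => k kn; apply: mX; exact: ltnW|exact: mX].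
Qed.

End measurable_wrt_closure.

Lemma measurable_wrt_sub (R : realType) (d : measure_display) (T : measurableType d)
    (G H : set (set T)) (X : T -> R) :
  G `<=` H -> measurable_wrt G X -> measurable_wrt H X.
Proof. by move=> GH mX B mB; exact/GH/mX. Qed.

Lemma norm_le_1Dsqr (R : realType) (x : R) : `|x| <= 1 + x ^+ 2.
Proof.
rewrite -(real_normK (num_real x)); have := sqr_ge0 (`|x| - 1).
have := normr_ge0 x; set y := `|x|; nra.
Qed.

Section brownian_increments.
Context (R : realType) (d : measure_display) (T : measurableType d).
Variables (P : probability T R) (F : R -> set (set T)) (W : R -> T -> R).
Hypotheses (cF : complete_filtration P F) (bW : brownian_motion P F W).

Lemma measurable_wrt_filtration (t : R) (X : T -> R) : 0 <= t ->
  measurable_wrt (F t) X -> measurable_fun setT X.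
Proof. by move=> t0 mX _ B mB; rewrite setTI; exact/(filtration_sub cF t0)/mX. Qed.

Lemma measurable_wrt_mono (s t : R) (X : T -> R) : 0 <= s -> s <= t ->
  measurable_wrt (F s) X -> measurable_wrt (F t) X.
Proof. by move=> s0 st; apply: measurable_wrt_sub; exact: (filtration_mono cF s0 st). Qed.

Lemma measurable_brownian (t : R) : 0 <= t -> measurable_fun setT (W t).
Proof. by move=> t0; apply: (measurable_wrt_filtration t0); exact: (brownian_adapted bW). Qed.

Lemma measurable_increment (s t : R) : 0 <= s -> s < t ->
  measurable_fun setT (fun w => W t w - W s w).
Proof.
move=> s0 st; apply: measurable_funB; apply: measurable_brownian => //.
exact: le_trans s0 (ltW st).
Qed.

Lemma increment_expectationM (s t : R) (X : T -> R) (g : R -> R) :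
  0 <= s -> s < t -> measurable_wrt (F s) X -> measurable_fun setT g ->
  P.-integrable setT (EFin \o X) ->
  P.-integrable setT (EFin \o (fun w => g (W t w - W s w))) ->
  P.-integrable setT (EFin \o (fun w => X w * g (W t w - W s w))) /\
  \int[P]_w (X w * g (W t w - W s w)) =
    \int[P]_w X w * \int[P]_w g (W t w - W s w).
Proof.
move=> s0 st mX mg iX ig; apply: independent_integralM => // A B mA mB.
have mgB : measurable (g @^-1` B) by rewrite -[X in measurable X]setTI; exact: mg.
exact: (brownian_indep bW s0 st (mX A mA) mgB).
Qed.

Let sqrt_gt0 (s t : R) : s < t -> 0 < Num.sqrt (t - s).
Proof. by move=> st; rewrite sqrtr_gt0 subr_gt0. Qed.

Lemma increment_integrable (s t : R) (g : R -> R) n (C c : R) :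
  0 <= s -> s < t -> measurable_fun setT g -> 0 <= c -> 0 <= C ->
  (forall x, `|g x| <= C * (`|x| ^+ n * expR (c * `|x|))) ->
  P.-integrable setT (EFin \o (fun w => g (W t w - W s w))) /\
  `|\int[P]_w g (W t w - W s w)| <= C * normal_abs_cst n c (Num.sqrt (t - s)).
Proof.
move=> s0 st mg c0 C0 gC.
have mI := measurable_increment s0 st.
have law := brownian_normal bW s0 st.
split.
  exact: (normal_integrable mI (sqrt_gt0 st) law mg c0 C0 gC).
exact: (normal_integral_le mI (sqrt_gt0 st) law mg c0 C0 gC).
Qed.

Lemma increment_pow_integrable (s t : R) n : 0 <= s -> s < t ->
  P.-integrable setT (EFin \o (fun w => (W t w - W s w) ^+ n)).
Proof.
move=> s0 st; apply: (normal_pow_integrable (measurable_increment s0 st) (sqrt_gt0 st)).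
exact: (brownian_normal bW s0 st).
Qed.

Lemma increment_mean (s t : R) : 0 <= s -> s < t ->
  \int[P]_w (W t w - W s w) = 0.
Proof.
move=> s0 st.
by have [] := normal_mean_variance (measurable_increment s0 st) (sqrt_gt0 st)
  (brownian_normal bW s0 st).
Qed.

Lemma increment_variance (s t : R) : 0 <= s -> s < t ->
  \int[P]_w (W t w - W s w) ^+ 2 = t - s.
Proof.
move=> s0 st.
have [_ ->] := normal_mean_variance (measurable_increment s0 st) (sqrt_gt0 st)
  (brownian_normal bW s0 st).
by rewrite sqr_sqrtr// subr_ge0 ltW.
Qed.

Lemma increment_integrable1 (s t : R) : 0 <= s -> s < t ->
  P.-integrable setT (EFin \o (fun w => W t w - W s w)).
Proof.
by move=> s0 st; have := increment_pow_integrable 1 s0 st; under eq_fun do rewrite expr1.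
Qed.

(** This is [4! * 2 * exp(1/2)], the value of [normal_abs_cst 4 0] without its factor [s^4], which
    becomes [(t - s)^2]: the fourth moment bounds the variance of the squared increment. *)
Definition qv_cst : R := 48 * expR 2^-1.

Lemma increment_sqr_centered (s t : R) : 0 <= s -> s < t ->
  [/\ P.-integrable setT (EFin \o (fun w => (W t w - W s w) ^+ 2 - (t - s))),
      P.-integrable setT (EFin \o (fun w => ((W t w - W s w) ^+ 2 - (t - s)) ^+ 2)),
      \int[P]_w ((W t w - W s w) ^+ 2 - (t - s)) = 0 &
      \int[P]_w ((W t w - W s w) ^+ 2 - (t - s)) ^+ 2 <= qv_cst * (t - s) ^+ 2].
Proof.
move=> s0 st; pose D w := W t w - W s w.
have i2 : P.-integrable setT (EFin \o (fun w => D w ^+ 2)).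
  exact: increment_pow_integrable.
have i4 : P.-integrable setT (EFin \o (fun w => D w ^+ 4)).
  exact: increment_pow_integrable.
have varD : \int[P]_w D w ^+ 2 = t - s by exact: increment_variance.
have ic (c : R) : P.-integrable setT (EFin \o (fun=> c) : T -> \bar R).
  have := increment_pow_integrable 0 s0 st; under eq_fun do rewrite expr0.
  by move=> /(integrableZl measurableT c); apply: eq_integrable => // w _; rewrite /= mule1.
have iq : P.-integrable setT (EFin \o (fun w => D w ^+ 2 - (t - s))).
  by have := integrableB measurableT i2 (ic (t - s)); apply: eq_integrable.
have i2' : P.-integrable setT (EFin \o (fun w => (2 * (t - s)) * D w ^+ 2)).
  by have := integrableZl measurableT (2 * (t - s)) i2; apply: eq_integrable.
have i3' : P.-integrable setT (EFin \o (fun w => D w ^+ 4 - (2 * (t - s)) * D w ^+ 2)).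
  by have := integrableB measurableT i4 i2'; apply: eq_integrable.
have iqq : P.-integrable setT (EFin \o (fun w => (D w ^+ 2 - (t - s)) ^+ 2)).
  have := integrableD measurableT i3' (ic ((t - s) ^+ 2)); apply: eq_integrable => //.
  by move=> w _ /=; rewrite -EFinD; congr EFin; ring.
split => //.
- transitivity (\int[P]_w (D w ^+ 2 - (t - s))) => //.
  by rewrite (RintegralB measurableT i2 (ic _)) varD Rintegral_prob_cst subrr.
- have -> : \int[P]_w (D w ^+ 2 - (t - s)) ^+ 2 =
      \int[P]_w (D w ^+ 4 - (2 * (t - s)) * D w ^+ 2 + (t - s) ^+ 2).
    by apply: eq_Rintegral => w _; rewrite /D; ring.
  rewrite (RintegralD measurableT i3' (ic _)) (RintegralB measurableT i4 i2').
  rewrite (RintegralZl _ measurableT i2) Rintegral_prob_cst varD.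
  have mg : measurable_fun setT (fun x : R => x ^+ 4) by exact: measurable_funX.
  have [|_] := increment_integrable (n := 4) s0 st mg (lexx 0) ler01.
    by move=> x; rewrite mul0r expR0 mulr1 mul1r normrX.
  move=> /(le_trans (ler_norm _)) h.
  (* The remaining terms add up to [- (t - s)^2]. *)
  apply: (@le_trans _ _ (\int[P]_w D w ^+ 4)).
    have := sqr_ge0 (t - s); lra.
  apply: (le_trans h); rewrite mul1r /normal_abs_cst mul0r add0r expr1n.
  rewrite (_ : Num.sqrt (t - s) ^+ 4 = (t - s) ^+ 2); last first.
    by rewrite (exprM _ 2 2) sqr_sqrtr// subr_ge0 ltW.
  rewrite mul1r /qv_cst (_ : 4`!%:R = 24)//; lra.
Qed.

Section quadratic_variation.
Variables (p : nat -> R) (N : nat) (Y : nat -> T -> R) (M : R).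
Hypotheses (p0 : forall k, (k <= N)%N -> 0 <= p k).
Hypothesis pS : forall k, (k < N)%N -> p k < p k.+1.
Hypothesis YF : forall k, (k < N)%N -> measurable_wrt (F (p k)) (Y k).
Hypothesis YM : forall k w, `|Y k w| <= M.
Let D k w := (W (p k.+1) w - W (p k) w) ^+ 2 - (p k.+1 - p k).
Let S n w := \sum_(0 <= k < n) Y k w * D k w.

Let Swrt n : (n <= N)%N -> measurable_wrt (F (p n)) (S n).
Proof.
move=> nN; have sF := filtration_sigma cF (p0 nN).
have pmono k l : (k <= l)%N -> (l <= N)%N -> p k <= p l.
  elim: l => [|l IH]; first by rewrite leqn0 => /eqP ->.
  rewrite leq_eqVlt => /predU1P[->//|kl lN].
  by rewrite (le_trans (IH kl (ltnW lN)))// ltW// pS.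
apply: measurable_wrt_sum => // k kn.
have kN : (k < N)%N := leq_trans kn nN.
have Fk l : (l <= n)%N -> forall X : T -> R, measurable_wrt (F (p l)) X -> measurable_wrt (F (p n)) X.
  move=> ln X; apply: measurable_wrt_mono; first by rewrite p0// (leq_trans ln).
  exact: pmono.
apply: measurable_wrtM => //; first by apply: (Fk k); [exact: ltnW|exact: YF].
apply: measurable_wrtB => //; last exact: measurable_wrt_cst.
apply: (measurable_wrt_comp sF (g := fun x => x ^+ 2)); first exact: measurable_funX.
apply: measurable_wrtB => //.
  by apply: (Fk k.+1) => //; apply: (brownian_adapted bW); exact: p0.
by apply: (Fk k); [exact: ltnW|apply: (brownian_adapted bW); rewrite p0// ltnW].
Qed.

(** The summands are martingale increments: [S n] and [Y n] are known at time [p n], and the centred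
    square is independent of that past with mean 0, so cross terms vanish and second moments add.
    Bounded weights keep [S n * Y n] integrable through [|S| <= 1 + S^2]. *)
Lemma weighted_qv_bound n : (n <= N)%N ->
  P.-integrable setT (EFin \o (fun w => S n w ^+ 2)) /\
  \int[P]_w S n w ^+ 2 <= \sum_(0 <= k < n) M ^+ 2 * qv_cst * (p k.+1 - p k) ^+ 2.
Proof.
have ic (c : R) : P.-integrable setT (EFin \o (fun=> c) : T -> \bar R).
  apply: (@integrable_EFin_bound _ _ _ _ _ `|c|) => //.
  by have := expectation_cst P `|c|; rewrite unlock /= => ->.
elim: n => [_|n IH nN].
  rewrite big_geq//; have S0 w : S 0%N w ^+ 2 = 0 by rewrite /S big_geq// expr0n.
  under eq_fun do rewrite S0; split; first exact: ic.
  by rewrite Rintegral_prob_cst.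
have [iS bS] := IH (ltnW nN).
have pn0 : 0 <= p n by rewrite p0// ltnW.
have mS := measurable_wrt_filtration pn0 (Swrt (ltnW nN)).
have mY := measurable_wrt_filtration pn0 (YF nN).
have [iD iDD ED EDD] := increment_sqr_centered pn0 (pS nN).
have M0 (w : T) : 0 <= M by exact: le_trans (normr_ge0 _) (YM 0%N w).
have mg1 : measurable_fun setT (fun x : R => x ^+ 2 - (p n.+1 - p n)).
  by apply: measurable_funB => //; exact: measurable_funX.
have mg2 : measurable_fun setT (fun x : R => (x ^+ 2 - (p n.+1 - p n)) ^+ 2).
  exact: measurable_funX.
have sF := filtration_sigma cF pn0.
have iSY : P.-integrable setT (EFin \o (fun w => S n w * Y n w)).
  apply: (@le_integrable _ _ _ _ _ measurableT _ (EFin \o (fun w => M * (1 + S n w ^+ 2)))).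
  - by apply/measurable_EFinP; exact: measurable_funM.
  - move=> w _ /=; rewrite lee_fin normrM [leRHS]normrM mulrC.
    rewrite ler_pM// ?(le_trans (YM n w))// ?ler_norm//.
    rewrite [leRHS]ger0_norm ?addr_ge0 ?sqr_ge0//.
    exact: norm_le_1Dsqr.
  - have := integrableZl measurableT M (integrableD measurableT (ic 1) iS).
    by apply: eq_integrable => // w _ /=; rewrite -EFinD -EFinM.
have [iSYD ESYD] := increment_expectationM pn0 (pS nN)
  (measurable_wrtM sF (Swrt (ltnW nN)) (YF nN)) mg1 iSY iD.
have wYY : measurable_wrt (F (p n)) (fun w => Y n w ^+ 2).
  by apply: (measurable_wrt_comp sF (g := fun x => x ^+ 2)) (YF nN); exact: measurable_funX.
have iYY : P.-integrable setT (EFin \o (fun w => Y n w ^+ 2)).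
  apply: (@le_integrable _ _ _ _ _ measurableT _ (EFin \o (fun=> M ^+ 2))).
  - by apply/measurable_EFinP; exact: measurable_funX.
  - move=> w _ /=; rewrite lee_fin normrX [leRHS]normrX.
    by apply: lerXn2r; rewrite ?nnegrE// (le_trans (YM n w))// ler_norm.
  - exact: ic.
have [iYYD EYYD] := increment_expectationM pn0 (pS nN) wYY mg2 iYY iDD.
have SE w : S n.+1 w ^+ 2 = S n w ^+ 2 + 2 * (S n w * Y n w * D n w) +
    Y n w ^+ 2 * D n w ^+ 2.
  by rewrite /S big_nat_recr//=; ring.
have i2 : P.-integrable setT (EFin \o (fun w => 2 * (S n w * Y n w * D n w))).
  by have := integrableZl measurableT 2 iSYD; apply: eq_integrable.
have i3 : P.-integrable setT (EFin \o (fun w => S n w ^+ 2 + 2 * (S n w * Y n w * D n w))).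
  by have := integrableD measurableT iS i2; apply: eq_integrable.
split.
  have := integrableD measurableT i3 iYYD; apply: eq_integrable => // w _ /=.
  by rewrite SE -EFinD.
have -> : \int[P]_w S n.+1 w ^+ 2 = \int[P]_w (S n w ^+ 2 +
    2 * (S n w * Y n w * D n w) + Y n w ^+ 2 * D n w ^+ 2).
  by apply: eq_Rintegral => w _; rewrite SE.
rewrite RintegralD// RintegralD// RintegralZl// ESYD ED mulr0 mulr0 addr0 EYYD.
rewrite big_nat_recr//= lerD// -mulrA ler_pM//.
- by apply: Rintegral_ge0 => w _; exact: sqr_ge0.
- by apply: Rintegral_ge0 => w _; exact: sqr_ge0.
- rewrite -(Rintegral_prob_cst P (M ^+ 2)); apply: le_Rintegral => // w _.
  by rewrite -real_normK ?num_real//; apply: lerXn2r; rewrite ?nnegrE// (M0 w).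
Qed.

End quadratic_variation.

End brownian_increments.

(** * Almost sure limits and adapted processes *)

Section almost_sure_limits.
Context (R : realType) (d : measure_display) (T : measurableType d).
Variable P : probability T R.

Lemma nneseries_fin_cvg0 (f : nat -> R) : (forall n, 0 <= f n) ->
  (\sum_(0 <= n <oo) (f n)%:E < +oo)%E -> f n @[n --> \oo] --> 0.
Proof.
move=> f0 fin; apply: cvg_series_cvg_0.
have E0 n : (0 <= (f n)%:E)%E by rewrite lee_fin.
have S0 : (0 <= \sum_(0 <= n <oo) (f n)%:E)%E by exact: nneseries_ge0.
apply: nondecreasing_is_cvgn.
  by apply/nondecreasing_seqP => n; rewrite /series/= big_nat_recr//= lerDl.
exists (fine (\sum_(0 <= n <oo) (f n)%:E)%E) => _ [n _ <-].
rewrite -lee_fin fineK ?ge0_fin_numE// /series/= -sumEFin.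
exact: (nneseries_lim_ge (P := xpredT)).
Qed.

(** The series of the [f n] has finite mean, so it converges almost everywhere and its terms tend to
    0. *)
Lemma ae_cvg0_summable (f : nat -> T -> R) (C : R) :
  (forall n, measurable_fun setT (f n)) -> (forall n w, 0 <= f n w) ->
  (forall n, (\int[P]_w (f n w)%:E <= (C / (2 ^ n.+1)%:R)%:E)%E) ->
  \forall w \ae P, f n w @[n --> \oo] --> 0.
Proof.
move=> mf f0 fC.
have mEf n : measurable_fun setT (fun w => (f n w)%:E) by exact/measurable_EFinP.
pose g w := (\sum_(0 <= n <oo) (f n w)%:E)%E.
have g0 w : (0 <= g w)%E by apply: nneseries_ge0 => n _ _; rewrite lee_fin.
have mg : measurable_fun setT g.
  by apply: ge0_emeasurable_sum => // n w _ _; rewrite lee_fin.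
have ig : P.-integrable setT g.
  apply/integrableP; split => //.
  under eq_integral do rewrite gee0_abs//.
  rewrite integral_nneseries//; last by move=> n w _; rewrite lee_fin.
  apply: (@le_lt_trans _ _ (\sum_(0 <= n <oo) (C / (2 ^ n.+1)%:R)%:E)%E).
    apply: lee_nneseries => // n _ _; apply: integral_ge0 => w _; by rewrite lee_fin.
  have -> : (\sum_(0 <= n <oo) (C / (2 ^ n.+1)%:R)%:E)%E = (C / 2 ^+ 0)%:E.
    apply/cvg_lim => //; have := @cvg_geometric_eseries_half R C 0.
    by rewrite /eseries/=; under eq_fun do under eq_bigr do rewrite addn1.
  by rewrite ltry.
have := integrable_ae measurableT ig.
apply: filterS => w /(_ Logic.I) gfin.
by apply: nneseries_fin_cvg0 => //; rewrite -ge0_fin_numE//; exact: g0.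
Qed.

(** Dominated convergence for the indicators of the deviation events, which are eventually 0 at
    almost every point. *)
Lemma ae_cvg_tail (S : nat -> T -> R) (Y : T -> R) (eps : R) : 0 < eps ->
  (forall n, measurable_fun setT (S n)) -> measurable_fun setT Y ->
  (\forall w \ae P, S n w @[n --> \oo] --> Y w) ->
  P [set w | (eps <= `|S n w - Y w|)%R] @[n --> \oo] --> 0%E.
Proof.
move=> e0 mS mY SY.
pose A n := [set w | eps <= `|S n w - Y w|].
have mA n : measurable (A n).
  have mh : measurable_fun setT (fun w => `|S n w - Y w|).
    by apply: measurableT_comp => //; exact: measurable_funB.
  have -> : A n = (fun w => `|S n w - Y w|) @^-1` `[eps, +oo[.
    by apply/seteqP; split => w /=; rewrite /A/= in_itv/= andbT.
  by rewrite -[X in measurable X]setTI; apply: mh.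
pose f n w := (\1_(A n) w)%:E : \bar R.
have mf n : measurable_fun setT (f n).
  by apply/measurable_EFinP; exact: measurable_indic.
have m0 : measurable_fun setT (cst 0%E : T -> \bar R) by exact: measurable_cst.
have f_0 : {ae P, forall w, setT w -> f ^~ w @ \oo --> (cst 0%E : T -> \bar R) w}.
  apply: filterS SY => w Sw _.
  apply: cvg_near_cst; have /cvgrPdist_lt/(_ _ e0) := Sw; apply: filterS => n h.
  rewrite /f indicE memNset// /A/=; apply/negP; rewrite -ltNge.
  by rewrite distrC.
have i1 : P.-integrable setT (cst 1%E : T -> \bar R).
  apply: (@integrable_EFin_bound _ _ _ _ (fun=> 1) `|1|) => //.
  by have := expectation_cst P `|1|; rewrite unlock /= => ->.
have f1 : {ae P, forall w n, setT w -> (`|f n w| <= (cst 1%E : T -> \bar R) w)%E}.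
  apply: aeW => w n _; rewrite /f indicE.
  by case: (_ \in _); rewrite /= ?normr1 ?normr0 lee_fin.
have [_ _] := dominated_convergence measurableT mf m0 f_0 i1 f1.
rewrite integral0; apply: cvg_trans; apply: near_eq_cvg; apply: nearW => n.
by rewrite /f /= integral_indic// setIT.
Qed.

End almost_sure_limits.

(** * Lipschitz paths and bounded variation *)

Section lipschitz_paths.
Variable R : realType.
Implicit Types f : R -> R.

Lemma Rintegral_lipschitz f (T : R) : {within `[0, T], continuous f} ->
  exists2 L : R, 0 <= L & forall u v, 0 <= u -> u <= v -> v <= T ->
    `|\int[lebesgue_measure]_(s in `[0, v]) f s -
      \int[lebesgue_measure]_(s in `[0, u]) f s| <= L * (v - u).
Proof.
move=> cf; have [M M0 fM] := within_continuous_bounded cf.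
exists (2 * M + M); first by rewrite addr_ge0// mulr_ge0.
move=> u v u0 uv vT; rewrite (Rintegral_itv_add cf u0 uv vT).
have uT : u <= T := le_trans uv vT.
have := @Rintegral_osc _ f 0 T u v (2 * M) cf u0 uv vT.
set J := Rintegral _ _ _ => h.
rewrite (_ : J = (J - f u * (v - u)) + f u * (v - u)); last by rewrite subrK.
rewrite (le_trans (ler_normD _ _))// mulrDl lerD//.
  apply: h => x /andP[ux xv]; rewrite (le_trans (ler_normB _ _))// mulr2n mulrDl mul1r.
  by rewrite lerD// fM// ?u0 ?uT// (le_trans u0 ux) (le_trans xv vT).
by rewrite normrM (ger0_norm (_ : 0 <= v - u)) ?subr_ge0// ler_wpM2r ?subr_ge0// fM// u0.
Qed.

(** A Lipschitz function is the difference of the nondecreasing functions [f x + L x] and [L x].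
    This serves the regularity clauses of [is_covariation]. *)
Lemma lipschitz_continuous_variation f (T L : R) : 0 < T ->
  (forall u v, 0 <= u -> u <= v -> v <= T -> `|f v - f u| <= L * (v - u)) ->
  {within `[0, T], continuous f} /\ bounded_variation 0 T f.
Proof.
move=> T0 fL.
have fL' u v : 0 <= u <= T -> 0 <= v <= T -> `|f u - f v| <= (`|L| + 1) * `|u - v|.
  move=> /andP[u0 uT] /andP[v0 vT].
  have [uv|/ltW vu] := leP u v.
    rewrite distrC (le_trans (fL _ _ u0 uv vT))// (distrC u) (ger0_norm (_ : 0 <= v - u)) ?subr_ge0//.
    by rewrite ler_wpM2r ?subr_ge0// (le_trans (ler_norm _))// lerDl.
  rewrite (le_trans (fL _ _ v0 vu uT))// (ger0_norm (_ : 0 <= u - v)) ?subr_ge0//.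
  by rewrite ler_wpM2r ?subr_ge0// (le_trans (ler_norm _))// lerDl.
have L0 : 0 < `|L| + 1 by rewrite ltr_wpDl.
split.
  apply/subspace_continuousP => x; rewrite /= in_itv/= => xT.
  apply/cvgrPdist_le => e e0; exists (e / (`|L| + 1)) => /=; first exact: divr_gt0.
  move=> y /= xy; rewrite in_itv/= => yT; rewrite (le_trans (fL' _ _ xT yT))//.
  by rewrite mulrC -ler_pdivlMr// ltW.
have -> : f = (fun x => f x + L * x) \+ (\- (fun x => L * x)).
  by apply/funext => x /=; rewrite addrK.
have LL u v : 0 <= u -> u <= v -> v <= T -> L * u <= L * v /\ f u + L * u <= f v + L * v.
  move=> u0 uv vT; have := fL u v u0 uv vT; rewrite ler_norml => /andP[h1 h2].
  by split; lra.
apply: bounded_variationD => //.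
  apply: nondecreasing_bounded_variation => u v; rewrite !in_itv/= => /andP[u0 uT] /andP[v0 vT] uv.
  by have [] := LL _ _ u0 uv vT.
apply: bounded_variationN.
apply: nondecreasing_bounded_variation => u v; rewrite !in_itv/= => /andP[u0 uT] /andP[v0 vT] uv.
by have [] := LL _ _ u0 uv vT.
Qed.

End lipschitz_paths.

Section adapted_integrals.
Context (R : realType) (d : measure_display) (Omega : measurableType d).
Variables (P : probability Omega R) (F : R -> set (set Omega)).
Hypothesis cF : complete_filtration P F.

(** Completeness of the filtration enters: the exceptional set and all its subsets lie in [F 0],
    hence in [F t]. Multiplying by the indicator of the complement leaves sequences that converge at
    every point. *)
Lemma measurable_wrt_ae_limit (t : R) (X : nat -> Omega -> R) (Y : Omega -> R) :
  0 <= t -> (forall n, measurable_wrt (F t) (X n)) ->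
  (\forall w \ae P, X n w @[n --> \oo] --> Y w) -> measurable_wrt (F t) Y.
Proof.
move=> t0 mX XY; have sF := filtration_sigma cF t0.
have Ft N : P.-negligible N -> F t N.
  by move=> nN; apply: (filtration_mono cF (lexx 0) t0); exact: (filtration_complete cF).
pose N := ~` [set w | X n w @[n --> \oo] --> Y w].
have nN : P.-negligible N := XY.
have mN : measurable_wrt (F t) (\1_(~` N) : Omega -> R).
  apply/(measurable_wrtP sF)/measurable_indic.
  rewrite /measurable/= sigma_algebra_id// -setTD.
  by have [_ sD _] := sF; apply: sD; exact: Ft.
have mYN : measurable_wrt (F t) (fun w => Y w * \1_(~` N) w).
  apply/(measurable_wrtP sF).
  apply: (@measurable_fun_cvg _ (g_sigma_algebraType (F t)) R setT (fun n w => X n w * \1_(~` N) w)) => [n|w _].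
    by apply/(measurable_wrtP sF); apply: measurable_wrtM.
  have [wN|wN] := pselect (N w).
    by rewrite indicE memNset ?mulr0; [under eq_fun do rewrite mulr0; exact: cvg_cst|exact].
  rewrite indicE mem_set// mulr1; under eq_fun do rewrite mulr1.
  exact: contrapT wN.
move=> B mB.
have -> : Y @^-1` B = ((fun w => Y w * \1_(~` N) w) @^-1` B `&` ~` N) `|` (Y @^-1` B `&` N).
  apply/seteqP; split => w /=.
    move=> YB; have [wN|wN] := pselect (N w); [by right|left; split => //].
    by rewrite indicE mem_set// mulr1.
  by case=> -[]//; rewrite indicE => + wN; rewrite mem_set// mulr1.
have FU (A C : set Omega) : F t A -> F t C -> F t (A `|` C).
  move=> /[swap] FC FA; rewrite -bigcup2E; have [F0 _ Fb] := sF.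
  by apply: Fb => -[|[|n]].
have FC (A : set Omega) : F t A -> F t (~` A) by rewrite -setTD; have [_ sD _] := sF; exact: sD.
apply: (FU); last by apply: (Ft); apply: negligibleS nN; exact: subIsetr.
rewrite -[_ `&` _]setCK setCI setCK; apply: (FC); apply: (FU); last exact: Ft.
by apply: FC; exact: mYN.
Qed.

(** Riemann sums on a uniform grid of [[0, t]] only look at times up to [t]; continuity of almost
    every path gives their limit. *)
Lemma adapted_integral (T t : R) (X : R -> Omega -> R) : 0 <= t <= T ->
  adapted F T X -> continuous_paths P T X ->
  measurable_wrt (F t) (fun w => \int[lebesgue_measure]_(s in `[0, t]) X s w).
Proof.
move=> /andP[t0 tT] aX cX; have sF := filtration_sigma cF t0.
pose p n k : R := t * k%:R / n.+1%:R.
have n0 n : (n.+1%:R : R) != 0 by rewrite pnatr_eq0.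
have pS n k : p n k.+1 = p n k + t / n.+1%:R.
  by rewrite /p -natr1; field.
apply: (@measurable_wrt_ae_limit _ (fun n w =>
  \sum_(0 <= k < n.+1) X (p n k) w * (p n k.+1 - p n k))) => // [n|].
  apply: measurable_wrt_sum => // k kn; apply: measurable_wrtM => //; last exact: measurable_wrt_cst.
  have p0 : 0 <= p n k by rewrite /p divr_ge0 ?mulr_ge0.
  have pt : p n k <= t.
    by rewrite /p -mulrA ler_piMr// ler_pdivrMr ?ltr0n// mul1r ler_nat ltnW.
  apply: (measurable_wrt_mono cF p0 pt); apply: aX.
  by rewrite p0 (le_trans pt).
apply: filterS cX => w cw.
apply: (riemann_sum_cvg (p := p) (N := fun n => n.+1) (m := fun n => t / n.+1%:R)).
- by apply: continuous_subspaceW cw; apply: subset_itvl; rewrite bnd_simp.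
- by move=> n; rewrite /p mulr0 mul0r.
- by move=> n; rewrite /p mulfK.
- by move=> n k _; rewrite pS lexx andbT lerDl divr_ge0.
- rewrite -[0 in X in _ --> X](mulr0 t); apply: cvgM; first exact: cvg_cst.
  exact: cvg_harmonic.
Qed.

End adapted_integrals.

Section partitions.
Variable R : realType.

Lemma partition_steps (t : R) (s : seq R) : itv_partition 0 t s ->
  [/\ nth t (0 :: s) 0 = 0, nth t (0 :: s) (size s) = t &
   forall k, (k < size s)%N ->
     [/\ 0 <= nth t (0 :: s) k, nth t (0 :: s) k < nth t (0 :: s) k.+1,
         nth t (0 :: s) k.+1 <= t &
         nth t (0 :: s) k.+1 - nth t (0 :: s) k <= mesh t s]].
Proof.
move=> ps; split => //; first exact: itv_partition_nth_size.
move=> k ks; split.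
- by apply: itv_partition_nth_ge ps; exact: ltnW.
- by case: ps => /(pathP t) h _; exact: h.
- exact: (@itv_partition_nth_le _ _ 0 t s k.+1).
- rewrite /mesh big_mkord.
  exact: (le_bigmax _ (fun i : 'I_(size s) => nth t (0 :: s) i.+1 - nth t (0 :: s) i) (Ordinal ks)).
Qed.

End partitions.

Section partition_limits.
Context (R : realType) (d : measure_display) (Omega : measurableType d).
Variables (P : probability Omega R).

(** If no mesh bound worked, then for every [n] some partition with mesh below [2^-(n+1)] would
    violate the estimate, against almost sure convergence along these partitions. Only sequences
    with this prescribed rate have to be handled, which is what makes variances summable. *)
Lemma partition_limit_ae (T : R) (S : R -> seq R -> Omega -> R) (Y : R -> Omega -> R) :
  (forall t s, 0 <= t <= T -> itv_partition 0 t s -> measurable_fun setT (S t s)) ->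
  (forall t, 0 <= t <= T -> measurable_fun setT (Y t)) ->
  (forall t (s : nat -> seq R), 0 <= t <= T -> (forall n, itv_partition 0 t (s n)) ->
     (forall n, mesh t (s n) < (2 ^ n.+1)%:R^-1) ->
     \forall w \ae P, S t (s n) w @[n --> \oo] --> Y t w) ->
  partition_limit P T S Y.
Proof.
move=> mS mY SY t tT eps eta eps0 eta0; apply: contrapT => H.
have Hn (n : nat) : exists s, itv_partition 0 t s /\ mesh t s < (2 ^ n.+1)%:R^-1 /\
    ~ (P [set w | (eps <= `|S t s w - Y t w|)%R] <= eta%:E)%E.
  apply: contrapT => Hs; apply: H; exists (2 ^ n.+1)%:R^-1.
    by rewrite invr_gt0 ltr0n expn_gt0.
  move=> s ps ms; apply: contrapT => h; apply: Hs; by exists s.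
have [s Hs] := choice Hn.
have ps n : itv_partition 0 t (s n) by have [] := Hs n.
have ms n : mesh t (s n) < (2 ^ n.+1)%:R^-1 by have [_ []] := Hs n.
have := ae_cvg_tail eps0 (fun n => mS t (s n) tT (ps n)) (mY t tT) (SY t s tT ps ms).
have eta0' : (0 < eta%:E)%E by rewrite lte_fin.
move=> /(_ _ (open_ereal_lt' eta0')) [n _ /(_ n (leqnn n))] /= h.
by have [_ [_]] := Hs n; apply; exact: ltW.
Qed.

End partition_limits.

(** * The explicit solution for multiplicative noise *)

Section explicit_solution.
Context (R : realType) (d : measure_display) (Omega : measurableType d).
Variables (P : probability Omega R) (F : R -> set (set Omega)) (W : R -> Omega -> R).
Hypotheses (cF : complete_filtration P F) (bW : brownian_motion P F W).
Variables (T : R) (A B : R[i]) (x0 : Omega -> R[i]).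
Hypotheses (T0 : 0 < T) (B0 : B != 0).
Notation Re := complex.Re.
Notation Im := complex.Im.
Hypotheses (mRe0 : measurable_wrt (F 0) (fun w => Re (x0 w)))
  (mIm0 : measurable_wrt (F 0) (fun w => Im (x0 w))).

Definition geometric_solution (t : R) (w : Omega) : R[i] :=
  geometric_path A B (x0 w) (fun s => W s w) t.
Let Z := geometric_solution.

Let pathW : \forall w \ae P, {within `[0, T], continuous (fun s => W s w)}.
Proof. by apply: (brownian_continuous bW); exact: ltW. Qed.

Lemma geometric_solution_wrt t : 0 <= t ->
  measurable_wrt (F t) (fun w => Re (Z t w)) /\
  measurable_wrt (F t) (fun w => Im (Z t w)).
Proof.
move=> t0; have sF := filtration_sigma cF t0.
have mI : measurable_wrt (F t) (fun w => W t w - W 0 w).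
  apply: measurable_wrtB => //; first exact: (brownian_adapted bW).
  by apply: (measurable_wrt_mono cF (lexx 0) t0); exact: (brownian_adapted bW).
have lin a b : measurable_wrt (F t) (fun w => a * t + b * (W t w - W 0 w)).
  apply: measurable_wrtD => //; first exact: measurable_wrt_cst.
  by apply: measurable_wrtM => //; exact: measurable_wrt_cst.
have mR0 := measurable_wrt_mono cF (lexx 0) t0 mRe0.
have mI0 := measurable_wrt_mono cF (lexx 0) t0 mIm0.
have reE w : Re (A * t%:C + B * (W t w - W 0 w)%:C) = Re A * t + Re B * (W t w - W 0 w).
  by rewrite cReD !cReMr.
have imE w : Im (A * t%:C + B * (W t w - W 0 w)%:C) = Im A * t + Im B * (W t w - W 0 w).
  by rewrite cImD !cImMr.
have mexp : measurable_wrt (F t) (fun w => expR (Re A * t + Re B * (W t w - W 0 w))).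
  exact: (measurable_wrt_comp sF (g := expR)).
have mcos : measurable_wrt (F t) (fun w => cos (Im A * t + Im B * (W t w - W 0 w))).
  apply: (measurable_wrt_comp sF (g := cos)) => //.
  exact: continuous_measurable_fun (@continuous_cos R).
have msin : measurable_wrt (F t) (fun w => sin (Im A * t + Im B * (W t w - W 0 w))).
  apply: (measurable_wrt_comp sF (g := sin)) => //.
  exact: continuous_measurable_fun (@continuous_sin R).
split.
- have -> : (fun w => Re (Z t w)) = (fun w =>
    Re (x0 w) * (expR (Re A * t + Re B * (W t w - W 0 w)) * cos (Im A * t + Im B * (W t w - W 0 w))) -
    Im (x0 w) * (expR (Re A * t + Re B * (W t w - W 0 w)) * sin (Im A * t + Im B * (W t w - W 0 w)))).
    by apply/funext => w; rewrite /Z /geometric_solution /geometric_path cReM Re_cexp Im_cexp reE imE.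
  by apply: measurable_wrtB => //; apply: measurable_wrtM => //; apply: measurable_wrtM.
- have -> : (fun w => Im (Z t w)) = (fun w =>
    Re (x0 w) * (expR (Re A * t + Re B * (W t w - W 0 w)) * sin (Im A * t + Im B * (W t w - W 0 w))) +
    Im (x0 w) * (expR (Re A * t + Re B * (W t w - W 0 w)) * cos (Im A * t + Im B * (W t w - W 0 w)))).
    by apply/funext => w; rewrite /Z /geometric_solution /geometric_path cImM Re_cexp Im_cexp reE imE.
  by apply: measurable_wrtD => //; apply: measurable_wrtM => //; apply: measurable_wrtM.
Qed.

Let adR : adapted F T (fun t w => Re (Z t w)).
Proof. by move=> t /andP[t0 _]; have [] := geometric_solution_wrt t0. Qed.

Let adI : adapted F T (fun t w => Im (Z t w)).
Proof. by move=> t /andP[t0 _]; have [] := geometric_solution_wrt t0. Qed.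

Let cR : continuous_paths P T (fun t w => Re (Z t w)).
Proof.
by apply: filterS pathW => w cw; have [] := geometric_path_continuous A B (x0 w) cw.
Qed.

Let cI : continuous_paths P T (fun t w => Im (Z t w)).
Proof.
by apply: filterS pathW => w cw; have [] := geometric_path_continuous A B (x0 w) cw.
Qed.

Let IZ (t : R) (w : Omega) : R[i] := cRintegral (fun s => Z s w) t.

Let adIR t : 0 <= t <= T -> measurable_wrt (F t) (fun w => Re (IZ t w)).
Proof. by move=> tT; exact: (adapted_integral cF tT adR cR). Qed.

Let adII t : 0 <= t <= T -> measurable_wrt (F t) (fun w => Im (IZ t w)).
Proof. by move=> tT; exact: (adapted_integral cF tT adI cI). Qed.

Let cscale_wrt t (c : R[i]) (X : Omega -> R[i]) : 0 <= t ->
  measurable_wrt (F t) (fun w => Re (X w)) -> measurable_wrt (F t) (fun w => Im (X w)) ->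
  measurable_wrt (F t) (fun w => Re (c * X w)) /\ measurable_wrt (F t) (fun w => Im (c * X w)).
Proof.
move=> t0 mR mI; have sF := filtration_sigma cF t0; split.
- under eq_fun do rewrite cReM.
  by apply: measurable_wrtB => //; apply: measurable_wrtM => //; exact: measurable_wrt_cst.
- under eq_fun do rewrite cImM.
  by apply: measurable_wrtD => //; apply: measurable_wrtM => //; exact: measurable_wrt_cst.
Qed.

Section along_partitions.
Variables (t : R) (s : nat -> seq R).
Hypotheses (tT : 0 <= t <= T) (ps : forall n, itv_partition 0 t (s n)).
Hypothesis ms : forall n, mesh t (s n) < (2 ^ n.+1)%:R^-1.
Let p n := nth t (0 :: s n).
Let N n := size (s n).
Let D n k w := W (p n k.+1) w - W (p n k) w.
Let tau n k := p n k.+1 - p n k.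

Let tau0 n k : (k < N n)%N -> 0 <= tau n k.
Proof. by move=> kN; have [_ _ /(_ k kN) [_ /ltW h _ _]] := partition_steps (ps n); rewrite subr_ge0. Qed.

(** The second moment is at most [M^2 qv_cst] times the sum of [tau^2]; one factor [tau] is bounded
    by the mesh, the other sums to [t], and the mesh rate makes the result summable in [n]. *)
Let weighted_qv_ae (Y : nat -> nat -> Omega -> R) (M : R) :
  (forall n k, (k < N n)%N -> measurable_wrt (F (p n k)) (Y n k)) ->
  (forall n k w, `|Y n k w| <= M) ->
  \forall w \ae P,
    \sum_(0 <= k < N n) Y n k w * (D n k w ^+ 2 - tau n k) @[n --> \oo] --> 0.
Proof.
move=> mY YM; pose S n w := \sum_(0 <= k < N n) Y n k w * (D n k w ^+ 2 - tau n k).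
have p0 n k : (k <= N n)%N -> 0 <= p n k.
  by move=> kN; apply: (itv_partition_nth_ge (b := t)) (ps n).
have pS n k : (k < N n)%N -> p n k < p n k.+1.
  by move=> kN; have [_ _ /(_ k kN) []] := partition_steps (ps n).
have qb n := weighted_qv_bound cF bW (p0 n) (pS n) (mY n) (YM n) (leqnn (N n)).
have : \forall w \ae P, S n w ^+ 2 @[n --> \oo] --> 0.
  apply: (@ae_cvg0_summable _ _ _ _ _ (M ^+ 2 * qv_cst R * t)).
  - by move=> n; have [/integrable_fin_measurable] := qb n.
  - by move=> n w; exact: sqr_ge0.
  move=> n; have [iS bS] := qb n.
  rewrite -[leLHS]fineK ?lee_fin; last exact: integrable_fin_num iS.
  apply: (le_trans bS).
  apply: (@le_trans _ _ (\sum_(0 <= k < N n) (M ^+ 2 * qv_cst R / (2 ^ n.+1)%:R) * tau n k)).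
    rewrite big_nat_cond [leRHS]big_nat_cond; apply: ler_sum => k /andP[/andP[_ kN] _].
    rewrite -(mulrA (M ^+ 2 * qv_cst R)) ler_wpM2l//.
      by rewrite mulr_ge0 ?sqr_ge0// mulr_ge0 ?expR_ge0.
    rewrite expr2 ler_wpM2r ?tau0//.
    have [_ _ /(_ k kN) [_ _ _ h]] := partition_steps (ps n).
    exact: le_trans h (ltW (ms n)).
  rewrite -mulr_sumr telescope_sumr//.
  have [p0E pN _] := partition_steps (ps n).
  by rewrite /N /p pN p0E subr0 mulrAC.
apply: filterS => w /cvgrPdist_lt h; apply/cvgrPdist_lt => e e0.
apply: filterS (h (e ^+ 2) _) => [n|]; last exact: exprn_gt0.
rewrite !sub0r !normrN normrX => H.
by rewrite -(ltr_pXn2r (n := 2))// ?nnegrE// ltW.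
Qed.

(** Values outside [[-M, M]] are sent to 0, not to the nearest endpoint. *)
Let truncate (M x : R) := x * \1_(`[(- M), M]%classic) x.

Let truncate_measurable M : measurable_fun setT (truncate M).
Proof. by apply: measurable_funM => //; exact: measurable_indic. Qed.

Let truncate_bound (M x : R) : 0 <= M -> `|truncate M x| <= M.
Proof.
move=> M0; rewrite /truncate indicE; case: (boolP (x \in _)) => xM; last by rewrite mulr0 normr0.
by rewrite mulr1; move: xM; rewrite inE/= in_itv/= -ler_norml.
Qed.

Let truncate_id (M x : R) : `|x| <= M -> truncate M x = x.
Proof. by move=> xM; rewrite /truncate indicE mem_set ?mulr1//= in_itv/= -ler_norml. Qed.

(** The variance estimate wants bounded weights, whereas a continuous path is bounded only by a
    random constant. All integer truncation levels are treated outside one null set, and on each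
    path a level above its maximum leaves the sums unchanged. *)
Let adapted_qv_ae (X : R -> Omega -> R) : adapted F T X -> continuous_paths P T X ->
  \forall w \ae P,
    \sum_(0 <= k < N n) X (p n k) w * (D n k w ^+ 2 - tau n k) @[n --> \oo] --> 0.
Proof.
move=> aX cX.
have pT n k : (k < N n)%N -> 0 <= p n k <= T.
  move=> kN; have [_ _ /(_ k kN) [-> lt le _]] := partition_steps (ps n).
  by case/andP: tT => _; apply: le_trans; exact: le_trans (ltW lt) le.
have H (M : nat) : \forall w \ae P, \sum_(0 <= k < N n) truncate M%:R (X (p n k) w) *
    (D n k w ^+ 2 - tau n k) @[n --> \oo] --> 0.
  apply: (@weighted_qv_ae (fun n k w => truncate M%:R (X (p n k) w)) M%:R).
    move=> n k kN; have pnk := pT n k kN.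
    apply: (measurable_wrt_comp (filtration_sigma cF _) (truncate_measurable _)); last exact: aX.
    by case/andP: pnk.
  by move=> n k w; exact: truncate_bound.
have /ae_foralln H' := H.
apply: filterS2 H' cX => w Hw cw.
have [M M0 hM] := within_continuous_bounded cw.
have [M' /ltW MM'] : exists M' : nat, M < M'%:R.
  by exists (Num.bound M); exact: archi_boundP.
apply: cvg_trans (Hw M'); apply: near_eq_cvg; apply: nearW => n.
rewrite big_nat_cond [RHS]big_nat_cond; apply: eq_bigr => k /andP[/andP[_ kN] _].
by rewrite truncate_id// (le_trans _ MM')// hM// pT.
Qed.

(** The null sums required by the pathwise expansion are obtained with the weights 1, [Re Z] and
    [Im Z]. *)
Lemma geometric_solution_sums_ae : \forall w \ae P,
  ccvg (fun n => \sum_(0 <= k < N n) Z (p n k) w * (D n k w)%:C)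
    ((Z t w - x0 w - A * IZ t w) / B - B / 2 * IZ t w) /\
  ccvg (fun n => \sum_(0 <= k < N n) (Z (p n k.+1) w - Z (p n k) w) * (D n k w)%:C)
    (B * IZ t w).
Proof.
have c1 : continuous_paths P T (fun (_ : R) (_ : Omega) => 1 : R).
  by apply: aeW => w x; exact: cvg_cst.
have a1 : adapted F T (fun (_ : R) (_ : Omega) => 1 : R).
  by move=> u /andP[u0 _]; apply: measurable_wrt_cst; exact: (filtration_sigma cF u0).
have q1 := adapted_qv_ae a1 c1.
have qR := adapted_qv_ae adR cR.
have qI := adapted_qv_ae adI cI.
apply: filterS2 (filterI q1 qR) (filterI qI pathW) => w [Q1 QR] [QI cw].
have cwt : {within `[0, t], continuous (fun s => W s w)}.
  by apply: continuous_subspaceW cw; apply: subset_itvl; rewrite bnd_simp; case/andP: tT.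
have p0 n : p n 0%N = 0 by [].
have pN n : p n (N n) = t by have [] := partition_steps (ps n).
have pm n k : (k < N n)%N -> p n k <= p n k.+1 <= p n k + mesh t (s n).
  by move=> kN; have [_ _ /(_ k kN) [_ /ltW -> _]] := partition_steps (ps n); rewrite lerBlDl.
have m0 : mesh t (s n) @[n --> \oo] --> (0 : R).
  apply: (@squeeze_cvgr _ _ _ _ (fun=> 0) (fun n => (1 / 2) * (1 / 2) ^+ n)).
  - apply: nearW => n; rewrite bigmax_ge_id/= (le_trans (ltW (ms n)))//.
    by rewrite -exprS expr_div_n expr1n div1r natrX.
  - exact: cvg_cst.
  - rewrite -[0 in X in _ --> X](mulr0 (1 / 2)); apply: cvgM; first exact: cvg_cst.
    by apply: cvg_expr; rewrite ger0_norm ?divr_ge0// ltr_pdivrMr// mul1r ltr1n.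
have Q1' : \sum_(0 <= k < N n) (D n k w ^+ 2 - tau n k) @[n --> \oo] --> (0 : R).
  apply: cvg_trans Q1; apply: near_eq_cvg; apply: nearW => n.
  by apply: eq_bigr => k _; rewrite mul1r.
split.
- exact: (pathwise_ito cwt p0 pN pm m0 Q1' QR QI B0).
- exact: (pathwise_covariation cwt p0 pN pm m0 Q1' QR QI).
Qed.

End along_partitions.


Let stochastic_sums_measurable (X : R -> Omega -> R) t s : adapted F T X ->
  0 <= t <= T -> itv_partition 0 t s ->
  measurable_fun setT (left_sum X W t s) /\ measurable_fun setT (covariation_sum X W t s).
Proof.
move=> aX /andP[t0 tT] ps; have [_ pN pk] := partition_steps ps.
have sF := filtration_sigma cF t0.
have p0t k : (k <= size s)%N -> 0 <= nth t (0 :: s) k /\ nth t (0 :: s) k <= t.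
  move=> ks; split; first exact: (itv_partition_nth_ge (b := t)) ps.
  exact: (itv_partition_nth_le (a := 0)) ps.
have Xk k : (k <= size s)%N -> measurable_wrt (F t) (X (nth t (0 :: s) k)).
  move=> /p0t[k0 kt]; apply: (measurable_wrt_mono cF k0 kt); apply: aX.
  by rewrite k0 (le_trans kt).
have Wk k : (k <= size s)%N -> measurable_wrt (F t) (W (nth t (0 :: s) k)).
  by move=> /p0t[k0 kt]; apply: (measurable_wrt_mono cF k0 kt); exact: (brownian_adapted bW).
split; apply: (measurable_wrt_filtration cF t0); apply: measurable_wrt_sum => // k ks.
- apply: measurable_wrtM => //; first by apply: Xk; exact: ltnW.
  by apply: measurable_wrtB => //; apply: Wk => //; exact: ltnW.
- by apply: measurable_wrtM => //; apply: measurable_wrtB => //;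
    (apply: Xk || apply: Wk) => //; exact: ltnW.
Qed.

(** The Stratonovich integral is what the equation forces it to be, so the equation holds by
    construction and the work lies in showing that [J] is an integral. *)
Let J (t : R) (w : Omega) : R[i] := (Z t w - x0 w - A * IZ t w) / B.

Let covariation_paths : \forall w \ae P,
  ({within `[0, T], continuous (fun t => Re (B * IZ t w))} /\
   bounded_variation 0 T (fun t => Re (B * IZ t w))) /\
  ({within `[0, T], continuous (fun t => Im (B * IZ t w))} /\
   bounded_variation 0 T (fun t => Im (B * IZ t w))).
Proof.
apply: filterS2 cR cI => w cRw cIw.
have [L1 L10 h1] := Rintegral_lipschitz cRw.
have [L2 L20 h2] := Rintegral_lipschitz cIw.
have lin (a b : R) u v : 0 <= u -> u <= v -> v <= T ->
    `|(a * Re (IZ v w) + b * Im (IZ v w)) - (a * Re (IZ u w) + b * Im (IZ u w))| <=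
    (`|a| * L1 + `|b| * L2) * (v - u).
  move=> u0 uv vT; have {}h1 := h1 u v u0 uv vT; have {}h2 := h2 u v u0 uv vT.
  have -> : (a * Re (IZ v w) + b * Im (IZ v w)) - (a * Re (IZ u w) + b * Im (IZ u w)) =
    a * (Re (IZ v w) - Re (IZ u w)) + b * (Im (IZ v w) - Im (IZ u w)) by ring.
  rewrite (le_trans (ler_normD _ _))// !normrM mulrDl -!mulrA.
  by rewrite lerD// ler_wpM2l.
split.
- have -> : (fun t => Re (B * IZ t w)) = (fun t => Re B * Re (IZ t w) + (- Im B) * Im (IZ t w)).
    by apply/funext => t; rewrite cReM mulNr.
  exact: (lipschitz_continuous_variation T0 (lin _ _)).
- have -> : (fun t => Im (B * IZ t w)) = (fun t => Im B * Re (IZ t w) + Re B * Im (IZ t w)).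
    by apply/funext => t; rewrite cImM addrC.
  exact: (lipschitz_continuous_variation T0 (lin _ _)).
Qed.

Let ito_wrt t : 0 <= t <= T ->
  measurable_wrt (F t) (fun w => Re (J t w - B / 2 * IZ t w)) /\
  measurable_wrt (F t) (fun w => Im (J t w - B / 2 * IZ t w)).
Proof.
move=> tT; have t0 : 0 <= t by case/andP: tT.
have sF := filtration_sigma cF t0.
have [ZR ZI] := geometric_solution_wrt t0.
have mR0 := measurable_wrt_mono cF (lexx 0) t0 mRe0.
have mI0 := measurable_wrt_mono cF (lexx 0) t0 mIm0.
have [AR AI] := cscale_wrt A t0 (adIR tT) (adII tT).
have [BR BI] := cscale_wrt (B / 2) t0 (adIR tT) (adII tT).
have [JR JI] : measurable_wrt (F t) (fun w => Re (J t w)) /\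
    measurable_wrt (F t) (fun w => Im (J t w)).
  have -> : J t = fun w => B^-1 * (Z t w - x0 w - A * IZ t w).
    by apply/funext => w; rewrite mulrC.
  apply: cscale_wrt => //.
  - under eq_fun do rewrite !cReB.
    by apply: measurable_wrtB => //; exact: measurable_wrtB.
  - under eq_fun do rewrite !cImB.
    by apply: measurable_wrtB => //; exact: measurable_wrtB.
split.
- by under eq_fun do rewrite cReB; exact: measurable_wrtB.
- by under eq_fun do rewrite cImB; exact: measurable_wrtB.
Qed.

(** The split into the Ito limit and half of the covariation [B int Z dt], matching the two pathwise
    limits. *)
Let itoE t w : J t w = (J t w - B / 2 * IZ t w) + (B * IZ t w) / 2.
Proof. by field. Qed.

Lemma geometric_solution_equation : mode_equation P F W T A B x0 Z Z.
Proof.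
split; [by split|by split|exists J; split].
- exists (fun t w => Re (J t w - B / 2 * IZ t w)), (fun t w => Re (B * IZ t w)); split.
  + split => //.
      by move=> t tT; have [] := ito_wrt tT.
    apply: partition_limit_ae.
    * by move=> t s tT ps; have [] := stochastic_sums_measurable adR tT ps.
    * move=> t tT; have t0 : 0 <= t by case/andP: tT.
      by apply: (measurable_wrt_filtration cF t0); have [] := ito_wrt tT.
    * move=> t s tT ps ms; apply: filterS (geometric_solution_sums_ae tT ps ms) => w [/ccvg_Re h _].
      apply: cvg_trans h; apply: near_eq_cvg; apply: nearW => n.
      by rewrite cRe_sum; apply: eq_bigr => k _; rewrite cReMr.
  + split => //.
    * move=> t tT; have t0 : 0 <= t by case/andP: tT.
      by have [] := cscale_wrt B t0 (adIR tT) (adII tT).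
    * by apply: filterS covariation_paths => w [[]].
    * by apply: filterS covariation_paths => w [[]].
    apply: partition_limit_ae.
    * by move=> t s tT ps; have [] := stochastic_sums_measurable adR tT ps.
    * move=> t tT; have t0 : 0 <= t by case/andP: tT.
      by apply: (measurable_wrt_filtration cF t0); have [] := cscale_wrt B t0 (adIR tT) (adII tT).
    * move=> t s tT ps ms; apply: filterS (geometric_solution_sums_ae tT ps ms) => w [_ /ccvg_Re h].
      apply: cvg_trans h; apply: near_eq_cvg; apply: nearW => n.
      by rewrite cRe_sum; apply: eq_bigr => k _; rewrite cReMr cReB.
  + move=> t tT; apply: aeW => w; rewrite [in LHS]itoE [LHS]cReD; congr (_ + _).
    have -> : B * IZ t w / 2 = B * IZ t w * (2^-1)%:C by rewrite fmorphV rmorph_nat.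
    by rewrite cReMr.
- exists (fun t w => Im (J t w - B / 2 * IZ t w)), (fun t w => Im (B * IZ t w)); split.
  + split => //.
      by move=> t tT; have [] := ito_wrt tT.
    apply: partition_limit_ae.
    * by move=> t s tT ps; have [] := stochastic_sums_measurable adI tT ps.
    * move=> t tT; have t0 : 0 <= t by case/andP: tT.
      by apply: (measurable_wrt_filtration cF t0); have [] := ito_wrt tT.
    * move=> t s tT ps ms; apply: filterS (geometric_solution_sums_ae tT ps ms) => w [/ccvg_Im h _].
      apply: cvg_trans h; apply: near_eq_cvg; apply: nearW => n.
      by rewrite cIm_sum; apply: eq_bigr => k _; rewrite cImMr.
  + split => //.
    * move=> t tT; have t0 : 0 <= t by case/andP: tT.
      by have [] := cscale_wrt B t0 (adIR tT) (adII tT).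
    * by apply: filterS covariation_paths => w [_ []].
    * by apply: filterS covariation_paths => w [_ []].
    apply: partition_limit_ae.
    * by move=> t s tT ps; have [] := stochastic_sums_measurable adI tT ps.
    * move=> t tT; have t0 : 0 <= t by case/andP: tT.
      by apply: (measurable_wrt_filtration cF t0); have [] := cscale_wrt B t0 (adIR tT) (adII tT).
    * move=> t s tT ps ms; apply: filterS (geometric_solution_sums_ae tT ps ms) => w [_ /ccvg_Im h].
      apply: cvg_trans h; apply: near_eq_cvg; apply: nearW => n.
      by rewrite cIm_sum; apply: eq_bigr => k _; rewrite cImMr cImB.
  + move=> t tT; apply: aeW => w; rewrite [in LHS]itoE [LHS]cImD; congr (_ + _).
    have -> : B * IZ t w / 2 = B * IZ t w * (2^-1)%:C by rewrite fmorphV rmorph_nat.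
    by rewrite cImMr.
- move=> t tT; apply: aeW => w.
  change (Z t w = x0 w + A * IZ t w + B * J t w).
  by rewrite /J; field.
Qed.

End explicit_solution.

(** * Linear equations driven by a continuous path *)

Section linear_equation.
Variable R : realType.
Notation Re := (@complex.Re R).
Notation Im := (@complex.Im R).

(** By the mean value theorem [f - K G] cannot increase and [f + K G] cannot decrease between [a]
    and [b]. *)
Lemma derive_bounded_increment (f df G dG : R -> R) (a b K : R) : a < b ->
  (forall x, x \in `]a, b[ -> is_derive x 1 f (df x)) ->
  (forall x, x \in `]a, b[ -> is_derive x 1 G (dG x)) ->
  {within `[a, b], continuous f} -> {within `[a, b], continuous G} ->
  (forall x, x \in `]a, b[ -> `|df x| <= K * dG x) ->
  `|f b - f a| <= K * (G b - G a).
Proof.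
move=> ab Df DG cf cG bound.
have cKG : {within `[a, b], continuous (fun x => K * G x)}.
  by move=> x; apply: cvgM; [exact: cvg_cst|exact: cG].
have DKG x : x \in `]a, b[ -> is_derive x 1 (fun x => K * G x) (K * dG x).
  by move=> /DG h; apply: is_derive_eq; rewrite /GRing.scale/=; ring.
have [c1 c1ab E1] := MVT ab (fun x xab => is_deriveB (Df x xab) (DKG x xab))
  (fun x => cvgB (cf x) (cKG x)).
have [c2 c2ab E2] := MVT ab (fun x xab => is_deriveD (Df x xab) (DKG x xab))
  (fun x => cvgD (cf x) (cKG x)).
have ba : 0 <= b - a by rewrite subr_ge0 ltW.
have /ler_normlP[h1 h1'] := bound _ c1ab.
have /ler_normlP[h2 h2'] := bound _ c2ab.
have n1 : (df c1 - K * dG c1) * (b - a) <= 0.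
  by rewrite mulr_le0_ge0// subr_le0.
have n2 : 0 <= (df c2 + K * dG c2) * (b - a).
  by rewrite mulr_ge0//; lra.
rewrite ler_norml; apply/andP; move: E1 E2; rewrite !fctE => E1 E2; split; lra.
Qed.

Lemma Rintegral_derive (f : R -> R) (T x : R) : {within `[0, T], continuous f} ->
  0 < x < T -> is_derive x 1 (fun t => \int[lebesgue_measure]_(s in `[0, t]) f s) (f x).
Proof.
move=> cf /andP[x0 xT]; have T0 : 0 < T := lt_trans x0 xT.
have cx : {for x, continuous f}.
  by have [+ _ _] := (continuous_within_itvP _ T0).1 cf; apply; rewrite in_itv/= x0.
have [dF F'] := continuous_FTC1_closed xT (within_continuous_integrable cf) x0 cx.
by split; [exact: dF|rewrite -derive1E; exact: F'].
Qed.

Section solution.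
Variables (A kappa x0 : R[i]) (X : R -> R[i]) (g : R -> R) (T : R).
Hypotheses (cR : {within `[0, T], continuous (fun s => Re (X s))})
  (cI : {within `[0, T], continuous (fun s => Im (X s))})
  (cg : {within `[0, T], continuous g}).
Hypothesis XE : forall t, 0 <= t <= T -> X t = x0 + A * cRintegral X t + kappa * (g t)%:C.

(* The function e^(- A t) (X t - kappa (g t - g t1)) is differentiable, with
   derivative kappa A e^(- A t) (g t - g t1). *)
Lemma linear_equation_increment (t1 t2 : R) : 0 <= t1 -> t1 < t2 -> t2 <= T ->
  normc (X t2 - cexp (A * (t2 - t1)%:C) * X t1 - kappa * (g t2 - g t1)%:C) <=
  2 * (normc A * normc kappa) * expR (normc A * T) ^+ 2 *
  (\int[lebesgue_measure]_(s in `]t1, t2]) `|g s - g t1|).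
Proof.
move=> t10 t12 t2T.
have t1T : t1 <= T by rewrite (le_trans (ltW t12)).
have t20 : 0 <= t2 by rewrite (le_trans t10)// ltW.
have T0 : 0 < T by rewrite (lt_le_trans _ t2T)// (le_lt_trans t10).
(* On [[0, T]] this is [X] with the noise frozen at time [t1]; it is differentiable, whereas [X]
   need not be. *)
pose V t := x0 + A * cRintegral X t + kappa * (g t1)%:C.
pose Psi t := cexp (t%:C * (- A)) * V t.
pose dPsi t := - A * cexp (t%:C * - A) * V t + cexp (t%:C * - A) * (0 + (0 * cRintegral X t + A * X t) + 0).
have DPsi t : t \in `]t1, t2[ -> cderive Psi t (dPsi t).
  rewrite in_itv/= => /andP[tt1 tt2].
  have tT : 0 < t < T by rewrite (le_lt_trans t10 tt1) (lt_le_trans tt2).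
  apply: cderiveM; first exact: cderive_cexp.
  apply: cderiveD; last exact: cderive_cst.
  apply: cderiveD; first exact: cderive_cst.
  apply: cderiveM; first exact: cderive_cst.
  by split; [exact: (Rintegral_derive cR tT)|exact: (Rintegral_derive cI tT)].
have dPsiE t : 0 <= t <= T -> dPsi t = cexp (t%:C * - A) * (A * kappa * (g t - g t1)%:C).
  by move=> tT; rewrite /dPsi /V (XE tT) rmorphB/=; ring.
pose G t := \int[lebesgue_measure]_(s in `[0, t]) `|g s - g t1|.
have cgn : {within `[0, T], continuous (fun s => `|g s - g t1|)}.
  by move=> s; apply: cvg_norm; apply: cvgB; [exact: cg|exact: cvg_cst].
have sub12 : `[t1, t2] `<=` `[0, T].
  by apply: subset_itvScc; rewrite bnd_simp.
have icont (f : R -> R) : {within `[0, T], continuous f} ->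
    {within `[t1, t2], continuous (fun t => \int[lebesgue_measure]_(s in `[0, t]) f s)}.
  move=> cf; apply: (continuous_subspaceW sub12).
  have [L _ h] := Rintegral_lipschitz cf.
  by have [] := lipschitz_continuous_variation T0 h.
have eA t : 0 <= t <= T -> normc (cexp (t%:C * - A)) <= expR (normc A * T).
  move=> /andP[t0 tT]; rewrite (le_trans (normc_cexp_le _))// ler_expR.
  by rewrite normcM normcN normc_real ger0_norm// mulrC ler_wpM2l ?normc_ge0.
pose K := normc A * normc kappa * expR (normc A * T).
have bound t : t \in `]t1, t2[ -> normc (dPsi t) <= K * `|g t - g t1|.
  rewrite in_itv/= => /andP[tt1 tt2].
  have tT : 0 <= t <= T by rewrite (le_trans t10 (ltW tt1)) (le_trans (ltW tt2)).
  rewrite dPsiE// normcM (normcM (A * kappa)) (normcM A) normc_real.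
  have -> : K * `|g t - g t1| =
      expR (normc A * T) * (normc A * normc kappa * `|g t - g t1|) by rewrite /K; ring.
  by apply: ler_wpM2r; [rewrite !mulr_ge0 ?normc_ge0|exact: eA].
have cexpc (f : R[i] -> R) : (f = Re) \/ (f = Im) ->
    {within `[t1, t2], continuous (fun t => f (cexp (t%:C * - A)))}.
  move=> fE; apply: derivable_within_continuous => t _.
  by have [h1 h2] := cderive_cexp (- A) t; case: fE => ->; [case: h1|case: h2].
have cV (f : R[i] -> R) : (f = Re) \/ (f = Im) ->
    {within `[t1, t2], continuous (fun t => f (V t))}.
  have cst (c : R) : {within `[t1, t2], continuous (fun=> c : R)} by move=> s; exact: cvg_cst.
  have iR := icont _ cR; have iI := icont _ cI.
  case=> ->.
  - have -> : (fun t => Re (V t)) = (fun t => Re x0 + (Re A * (\int[lebesgue_measure]_(s in `[0, t]) Re (X s)) -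
       Im A * (\int[lebesgue_measure]_(s in `[0, t]) Im (X s))) + Re (kappa * (g t1)%:C)).
      by apply/funext => t; rewrite /V !cReD cReM.
    move=> s; apply: cvgD; last exact: cvg_cst.
    apply: cvgD; first exact: cvg_cst.
    by apply: cvgB; (apply: cvgM; first exact: cvg_cst); [exact: iR|exact: iI].
  - have -> : (fun t => Im (V t)) = (fun t => Im x0 + (Re A * (\int[lebesgue_measure]_(s in `[0, t]) Im (X s)) +
       Im A * (\int[lebesgue_measure]_(s in `[0, t]) Re (X s))) + Im (kappa * (g t1)%:C)).
      by apply/funext => t; rewrite /V !cImD cImM.
    move=> s; apply: cvgD; last exact: cvg_cst.
    apply: cvgD; first exact: cvg_cst.
    by apply: cvgD; (apply: cvgM; first exact: cvg_cst); [exact: iI|exact: iR].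
have inR : Re = Re \/ Re = Im by left.
have inI : Im = Re \/ Im = Im by right.
have cPR : {within `[t1, t2], continuous (fun t => Re (Psi t))}.
  have -> : (fun t => Re (Psi t)) = (fun t => Re (cexp (t%:C * - A)) * Re (V t) -
      Im (cexp (t%:C * - A)) * Im (V t)).
    by apply/funext => t; rewrite /Psi cReM.
  by move=> s; apply: cvgB; apply: cvgM;
    [exact: (cexpc _ inR)|exact: (cV _ inR)|exact: (cexpc _ inI)|exact: (cV _ inI)].
have cPI : {within `[t1, t2], continuous (fun t => Im (Psi t))}.
  have -> : (fun t => Im (Psi t)) = (fun t => Re (cexp (t%:C * - A)) * Im (V t) +
      Im (cexp (t%:C * - A)) * Re (V t)).
    by apply/funext => t; rewrite /Psi cImM.
  by move=> s; apply: cvgD; apply: cvgM;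
    [exact: (cexpc _ inR)|exact: (cV _ inI)|exact: (cexpc _ inI)|exact: (cV _ inR)].
have DG t : t \in `]t1, t2[ -> is_derive t 1 G (`|g t - g t1|).
  rewrite in_itv/= => /andP[tt1 tt2]; apply: (Rintegral_derive cgn).
  by rewrite (le_lt_trans t10 tt1) (lt_le_trans tt2).
have cG : {within `[t1, t2], continuous G} by exact: icont.
have hR : `|Re (Psi t2) - Re (Psi t1)| <= K * (G t2 - G t1).
  apply: (derive_bounded_increment (f := fun t => Re (Psi t)) (df := fun t => Re (dPsi t)) t12 _ DG cPR cG).
    by move=> t /DPsi[].
  by move=> t tt; rewrite (le_trans (normc_Re_le _))// bound.
have hI : `|Im (Psi t2) - Im (Psi t1)| <= K * (G t2 - G t1).
  apply: (derive_bounded_increment (f := fun t => Im (Psi t)) (df := fun t => Im (dPsi t)) t12 _ DG cPI cG).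
    by move=> t /DPsi[].
  by move=> t tt; rewrite (le_trans (normc_Im_le _))// bound.
have -> : X t2 - cexp (A * (t2 - t1)%:C) * X t1 - kappa * (g t2 - g t1)%:C =
    cexp (A * t2%:C) * (Psi t2 - Psi t1).
  have e2 : cexp (A * t2%:C) * cexp (t2%:C * - A) = 1.
    by rewrite -cexpD (_ : _ + _ = 0) ?cexp0//; ring.
  have e1 : cexp (A * t2%:C) * cexp (t1%:C * - A) = cexp (A * (t2 - t1)%:C).
    by rewrite -cexpD; congr cexp; rewrite rmorphB/=; ring.
  have V2 : X t2 = V t2 + kappa * (g t2 - g t1)%:C.
    by rewrite XE ?t20// /V rmorphB/=; ring.
  have V1 : X t1 = V t1 by rewrite XE ?t10.
  rewrite mulrBr /Psi (mulrA _ _ (V t2)) e2 (mulrA _ _ (V t1)) e1 -V1 V2; ring.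
rewrite normcM -(Rintegral_itv_add cgn t10 (ltW t12) t2T) -/(G t1) -/(G t2).
(* One exponential bounds [e^(- A t)] inside the derivative, the other bounds the factor [e^(A t2)]
   that undoes it; the 2 comes from adding real and imaginary parts. *)
have -> : 2 * (normc A * normc kappa) * expR (normc A * T) ^+ 2 * (G t2 - G t1) =
    expR (normc A * T) * (2 * (K * (G t2 - G t1))) by rewrite /K; ring.
apply: ler_pM; rewrite ?normc_ge0//.
  rewrite (le_trans (normc_cexp_le _))// ler_expR normcM normc_real ger0_norm//.
  by rewrite ler_wpM2l ?normc_ge0.
by rewrite (le_trans (normc_le_ReIm _))// cReB cImB mulr2n mulrDl mul1r lerD.
Qed.

End solution.
End linear_equation.

(** * Complex expectations and covariances *)

Section complex_expectation.
Context (R : realType) (d : measure_display) (Omega : measurableType d).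
Variable P : probability Omega R.
Notation Re := (@complex.Re R).
Notation Im := (@complex.Im R).
Implicit Types X Y : Omega -> R[i].

Definition cintegrable X :=
  P.-integrable setT (EFin \o (fun w => Re (X w))) /\
  P.-integrable setT (EFin \o (fun w => Im (X w))).

Lemma cexpectationE X :
  cexpectation P X = Complex (\int[P]_w Re (X w)) (\int[P]_w Im (X w)).
Proof. by rewrite /cexpectation unlock. Qed.

Lemma cintegrable_cst c : cintegrable (fun=> c).
Proof.
have ic (r : R) : P.-integrable setT (EFin \o (fun=> r) : Omega -> \bar R).
  by apply/Lfun1_integrable; exact: Lfun_cst.
by split; exact: ic.
Qed.

Lemma cexpectation_cst c : cexpectation P (fun=> c) = c.
Proof. by rewrite cexpectationE !Rintegral_prob_cst; case: c. Qed.

Lemma cintegrableD X Y : cintegrable X -> cintegrable Y ->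
  cintegrable (fun w => X w + Y w).
Proof.
move=> [X1 X2] [Y1 Y2]; split.
- have := integrableD measurableT X1 Y1; apply: eq_integrable => // w _ /=.
  by rewrite cReD EFinD.
- have := integrableD measurableT X2 Y2; apply: eq_integrable => // w _ /=.
  by rewrite cImD EFinD.
Qed.

Lemma cexpectationD X Y : cintegrable X -> cintegrable Y ->
  cexpectation P (fun w => X w + Y w) = cexpectation P X + cexpectation P Y.
Proof.
move=> [X1 X2] [Y1 Y2]; rewrite !cexpectationE; apply: complex_ext => /=.
- by rewrite -RintegralD//; apply: eq_Rintegral => w _; rewrite cReD.
- by rewrite -RintegralD//; apply: eq_Rintegral => w _; rewrite cImD.
Qed.

Lemma cintegrableZ c X : cintegrable X -> cintegrable (fun w => c * X w).
Proof.
move=> [X1 X2]; split.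
- have := integrableB measurableT (integrableZl measurableT (Re c) X1)
    (integrableZl measurableT (Im c) X2).
  by apply: eq_integrable => // w _ /=; rewrite cReM EFinB !EFinM.
- have := integrableD measurableT (integrableZl measurableT (Re c) X2)
    (integrableZl measurableT (Im c) X1).
  by apply: eq_integrable => // w _ /=; rewrite cImM EFinD !EFinM.
Qed.

Lemma cexpectationZ c X : cintegrable X ->
  cexpectation P (fun w => c * X w) = c * cexpectation P X.
Proof.
move=> [X1 X2]; rewrite !cexpectationE; apply: complex_ext; rewrite ?cReM ?cImM/=.
- have i1 : P.-integrable setT (EFin \o (fun w => Re c * Re (X w))).
    by have := integrableZl measurableT (Re c) X1; apply: eq_integrable.
  have i2 : P.-integrable setT (EFin \o (fun w => Im c * Im (X w))).
    by have := integrableZl measurableT (Im c) X2; apply: eq_integrable.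
  rewrite -!RintegralZl// -RintegralB//.
  by apply: eq_Rintegral => w _; rewrite cReM.
- have i1 : P.-integrable setT (EFin \o (fun w => Re c * Im (X w))).
    by have := integrableZl measurableT (Re c) X2; apply: eq_integrable.
  have i2 : P.-integrable setT (EFin \o (fun w => Im c * Re (X w))).
    by have := integrableZl measurableT (Im c) X1; apply: eq_integrable.
  rewrite -!RintegralZl// -RintegralD//.
  by apply: eq_Rintegral => w _; rewrite cImM.
Qed.

Lemma cexpectation_conj X : cintegrable X ->
  cexpectation P (fun w => conjc (X w)) = conjc (cexpectation P X).
Proof.
move=> [X1 X2]; rewrite !cexpectationE; congr Complex.
- by apply: eq_Rintegral => w _; case: (X w).
- rewrite -mulN1r -RintegralZl//.
  by apply: eq_Rintegral => w _; case: (X w) => a b /=; rewrite mulN1r.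
Qed.

Definition cmeasurable X :=
  measurable_fun setT (fun w => Re (X w)) /\ measurable_fun setT (fun w => Im (X w)).

Lemma ae_eq_cexpectation X Y : cmeasurable X -> cmeasurable Y ->
  (\forall w \ae P, X w = Y w) -> cexpectation P X = cexpectation P Y.
Proof.
move=> [X1 X2] [Y1 Y2] XY; rewrite !cexpectationE /Rintegral; congr (Complex (fine _) (fine _)).
- apply: ae_eq_integral => //; [exact/measurable_EFinP|exact/measurable_EFinP|].
  by apply: filterS XY => w -> _.
- apply: ae_eq_integral => //; [exact/measurable_EFinP|exact/measurable_EFinP|].
  by apply: filterS XY => w -> _.
Qed.

Lemma cmeasurableD X Y : cmeasurable X -> cmeasurable Y -> cmeasurable (fun w => X w + Y w).
Proof.
move=> [X1 X2] [Y1 Y2]; split.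
- by under eq_fun do rewrite cReD; exact: measurable_funD.
- by under eq_fun do rewrite cImD; exact: measurable_funD.
Qed.

Lemma cmeasurableZ c X : cmeasurable X -> cmeasurable (fun w => c * X w).
Proof.
move=> [X1 X2]; split.
- by under eq_fun do rewrite cReM; apply: measurable_funB; exact: measurable_funM.
- by under eq_fun do rewrite cImM; apply: measurable_funD; exact: measurable_funM.
Qed.

Lemma cmeasurableM X Y : cmeasurable X -> cmeasurable Y -> cmeasurable (fun w => X w * Y w).
Proof.
move=> [X1 X2] [Y1 Y2]; split.
- by under eq_fun do rewrite cReM; apply: measurable_funB; exact: measurable_funM.
- by under eq_fun do rewrite cImM; apply: measurable_funD; exact: measurable_funM.
Qed.

Lemma cmeasurable_conj X : cmeasurable X -> cmeasurable (fun w => conjc (X w)).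
Proof.
move=> [X1 X2]; split.
- by have -> : (fun w => Re (conjc (X w))) = (fun w => Re (X w)) by apply/funext => w; case: (X w).
- have -> : (fun w => Im (conjc (X w))) = (fun w => - Im (X w)) by apply/funext => w; case: (X w).
  exact: measurableT_comp.
Qed.

Section square_integrable.
Notation L2 X := (cLfun P 2%:E X).

Lemma cLfun2_integrable X : L2 X -> cintegrable X.
Proof.
move=> [X1 X2].
have sub (f : Omega -> R) : f \in Lfun P 2%:E -> P.-integrable setT (EFin \o f).
  move=> f2; apply/Lfun1_integrable; apply: Lfun_subset12 f2.
  exact: fin_num_measure.
by split; exact: sub.
Qed.

Lemma cLfun2_measurable X : L2 X -> cmeasurable X.
Proof.
move=> /cLfun2_integrable[X1 X2].
by split; [exact: integrable_fin_measurable X1|exact: integrable_fin_measurable X2].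
Qed.

Let Lfun2D (f g : Omega -> R) : f \in Lfun P 2%:E -> g \in Lfun P 2%:E ->
  (fun w => f w + g w) \in Lfun P 2%:E.
Proof.
move=> f2 g2; have le12 : (1 <= 2%:E :> \bar R)%E by rewrite lee_fin ler1n.
by have [_ h] := Lfun_addr_closed P le12; exact: h.
Qed.

Lemma cLfun2D X Y : L2 X -> L2 Y -> L2 (fun w => X w + Y w).
Proof.
move=> [X1 X2] [Y1 Y2]; split.
- have -> : (fun w => Re (X w + Y w)) = (fun w => Re (X w) + Re (Y w)).
    by apply/funext => w; rewrite cReD.
  exact: Lfun2D.
- have -> : (fun w => Im (X w + Y w)) = (fun w => Im (X w) + Im (Y w)).
    by apply/funext => w; rewrite cImD.
  exact: Lfun2D.
Qed.

Let Lfun2Z (a : R) (f : Omega -> R) : f \in Lfun P 2%:E -> (fun w => a * f w) \in Lfun P 2%:E.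
Proof.
move=> f2; have -> : (fun w => a * f w) = a \o* f.
  by apply/funext => w /=; rewrite mulrC.
exact: Lfun_scale (ler1n _ 2) f2.
Qed.

Lemma cLfun2Z c X : L2 X -> L2 (fun w => c * X w).
Proof.
move=> [X1 X2]; split.
- have -> : (fun w => Re (c * X w)) = (fun w => Re c * Re (X w) + (- Im c) * Im (X w)).
    by apply/funext => w; rewrite cReM mulNr.
  exact: (Lfun2D (Lfun2Z _ X1) (Lfun2Z _ X2)).
- have -> : (fun w => Im (c * X w)) = (fun w => Re c * Im (X w) + Im c * Re (X w)).
    by apply/funext => w; rewrite cImM.
  exact: (Lfun2D (Lfun2Z _ X2) (Lfun2Z _ X1)).
Qed.

Lemma cLfun2_cst c : L2 (fun=> c).
Proof. by split; exact: Lfun_cst. Qed.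

Lemma cLfun2_mulconj_integrable X Y : L2 X -> L2 Y ->
  cintegrable (fun w => X w * conjc (Y w)).
Proof.
move=> [X1 X2] [Y1 Y2].
have mulL (f g : Omega -> R) : f \in Lfun P 2%:E -> g \in Lfun P 2%:E ->
    P.-integrable setT (EFin \o (fun w => f w * g w)).
  by move=> f2 g2; apply/Lfun1_integrable; exact: Lfun2_mul_Lfun1.
split.
- have := integrableD measurableT (mulL _ _ X1 Y1) (mulL _ _ X2 Y2).
  apply: eq_integrable => // w _ /=; rewrite -EFinD cReM; congr EFin.
  by case: (Y w) => a b /=; ring.
- have := integrableB measurableT (mulL _ _ X2 Y1) (mulL _ _ X1 Y2).
  apply: eq_integrable => // w _ /=; rewrite -EFinB cImM; congr EFin.
  by case: (Y w) => a b /=; ring.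
Qed.

Lemma ccovarianceC X Y : L2 X -> L2 Y -> ccovariance P Y X = conjc (ccovariance P X Y).
Proof.
move=> LX LY; rewrite /ccovariance -cexpectation_conj.
  congr cexpectation; apply/funext => w.
  by rewrite rmorphM/= conjcK mulrC.
by apply: cLfun2_mulconj_integrable; (apply: cLfun2D => //; exact: cLfun2_cst).
Qed.

(** It makes the variance of the innovation [X2 - e X1] a function of the observed covariances. *)
Lemma ccovariance_combination e X1 X2 : L2 X1 -> L2 X2 ->
  ccovariance P (fun w => X2 w - e * X1 w) (fun w => X2 w - e * X1 w) =
  ccovariance P X2 X2 - e * ccovariance P X1 X2 -
  conjc e * conjc (ccovariance P X1 X2) + e * conjc e * ccovariance P X1 X1.
Proof.
move=> L1 L2'; rewrite -ccovarianceC//.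
pose X1c w := X1 w - cexpectation P X1; pose X2c w := X2 w - cexpectation P X2.
have L1c : L2 X1c by apply: cLfun2D => //; exact: cLfun2_cst.
have L2c : L2 X2c by apply: cLfun2D => //; exact: cLfun2_cst.
have EY : cexpectation P (fun w => X2 w - e * X1 w) =
    cexpectation P X2 - e * cexpectation P X1.
  have i1 := cLfun2_integrable L1; have i2 := cLfun2_integrable L2'.
  have -> : (fun w => X2 w - e * X1 w) = (fun w => X2 w + (- e) * X1 w).
    by apply/funext => w; rewrite mulNr.
  by rewrite cexpectationD ?cexpectationZ ?mulNr//; exact: cintegrableZ.
rewrite {1}/ccovariance EY.
have -> : (fun w => (X2 w - e * X1 w - (cexpectation P X2 - e * cexpectation P X1)) *
    conjc (X2 w - e * X1 w - (cexpectation P X2 - e * cexpectation P X1))) =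
  (fun w => X2c w * conjc (X2c w) + ((- e) * (X1c w * conjc (X2c w)) +
     ((- conjc e) * (X2c w * conjc (X1c w)) + (e * conjc e) * (X1c w * conjc (X1c w))))).
  apply/funext => w; rewrite /X1c /X2c !(rmorphB, rmorphM)/=; ring.
have i22 := cLfun2_mulconj_integrable L2c L2c.
have i12 := cLfun2_mulconj_integrable L1c L2c.
have i21 := cLfun2_mulconj_integrable L2c L1c.
have i11 := cLfun2_mulconj_integrable L1c L1c.
have j12 := cintegrableZ (- e) i12.
have j21 := cintegrableZ (- conjc e) i21.
have j11 := cintegrableZ (e * conjc e) i11.
have k1 := cintegrableD j21 j11.
rewrite cexpectationD//; last exact: cintegrableD.
by rewrite cexpectationD// cexpectationD// !cexpectationZ// /ccovariance !mulNr !addrA.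
Qed.

Lemma ccovarianceZ c X : L2 X ->
  ccovariance P (fun w => c * X w) (fun w => c * X w) = c * conjc c * ccovariance P X X.
Proof.
move=> LX; rewrite /ccovariance cexpectationZ; last exact: cLfun2_integrable.
have LXc : L2 (fun w => X w - cexpectation P X) by apply: cLfun2D => //; exact: cLfun2_cst.
rewrite -(cexpectationZ (c * conjc c) (cLfun2_mulconj_integrable LXc LXc)).
by congr cexpectation; apply/funext => w; rewrite -mulrBr rmorphM/=; ring.
Qed.

Lemma ae_eq_ccovariance X Y : cmeasurable X -> cmeasurable Y ->
  (\forall w \ae P, X w = Y w) -> ccovariance P X X = ccovariance P Y Y.
Proof.
move=> mX mY XY; rewrite /ccovariance (ae_eq_cexpectation mX mY XY).
have mc c : cmeasurable (fun=> c) by split; exact: measurable_cst.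
apply: ae_eq_cexpectation.
- by apply: cmeasurableM; [|apply: cmeasurable_conj]; apply: cmeasurableD.
- by apply: cmeasurableM; [|apply: cmeasurable_conj]; apply: cmeasurableD.
- by apply: filterS XY => w ->.
Qed.

(** The variance is the integral of the nonnegative function [|X - E X|^2], which must then vanish
    almost everywhere. *)
Lemma ccovariance0_cst X : L2 X -> ccovariance P X X = 0 ->
  \forall w \ae P, X w = cexpectation P X.
Proof.
move=> LX; pose Y w := X w - cexpectation P X.
have LY : L2 Y by apply: cLfun2D => //; exact: cLfun2_cst.
have [iR _] := cLfun2_mulconj_integrable LY LY.
rewrite /ccovariance -/(Y _) cexpectationE => /(congr1 Re)/=.
have YE w : Re (Y w * conjc (Y w)) = Re (Y w) ^+ 2 + Im (Y w) ^+ 2.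
  by case: (Y w) => a b /=; ring.
move=> E0.
have : (\int[P]_w `|(Re (Y w * conjc (Y w)))%:E| = 0)%E.
  have -> : (\int[P]_w `|(Re (Y w * conjc (Y w)))%:E| = \int[P]_w (Re (Y w * conjc (Y w)))%:E)%E.
    by apply: eq_integral => w _; rewrite /= YE ger0_norm// addr_ge0 ?sqr_ge0.
  by rewrite -[LHS]fineK ?(integrable_fin_num _ iR)// -[fine _]/(Rintegral _ _ _) E0.
have mR : measurable_fun setT (fun w => (Re (Y w * conjc (Y w)))%:E).
  by apply/measurable_EFinP; exact: integrable_fin_measurable iR.
move/(ae_eq_integral_abs P measurableT mR); apply: filterS => w /(_ Logic.I) [].
rewrite YE => /eqP; rewrite paddr_eq0 ?sqr_ge0// !sqrf_eq0 => /andP[/eqP r0 /eqP i0].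
by apply/eqP; rewrite -subr_eq0; apply/eqP/complex_ext.
Qed.

End square_integrable.
End complex_expectation.

(** * Modes with additive noise *)

Section indistinguishability.
Context (R : realType) (d : measure_display) (Omega : measurableType d).
Variable P : probability Omega R.

Lemma within_continuous_eq (f g : R -> R) (T : R) : 0 < T ->
  {within `[0, T], continuous f} -> {within `[0, T], continuous g} ->
  (forall q : rat, 0 <= (ratr q : R) <= T -> f (ratr q) = g (ratr q)) ->
  forall t, 0 <= t <= T -> f t = g t.
Proof.
move=> T0 cf cg fg t /[dup] tT /andP[t0 tT'].
have cfg : {within `[0, T], continuous (fun x => f x - g x)}.
  by move=> x; apply: cvgB; [exact: cf|exact: cg].
apply/eqP; rewrite -subr_eq0 -normr_le0; apply/ler_addgt0Pl => e e0; rewrite addr0.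
have [m m0 hm] := within_unif_continuous cfg e0.
have lt_q : Num.max 0 (t - m) < Num.min T (t + m).
  by rewrite gt_max !lt_min T0 !ltrBlDr; apply/andP; split; apply/andP; split; lra.
have [q] := rat_in_itvoo lt_q; rewrite in_itv/= => /andP[].
rewrite gt_max => /andP[q0 tq]; rewrite lt_min => /andP[qT qt].
have qT' : 0 <= (ratr q : R) <= T by rewrite !ltW.
have := hm t (ratr q) tT qT'; rewrite (fg q qT') subrr subr0; apply.
by rewrite ler_norml; apply/andP; split; lra.
Qed.

(** Rational times are countable, so one null set serves all of them, and continuity extends the
    equality to every time. *)
Lemma indistinguishable (T : R) (X Y : R -> Omega -> R) : 0 < T ->
  continuous_paths P T X -> continuous_paths P T Y ->
  (forall t, 0 <= t <= T -> \forall w \ae P, X t w = Y t w) ->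
  \forall w \ae P, forall t, 0 <= t <= T -> X t w = Y t w.
Proof.
move=> T0 cX cY XY.
(* [unpickle] enumerates the rationals by natural numbers; indices that code no rational contribute
   a trivial statement. *)
have : \forall w \ae P, forall n : nat, if unpickle n is Some q
    then 0 <= (ratr q : R) <= T -> X (ratr q) w = Y (ratr q) w else True.
  apply/ae_foralln => n; case: (unpickle n) => [q|]; last exact: aeW.
  have [qT|qT] := pselect (0 <= (ratr q : R) <= T); last by apply: aeW.
  by apply: filterS (XY _ qT).
move=> H; apply: filterS3 H cX cY => w Hw cXw cYw t tT.
apply: (within_continuous_eq T0 cXw cYw) => // q qT.
by have := Hw (pickle q); rewrite pickleK; apply.
Qed.

(** The null set of the equation may depend on [t]; continuity of both sides yields a single one,
    after which each path can be treated as a deterministic function. *)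
Lemma linear_mode_paths (W : R -> Omega -> R) (T : R) (A kappa : R[i])
    (x0 : Omega -> R[i]) (X : R -> Omega -> R[i]) : 0 < T ->
  continuous_paths P T W ->
  continuous_paths P T (fun t w => complex.Re (X t w)) ->
  continuous_paths P T (fun t w => complex.Im (X t w)) ->
  (forall t, 0 <= t <= T -> \forall w \ae P,
    X t w = x0 w + A * cRintegral (fun s => X s w) t + kappa * (W t w - W 0 w)%:C) ->
  \forall w \ae P, forall t, 0 <= t <= T ->
    X t w = x0 w + A * cRintegral (fun s => X s w) t + kappa * (W t w - W 0 w)%:C.
Proof.
move=> T0 cW cR cI XE.
pose Y t w := x0 w + A * cRintegral (fun s => X s w) t + kappa * (W t w - W 0 w)%:C.
have cint (f : R -> R) : {within `[0, T], continuous f} ->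
    {within `[0, T], continuous (fun t => \int[lebesgue_measure]_(s in `[0, t]) f s)}.
  move=> cf; have [L _ h] := Rintegral_lipschitz cf.
  by have [] := lipschitz_continuous_variation T0 h.
have cY : (continuous_paths P T (fun t w => complex.Re (Y t w))) /\
    (continuous_paths P T (fun t w => complex.Im (Y t w))).
  split; apply: filterS3 cW cR cI => w cWw cRw cIw.
  - have -> : (fun t => complex.Re (Y t w)) = (fun t => complex.Re (x0 w) +
        (complex.Re A * (\int[lebesgue_measure]_(s in `[0, t]) complex.Re (X s w)) -
         complex.Im A * (\int[lebesgue_measure]_(s in `[0, t]) complex.Im (X s w))) +
        complex.Re kappa * (W t w - W 0 w)).
      by apply/funext => t; rewrite /Y !cReD cReM cReMr.
    move=> s; apply: cvgD; last first.
      by apply: cvgM; [exact: cvg_cst|apply: cvgB; [exact: cWw|exact: cvg_cst]].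
    apply: cvgD; first exact: cvg_cst.
    by apply: cvgB; (apply: cvgM; first exact: cvg_cst); [exact: cint cRw _|exact: cint cIw _].
  - have -> : (fun t => complex.Im (Y t w)) = (fun t => complex.Im (x0 w) +
        (complex.Re A * (\int[lebesgue_measure]_(s in `[0, t]) complex.Im (X s w)) +
         complex.Im A * (\int[lebesgue_measure]_(s in `[0, t]) complex.Re (X s w))) +
        complex.Im kappa * (W t w - W 0 w)).
      by apply/funext => t; rewrite /Y !cImD cImM cImMr.
    move=> s; apply: cvgD; last first.
      by apply: cvgM; [exact: cvg_cst|apply: cvgB; [exact: cWw|exact: cvg_cst]].
    apply: cvgD; first exact: cvg_cst.
    by apply: cvgD; (apply: cvgM; first exact: cvg_cst); [exact: cint cIw _|exact: cint cRw _].
have XYR : \forall w \ae P, forall t, 0 <= t <= T -> complex.Re (X t w) = complex.Re (Y t w).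
  apply: (@indistinguishable T (fun t w => complex.Re (X t w)) (fun t w => complex.Re (Y t w)) T0 cR).
    by case: cY.
  by move=> t /XE; apply: filterS => w ->.
have XYI : \forall w \ae P, forall t, 0 <= t <= T -> complex.Im (X t w) = complex.Im (Y t w).
  apply: (@indistinguishable T (fun t w => complex.Im (X t w)) (fun t w => complex.Im (Y t w)) T0 cI).
    by case: cY.
  by move=> t /XE; apply: filterS => w ->.
apply: filterS2 XYR XYI => w h1 h2 t tT.
by apply: complex_ext; [exact: h1|exact: h2].
Qed.

End indistinguishability.

(** * Stratonovich integrals of constants *)

Section constant_integrand.
Context (R : realType) (d : measure_display) (Omega : measurableType d).
Variables (P : probability Omega R) (F : R -> set (set Omega)) (W : R -> Omega -> R).
Hypotheses (cF : complete_filtration P F) (bW : brownian_motion P F W).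

(** It ensures that a limit along partitions is not a vacuous condition. A uniform grid serves for
    [t > 0], the empty list for [t = 0]. *)
Lemma fine_partition (t delta : R) : 0 <= t -> 0 < delta ->
  exists2 s, itv_partition 0 t s & mesh t s < delta.
Proof.
rewrite le_eqVlt => /predU1P[<- d0|t0 d0].
  by exists [::]; rewrite ?/mesh ?big_geq//; split => //=.
have [n tn] : exists n : nat, t / n.+1%:R < delta.
  have : t * n.+1%:R^-1 @[n --> \oo] --> (0 : R).
    rewrite -[0 in X in _ --> X](mulr0 t); apply: cvgM; first exact: cvg_cst.
    exact: cvg_harmonic.
  by move/cvgr_lt => /(_ _ d0) [n _ /(_ n (leqnn n)) h]; exists n.
pose g k : R := t * k%:R / n.+1%:R.
pose s := mkseq (fun k => g k.+1) n.+1.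
have n0 : (n.+1%:R : R) != 0 by rewrite pnatr_eq0.
have gS k : g k.+1 - g k = t / n.+1%:R by rewrite /g -natr1; field.
have nthE x i : (i <= n.+1)%N -> nth x (0 :: s) i = g i.
  case: i => [|i] iN; first by rewrite /= /g mulr0 mul0r.
  by rewrite /= nth_mkseq.
exists s.
  split.
    apply/(pathP 0) => i; rewrite size_mkseq => iN.
    rewrite nthE ?(ltnW iN)// nth_mkseq// -subr_gt0 gS divr_gt0//.
  apply/eqP; rewrite (last_nth 0) size_mkseq nthE// /g mulfK//.
rewrite /mesh size_mkseq big_nat_cond.
apply: (big_ind (fun x => x < delta)) => // [x y xd yd|k /andP[/andP[_ kn] _]].
  by rewrite gt_max xd.
by rewrite !nthE ?gS// ltnW.
Qed.

(** As the sums do not vary with the partition, each deviation probability is below every [eta > 0],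
    hence 0; countably many levels [1 / (n + 1)] then suffice. *)
Lemma partition_limit_stationary (T t : R) (S : R -> seq R -> Omega -> R)
    (Y : R -> Omega -> R) (Z : Omega -> R) : 0 <= t <= T ->
  partition_limit P T S Y -> measurable_fun setT (Y t) -> measurable_fun setT Z ->
  (forall s w, itv_partition 0 t s -> S t s w = Z w) ->
  \forall w \ae P, Y t w = Z w.
Proof.
move=> tT SY mY mZ SZ.
have H (n : nat) : \forall w \ae P, `|Z w - Y t w| < n.+1%:R^-1.
  pose A := [set w | n.+1%:R^-1 <= `|Z w - Y t w|].
  have mA : measurable A.
    have mh : measurable_fun setT (fun w => `|Z w - Y t w|).
      by apply: measurableT_comp => //; exact: measurable_funB.
    have -> : A = (fun w => `|Z w - Y t w|) @^-1` `[n.+1%:R^-1, +oo[.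
      by apply/seteqP; split => w /=; rewrite /A/= in_itv/= andbT.
    by rewrite -[X in measurable X]setTI; apply: mh.
  have PA : P A = 0%E.
    apply/eqP; rewrite eq_le measure_ge0 andbT; apply/lee_addgt0Pr => eta eta0; rewrite add0e.
    have n0 : 0 < (n.+1%:R^-1 : R) by rewrite invr_gt0.
    have [delta d0 h] := SY t tT _ eta n0 eta0.
    have [s ps ms] := @fine_partition t delta (proj1 (andP tT)) d0.
    have := h s ps ms; congr (_ <= _)%E; congr (P _).
    by apply/seteqP; split => w /=; rewrite SZ.
  exists A; split => // w /= /negP; rewrite -leNgt; exact.
have /ae_foralln := H; apply: filterS => w Hw.
apply/eqP; rewrite eq_sym -subr_eq0 -normr_le0; apply/ler_addgt0Pl => e e0; rewrite addr0.
have [n ne] : exists n : nat, (n.+1%:R^-1 : R) < e.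
  have : (n.+1%:R^-1 : R) @[n --> \oo] --> (0 : R) by exact: cvg_harmonic.
  by move/cvgr_lt => /(_ _ e0) [n _ /(_ n (leqnn n)) h]; exists n.
exact: ltW (lt_trans (Hw n) ne).
Qed.

(** For every partition the left sums telescope to [c (W_t - W_0)] and the covariation sums are
    0. *)
Lemma stratonovich_integral_cst (T c : R) (J : R -> Omega -> R) :
  is_stratonovich_integral P F T (fun _ _ => c) W J ->
  forall t, 0 <= t <= T -> \forall w \ae P, J t w = c * (W t w - W 0 w).
Proof.
move=> [I [C [[_ _ aI limI] [aC _ _ limC] JE]]] t tT.
have t0 : 0 <= t by case/andP: tT.
have mI := measurable_wrt_filtration cF t0 (aI t tT).
have mC := measurable_wrt_filtration cF t0 (aC t tT).
have mW : measurable_fun setT (fun w => c * (W t w - W 0 w)).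
  apply: measurable_funM => //.
  by apply: measurable_funB; apply: (measurable_brownian cF bW).
have It : \forall w \ae P, I t w = c * (W t w - W 0 w).
  apply: (partition_limit_stationary tT limI mI mW) => s w ps.
  rewrite /left_sum -mulr_sumr.
  rewrite (telescope_sumr (fun k => W (nth t (0 :: s) k) w))//.
  by rewrite (itv_partition_nth_size _ ps).
have Ct : \forall w \ae P, C t w = 0.
  apply: (partition_limit_stationary tT limC mC (measurable_cst _)) => s w ps.
  by rewrite /covariation_sum big1// => k _; rewrite subrr mul0r.
apply: filterS3 It Ct (JE t tT) => w -> -> ->.
by rewrite mul0r addr0.
Qed.

Lemma additive_mode_paths (T : R) (A B r : R[i]) (x0 : Omega -> R[i])
    (X : R -> Omega -> R[i]) : 0 < T ->
  mode_equation P F W T A B x0 (fun _ _ => r) X ->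
  \forall w \ae P, forall t, 0 <= t <= T ->
    X t w = x0 w + A * cRintegral (fun s => X s w) t + (B * r) * (W t w - W 0 w)%:C.
Proof.
move=> T0 [_ [cR cI] [J [JR JI XE]]].
apply: linear_mode_paths => //; first by apply: (brownian_continuous bW); exact: ltW.
move=> t tT; have hR := stratonovich_integral_cst JR tT.
have hI := stratonovich_integral_cst JI tT.
apply: filterS3 hR hI (XE t tT) => w hRw hIw ->.
rewrite /cRintegral; congr (_ + _); rewrite -mulrA; congr (_ * _).
by apply: complex_ext; rewrite ?cReMr ?cImMr.
Qed.

End constant_integrand.

Section fatou_bound.
Context (R : realType) (d : measure_display) (Omega : measurableType d).
Variable P : probability Omega R.

Lemma limn_einf_le (u : nat -> \bar R) c :
  (forall n, (u n <= c)%E) -> (limn_einf u <= c)%E.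
Proof.
move=> uc; rewrite limn_einf_lim; apply: lime_le; first exact: is_cvg_einfs.
apply: nearW => n; apply: le_trans (uc n); apply: ereal_inf_lbound.
by exists n => /=.
Qed.

Lemma limn_einf_ge (u : nat -> \bar R) c :
  (forall n, (c <= u n)%E) -> (c <= limn_einf u)%E.
Proof.
move=> uc; rewrite limn_einf_lim; apply: lime_ge; first exact: is_cvg_einfs.
by apply: nearW => n; apply: le_ereal_inf_tmp => _ [k _ <-].
Qed.

(** Fatou's lemma followed by comparison with a minorant; measurability is asked of [g] rather than
    of [l], which is a time integral in the application. *)
Lemma ae_limit_integral_le (f : nat -> Omega -> R) (g l : Omega -> R) (c : \bar R) :
  (forall n, measurable_fun setT (f n)) -> measurable_fun setT g ->
  (forall n w, 0 <= f n w) -> (forall w, 0 <= g w) ->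
  (\forall w \ae P, f n w @[n --> \oo] --> l w) ->
  (\forall w \ae P, g w <= l w) ->
  (forall n, (\int[P]_w (f n w)%:E <= c)%E) -> (\int[P]_w (g w)%:E <= c)%E.
Proof.
move=> mf mg f0 g0 fl gl fc.
have mf' n : measurable_fun setT (fun w => (f n w)%:E) by exact/measurable_EFinP.
have f0' n w : setT w -> (0 <= (f n w)%:E)%E by move=> _; rewrite lee_fin.
apply: (@le_trans _ _ (\int[P]_w limn_einf (fun n => (f n w)%:E))%E).
  apply: ae_ge0_le_integral => //.
  - by move=> w _; rewrite lee_fin.
  - exact/measurable_EFinP.
  - by move=> w _; apply: limn_einf_ge => n; rewrite lee_fin.
  - rewrite /limn_einf; apply: measurableT_comp => //.
    by apply: measurable_fun_limn_esup => n; exact: measurableT_comp.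
  - apply: filterS2 fl gl => w fw gw _.
    have fw' : (f n w)%:E @[n --> \oo] --> (l w)%:E by apply: cvg_EFin fw; apply: nearW.
    rewrite is_cvg_limn_einfE; last by apply/cvg_ex; eexists; exact: fw'.
    by rewrite (cvg_lim _ fw')// lee_fin.
by apply: (le_trans (fatou P measurableT mf' f0')); exact: limn_einf_le.
Qed.

End fatou_bound.

(** * Correlation of the Brownian area with the increment *)

Section additive_noise.
Context (R : realType) (d : measure_display) (Omega : measurableType d).
Variables (P : probability Omega R) (F : R -> set (set Omega)) (W : R -> Omega -> R).
Hypotheses (cF : complete_filtration P F) (bW : brownian_motion P F W).

Let mW t : 0 <= t -> measurable_fun setT (W t).
Proof. by move=> t0; exact: (measurable_brownian cF bW). Qed.

(** By [|x y| <= (x^2 + y^2) / 2], with variances [s - t1] and [t2 - t1], both at most [t2 - t1]. *)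
Lemma increment_product_bound (t1 s t2 : R) : 0 <= t1 -> t1 <= s -> s <= t2 -> t1 < t2 ->
  (\int[P]_w (`|W s w - W t1 w| * `|W t2 w - W t1 w|)%:E <= (t2 - t1)%:E)%E.
Proof.
move=> t10 + st2 t12; rewrite le_eqVlt => /predU1P[<-|t1s].
  under eq_integral do rewrite subrr normr0 mul0r.
  by rewrite integral0 lee_fin subr_ge0 ltW.
have s0 : 0 <= s by rewrite (le_trans t10)// ltW.
have t20 : 0 <= t2 by rewrite (le_trans s0).
have ms := measurable_increment cF bW t10 t1s.
have mt := measurable_increment cF bW t10 t12.
have i1 := increment_pow_integrable cF bW 2 t10 t1s.
have i2 := increment_pow_integrable cF bW 2 t10 t12.
have iD : P.-integrable setT (EFin \o (fun w => (W s w - W t1 w) ^+ 2 + (W t2 w - W t1 w) ^+ 2)).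
  by have := integrableD measurableT i1 i2; apply: eq_integrable.
have ig : P.-integrable setT (EFin \o (fun w => 2^-1 * ((W s w - W t1 w) ^+ 2 + (W t2 w - W t1 w) ^+ 2))).
  by have := integrableZl measurableT 2^-1 iD; apply: eq_integrable.
have pw w : `|W s w - W t1 w| * `|W t2 w - W t1 w| <=
    2^-1 * ((W s w - W t1 w) ^+ 2 + (W t2 w - W t1 w) ^+ 2).
  rewrite -[X in _ <= 2^-1 * (X + _)]real_normK ?num_real//.
  rewrite -[X in _ <= 2^-1 * (_ + X)]real_normK ?num_real//.
  set x := `|_|; set y := `|_|; have := sqr_ge0 (x - y); rewrite sqrrB; lra.
apply: (le_trans (ge0_le_integral_EFin P _ (integrable_fin_measurable ig) _ pw)).
- by apply: measurable_funM; exact: measurableT_comp.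
- by move=> w; rewrite mulr_ge0.
rewrite -[leLHS]fineK ?(integrable_fin_num _ ig)// lee_fin -[fine _]/(Rintegral _ _ _).
rewrite (RintegralZl _ measurableT iD) (RintegralD measurableT i1 i2).
rewrite (increment_variance cF bW t10 t1s) (increment_variance cF bW t10 t12); lra.
Qed.

Section area.
Variables (T t1 t2 C : R) (rho : Omega -> R).
Hypotheses (t10 : 0 <= t1) (t12 : t1 < t2) (t2T : t2 <= T) (C0 : 0 <= C).
Hypothesis mrho : measurable_fun setT rho.
Hypothesis rhoC : \forall w \ae P,
  `|rho w| <= C * \int[lebesgue_measure]_(s in `]t1, t2]) `|W s w - W t1 w|.

Let p n k : R := t1 + (t2 - t1) * k%:R / n.+1%:R.

Let pS n k : p n k.+1 - p n k = (t2 - t1) / n.+1%:R.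
Proof.
have n0 : (n.+1%:R : R) != 0 by rewrite pnatr_eq0.
by rewrite /p -natr1; field.
Qed.

Let pN n : p n n.+1 = t2.
Proof. by rewrite /p mulfK ?pnatr_eq0// addrC subrK. Qed.

Let p_itv n k : (k <= n.+1)%N -> t1 <= p n k <= t2.
Proof.
move=> kn; have h0 : 0 <= t2 - t1 by rewrite subr_ge0 ltW.
rewrite lerDl divr_ge0 ?mulr_ge0//= -lerBrDl -mulrA ler_piMr//.
by rewrite ler_pdivrMr ?ltr0n// mul1r ler_nat.
Qed.

(** Riemann sums of the area times the increment: their means involve [W] at finitely many times
    only, so time integral and expectation are never interchanged directly. *)
Let f n w : R := C * \sum_(0 <= k < n.+1)
  (`|W (p n k) w - W t1 w| * `|W t2 w - W t1 w|) * (p n k.+1 - p n k).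

Let mterm n k : (k < n.+1)%N -> measurable_fun setT
  (fun w => (`|W (p n k) w - W t1 w| * `|W t2 w - W t1 w|) * (p n k.+1 - p n k)).
Proof.
move=> kn; have /andP[h1 h2] := p_itv (ltnW kn).
have t20 : 0 <= t2 := le_trans t10 (ltW t12).
apply: measurable_funM => //; apply: measurable_funM; apply: measurableT_comp => //;
  apply: measurable_funB; apply: mW => //; exact: le_trans h1.
Qed.

Let f_integral n : measurable_fun setT (f n) /\
  (\int[P]_w (f n w)%:E <= (C * (t2 - t1) ^+ 2)%:E)%E.
Proof.
have step m : (m <= n.+1)%N ->
    measurable_fun setT (fun w => \sum_(0 <= k < m)
      (`|W (p n k) w - W t1 w| * `|W t2 w - W t1 w|) * (p n k.+1 - p n k)) /\
    (\int[P]_w (\sum_(0 <= k < m)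
      (`|W (p n k) w - W t1 w| * `|W t2 w - W t1 w|) * (p n k.+1 - p n k))%:E <=
      ((t2 - t1) * (p n m - p n 0%N))%:E)%E.
  elim: m => [_|m IH mn].
    under eq_fun do rewrite big_geq//.
    split; first exact: measurable_cst.
    under eq_integral do rewrite big_geq//.
    by rewrite integral0 subrr mulr0.
  have [mI bI] := IH (ltnW mn); have mt := mterm mn.
  have /andP[h1 h2] := p_itv (ltnW mn).
  have tau0 : 0 <= p n m.+1 - p n m by rewrite pS divr_ge0// subr_ge0 ltW.
  split.
    by under eq_fun do rewrite big_nat_recr//=; exact: measurable_funD.
  under eq_integral do rewrite big_nat_recr//=.
  rewrite ge0_integralD_EFin//; last 2 first.
  - move=> w; rewrite big_nat_cond sumr_ge0// => k /andP[/andP[_ km] _].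
    by rewrite !mulr_ge0// pS divr_ge0// subr_ge0 ltW.
  - by move=> w; rewrite !mulr_ge0.
  have -> : ((t2 - t1) * (p n m.+1 - p n 0%N))%:E =
     ((t2 - t1) * (p n m - p n 0%N))%:E + ((p n m.+1 - p n m) * (t2 - t1))%:E.
    by rewrite -EFinD; congr EFin; ring.
  apply: leeD => //.
  under eq_integral do rewrite mulrC.
  rewrite ge0_integralZl_EFin//.
    by rewrite EFinM lee_wpmul2l ?lee_fin// increment_product_bound.
  have t20 : 0 <= t2 := le_trans t10 (ltW t12).
  apply: measurable_funM; apply: measurableT_comp => //; apply: measurable_funB;
    apply: mW => //; exact: le_trans h1.
have [mS bS] := step n.+1 (leqnn _); split; first exact: measurable_funM.
rewrite ge0_integralZl_EFin//; last first.
  move=> w; rewrite big_nat_cond sumr_ge0// => k _.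
  by rewrite !mulr_ge0// pS divr_ge0// subr_ge0 ltW.
rewrite EFinM lee_wpmul2l ?lee_fin//; apply: (le_trans bS).
by rewrite pN /p mulr0 mul0r addr0 lee_fin expr2.
Qed.

Let f_cvg : \forall w \ae P, f n w @[n --> \oo] -->
  C * (\int[lebesgue_measure]_(s in `]t1, t2]) `|W s w - W t1 w|) * `|W t2 w - W t1 w|.
Proof.
have t20 : 0 <= t2 := le_trans t10 (ltW t12).
have T0 : 0 <= T := le_trans t20 t2T.
apply: filterS (brownian_continuous bW T0) => w cw.
have cn : {within `[t1, t2], continuous (fun s => `|W s w - W t1 w|)}.
  have sub : `[t1, t2] `<=` `[0, T] by apply: subset_itvScc; rewrite bnd_simp.
  have cw' := continuous_subspaceW sub cw.
  by move=> s; apply: cvg_norm; apply: cvgB; [exact: cw'|exact: cvg_cst].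
have := @riemann_sum_cvg _ _ t1 t2 p (fun n => n.+1) (fun n => (t2 - t1) / n.+1%:R) cn _ pN _ _.
have -> : (fun n => f n w) = (fun n => C * (\sum_(0 <= k < n.+1)
   `|W (p n k) w - W t1 w| * (p n k.+1 - p n k)) * `|W t2 w - W t1 w|).
  apply/funext => n; rewrite /f -mulrA; congr (_ * _); rewrite mulr_suml.
  by apply: eq_bigr => k _; ring.
rewrite Rintegral_itv_obnd_cbnd; last first.
  apply: integrableS (within_continuous_integrable cn) => //.
  by apply: subset_itvr; rewrite bnd_simp.
move=> h; apply: cvgM; last exact: cvg_cst.
apply: cvgM; first exact: cvg_cst.
apply: h.
- by move=> n; rewrite /p mulr0 mul0r addr0.
- move=> n k _; rewrite -subr_ge0 pS divr_ge0 ?subr_ge0 ?(ltW t12)//=.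
  by rewrite -lerBlDl pS.
- rewrite -[0 in X in _ --> X](mulr0 (t2 - t1)); apply: cvgM; first exact: cvg_cst.
  exact: cvg_harmonic.
Qed.

(* Fatou's lemma along Riemann sums of the area. *)
Lemma area_product_bound :
  (\int[P]_w (`|rho w * (W t2 w - W t1 w)|)%:E <= (C * (t2 - t1) ^+ 2)%:E)%E.
Proof.
have t20 : 0 <= t2 := le_trans t10 (ltW t12).
apply: (@ae_limit_integral_le _ _ _ _ f _ (fun w => C *
  (\int[lebesgue_measure]_(s in `]t1, t2]) `|W s w - W t1 w|) * `|W t2 w - W t1 w|)).
- by move=> n; have [] := f_integral n.
- by apply: measurableT_comp => //; apply: measurable_funM => //; apply: measurable_funB; exact: mW.
- move=> n w; rewrite /f mulr_ge0// big_nat_cond sumr_ge0// => k _.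
  by rewrite !mulr_ge0// pS divr_ge0// subr_ge0 ltW.
- by move=> w; exact: normr_ge0.
- exact: f_cvg.
- by apply: filterS rhoC => w rw; rewrite normrM ler_wpM2r.
- by move=> n; have [] := f_integral n.
Qed.

End area.
End additive_noise.

(** * Identification of [|B|] with additive noise *)

Section additive_identification.
Context (R : realType) (d : measure_display) (Omega : measurableType d).
Variables (P : probability Omega R) (F : R -> set (set Omega)) (W : R -> Omega -> R).
Hypotheses (cF : complete_filtration P F) (bW : brownian_motion P F W).
Variables (T : R) (A : R[i]).
Hypothesis T0 : 0 < T.
Notation Re := (@complex.Re R).
Notation Im := (@complex.Im R).

(** The constant of [linear_equation_increment] with the factor [normc kappa] removed; it depends on
    [A] and [T] only. *)
Let C : R := 2 * normc A * expR (normc A * T) ^+ 2.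

Let C0 : 0 <= C.
Proof. by rewrite !mulr_ge0 ?normc_ge0 ?exprn_ge0 ?expR_ge0. Qed.

Let contW : continuous_paths P T W.
Proof. by apply: (brownian_continuous bW); exact: ltW. Qed.

Section two_times.
Variables (t1 t2 : R).
Hypotheses (t10 : 0 <= t1) (t12 : t1 < t2) (t2T : t2 <= T).
Let e := cexp (A * (t2 - t1)%:C).

Let t1T : 0 <= t1 <= T.
Proof. by rewrite t10 (le_trans (ltW t12)). Qed.

Let t2T' : 0 <= t2 <= T.
Proof. by rewrite t2T (le_trans t10 (ltW t12)). Qed.

(** For a constant innovation, [rho] is a constant minus the increment and is dominated by the area.
    As the increment has mean 0 and variance [t2 - t1], the mean of [rho] times the increment is
    exactly [- (t2 - t1)], while the area bound allows at most [C (t2 - t1)^2] in absolute value. *)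
Lemma mode_innovation_not_cst (B r : R[i]) (x0 : Omega -> R[i]) (X : R -> Omega -> R[i]) m :
  B * r != 0 -> mode_equation P F W T A B x0 (fun _ _ => r) X ->
  (\forall w \ae P, X t2 w - e * X t1 w = m) -> 1 <= C * (t2 - t1).
Proof.
move=> k0 eqX Xm; set kappa := B * r in k0.
have [_ [cR cI] _] := eqX.
have paths := additive_mode_paths cF bW T0 eqX.
(* The increment is real, so after division by [kappa] the real part of the defect is enough. *)
pose rho w := Re (m / kappa) - (W t2 w - W t1 w).
have mI := measurable_increment cF bW t10 t12.
have mrho : measurable_fun setT rho by exact: measurable_funB.
have rhoC : \forall w \ae P,
    `|rho w| <= C * \int[lebesgue_measure]_(s in `]t1, t2]) `|W s w - W t1 w|.
  apply: filterS3 (filterI paths Xm) (filterI cR cI) contW => w [XE mE] [cRw cIw] cWw.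
  have cW0 : {within `[0, T], continuous (fun s => W s w - W 0 w)}.
    by move=> s; apply: cvgB; [exact: cWw|exact: cvg_cst].
  have := linear_equation_increment cRw cIw cW0 XE t10 t12 t2T.
  rewrite -/e mE -/kappa.
  have -> : m - kappa * (W t2 w - W 0 w - (W t1 w - W 0 w))%:C =
      kappa * (m / kappa - (W t2 w - W t1 w)%:C).
    have -> : W t2 w - W 0 w - (W t1 w - W 0 w) = W t2 w - W t1 w by ring.
    by field.
  have -> : (fun s => `|W s w - W 0 w - (W t1 w - W 0 w)|) = (fun s => `|W s w - W t1 w|).
    by apply/funext => s; congr (`|_|); ring.
  rewrite normcM => h.
  have nk : 0 < normc kappa.
    rewrite lt_neqAle normc_ge0 andbT eq_sym; apply: contra k0 => /eqP/eq0_normc ->.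
    exact: eqxx.
  rewrite -(ler_pM2l nk); apply: le_trans (le_trans h _).
    rewrite ler_wpM2l ?normc_ge0//; apply: le_trans (normc_Re_le _).
    by rewrite cReB.
  by rewrite le_eqVlt; apply/orP; left; apply/eqP; rewrite /C; ring.
have bound := area_product_bound cF bW t10 t12 t2T C0 mrho rhoC.
have i1 := increment_integrable1 cF bW t10 t12.
have i2 := increment_pow_integrable cF bW 2 t10 t12.
have i1' : P.-integrable setT (EFin \o (fun w => Re (m / kappa) * (W t2 w - W t1 w))).
  by have := integrableZl measurableT (Re (m / kappa)) i1; apply: eq_integrable.
have E : \int[P]_w (rho w * (W t2 w - W t1 w)) = - (t2 - t1).
  transitivity (\int[P]_w (Re (m / kappa) * (W t2 w - W t1 w) - (W t2 w - W t1 w) ^+ 2)).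
    by apply: eq_Rintegral => w _; rewrite /rho; ring.
  rewrite (RintegralB measurableT i1' i2) (RintegralZl _ measurableT i1).
  by rewrite (increment_mean cF bW t10 t12) (increment_variance cF bW t10 t12) mulr0 sub0r.
have mrW : measurable_fun setT (fun w => rho w * (W t2 w - W t1 w)) by exact: measurable_funM.
have h0 : 0 < t2 - t1 by rewrite subr_gt0.
have := Rintegral_norm_le mrW bound; rewrite E normrN gtr0_norm// expr2 mulrA.
by rewrite -[leLHS]mul1r ler_pM2r.
Qed.

(* The combination k' X - k X' solves an equation without noise, so that the
   innovations satisfy k' Y = k Y'; they also have the same variance. *)
Lemma additive_identification (B B' r : R[i]) (x0 : Omega -> R[i])
    (X X' : R -> Omega -> R[i]) : r != 0 -> C * (t2 - t1) < 1 ->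
  mode_equation P F W T A B x0 (fun _ _ => r) X ->
  mode_equation P F W T A B' x0 (fun _ _ => r) X' ->
  cLfun P 2%:E (X t1) -> cLfun P 2%:E (X t2) ->
  cLfun P 2%:E (X' t1) -> cLfun P 2%:E (X' t2) ->
  same_mean_covariance P (X t1) (X t2) (X' t1) (X' t2) ->
  normc B = normc B'.
Proof.
move=> r0 small eqX eqX' L1 L2 L1' L2' [_ _ c11 c12 c22].
pose Y w := X t2 w - e * X t1 w; pose Y' w := X' t2 w - e * X' t1 w.
have LY : cLfun P 2%:E Y.
  have -> : Y = (fun w => X t2 w + (- e) * X t1 w) by apply/funext => w; rewrite mulNr.
  by apply: cLfun2D => //; exact: cLfun2Z.
have LY' : cLfun P 2%:E Y'.
  have -> : Y' = (fun w => X' t2 w + (- e) * X' t1 w) by apply/funext => w; rewrite mulNr.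
  by apply: cLfun2D => //; exact: cLfun2Z.
have covY : ccovariance P Y Y = ccovariance P Y' Y'.
  by rewrite !ccovariance_combination// c11 c12 c22.
pose k := B * r; pose k' := B' * r.
have prop : \forall w \ae P, k' * Y w = k * Y' w.
  have [_ [cR cI] _] := eqX; have [_ [cR' cI'] _] := eqX'.
  have p := additive_mode_paths cF bW T0 eqX; have p' := additive_mode_paths cF bW T0 eqX'.
  apply: filterS3 (filterI p p') (filterI cR cI) (filterI cR' cI') => w [E E'] [cRw cIw] [cRw' cIw'].
  pose D s := k' * X s w - k * X' s w.
  have cD : {within `[0, T], continuous (fun s => Re (D s))} /\
      {within `[0, T], continuous (fun s => Im (D s))}.
    split.
    - have -> : (fun s => Re (D s)) = (fun s => (Re k' * Re (X s w) - Im k' * Im (X s w)) -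
          (Re k * Re (X' s w) - Im k * Im (X' s w))).
        by apply/funext => s; rewrite /D cReB !cReM.
      by move=> s; apply: cvgB; apply: cvgB; (apply: cvgM; first exact: cvg_cst);
        [exact: cRw|exact: cIw|exact: cRw'|exact: cIw'].
    - have -> : (fun s => Im (D s)) = (fun s => (Re k' * Im (X s w) + Im k' * Re (X s w)) -
          (Re k * Im (X' s w) + Im k * Re (X' s w))).
        by apply/funext => s; rewrite /D cImB !cImM.
      by move=> s; apply: cvgB; apply: cvgD; (apply: cvgM; first exact: cvg_cst);
        [exact: cIw|exact: cRw|exact: cIw'|exact: cRw'].
  (* The vanishing noise is written as [0 * 0] to fit [linear_equation_increment], whose bound is
     then 0. *)
  have DE s : 0 <= s <= T -> D s = (k' - k) * x0 w + A * cRintegral D s + 0 * (0 : R)%:C.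
    move=> sT; have [s0 sT'] := andP sT.
    have sub : `[0, s] `<=` `[0, T] by apply: subset_itvl; rewrite bnd_simp.
    have ii (f : R -> R) : {within `[0, T], continuous f} ->
        lebesgue_measure.-integrable `[0, s] (EFin \o f).
      by move=> cf; apply: within_continuous_integrable; exact: continuous_subspaceW cf.
    have iZ (c : R) (f : R -> R) : {within `[0, T], continuous f} ->
        lebesgue_measure.-integrable `[0, s] (EFin \o (fun x => c * f x)).
      by move=> cf; apply: ii => x; apply: cvgM; [exact: cvg_cst|exact: cf].
    have iB (f g : R -> R) : lebesgue_measure.-integrable `[0, s] (EFin \o f) ->
        lebesgue_measure.-integrable `[0, s] (EFin \o g) ->
        lebesgue_measure.-integrable `[0, s] (EFin \o (fun x => f x - g x)).
      by move=> fi gi; apply: eq_integrable (integrableB _ fi gi).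
    have iD (f g : R -> R) : lebesgue_measure.-integrable `[0, s] (EFin \o f) ->
        lebesgue_measure.-integrable `[0, s] (EFin \o g) ->
        lebesgue_measure.-integrable `[0, s] (EFin \o (fun x => f x + g x)).
      by move=> fi gi; apply: eq_integrable (integrableD _ fi gi).
    have -> : cRintegral D s = k' * cRintegral (fun s => X s w) s - k * cRintegral (fun s => X' s w) s.
      apply: complex_ext.
      - rewrite cReB (cReM k') (cReM k).
        transitivity (\int[lebesgue_measure]_(x in `[0, s]) ((Re k' * Re (X x w) - Im k' * Im (X x w)) -
          (Re k * Re (X' x w) - Im k * Im (X' x w)))).
          by apply: eq_Rintegral => x _; rewrite /D cReB !cReM.
        rewrite RintegralB//; [|by apply: iB; exact: iZ|by apply: iB; exact: iZ].
        rewrite RintegralB//; [|exact: iZ|exact: iZ].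
        rewrite RintegralB//; [|exact: iZ|exact: iZ].
        by rewrite !RintegralZl//; exact: ii.
      - rewrite cImB (cImM k') (cImM k).
        transitivity (\int[lebesgue_measure]_(x in `[0, s]) ((Re k' * Im (X x w) + Im k' * Re (X x w)) -
          (Re k * Im (X' x w) + Im k * Re (X' x w)))).
          by apply: eq_Rintegral => x _; rewrite /D cImB !cImM.
        rewrite RintegralB//; [|by apply: iD; exact: iZ|by apply: iD; exact: iZ].
        rewrite RintegralD//; [|exact: iZ|exact: iZ].
        rewrite RintegralD//; [|exact: iZ|exact: iZ].
        by rewrite !RintegralZl//; exact: ii.
    by rewrite /D E// E'// -/k -/k'; ring.
  have c0 : {within `[0, T], continuous (fun _ : R => 0 : R)} by move=> s; exact: cvg_cst.
  have := linear_equation_increment cD.1 cD.2 c0 DE t10 t12 t2T.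
  rewrite (_ : normc 0 = 0) ?normc0// !(mulr0, mul0r) subr0 => h.
  have /eq0_normc : normc (D t2 - e * D t1) = 0 by apply/eqP; rewrite eq_le h normc_ge0.
  rewrite /D /Y /Y' => h'; apply/eqP; rewrite -subr_eq0 -h'; apply/eqP; ring.
have mY := cLfun2_measurable LY; have mY' := cLfun2_measurable LY'.
have covE : k' * conjc k' * ccovariance P Y Y = k * conjc k * ccovariance P Y Y.
  rewrite {2}covY -!ccovarianceZ//; apply: ae_eq_ccovariance prop; exact: cmeasurableZ.
have normE (z : R[i]) : z * conjc z = (normc z ^+ 2)%:C.
  by rewrite sqr_normcE; case: z => a b; apply: complex_ext => /=; ring.
have : (normc k' ^+ 2 - normc k ^+ 2)%:C * ccovariance P Y Y = 0.
  by rewrite rmorphB/= -!normE mulrBl covE subrr.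
(* Either [|k| = |k'|], or the common variance is 0; then both innovations are almost surely
   constant, which for small [t2 - t1] leaves only [k = k' = 0]. *)
move/eqP; rewrite mulf_eq0 => /orP[/eqP/complexI/eqP|/eqP cov0].
  rewrite subr_eq0 eqrXn2 ?normc_ge0// /k /k' !normcM => /eqP h.
  have nr : normc r != 0 by apply: contra r0 => /eqP/eq0_normc ->; exact: eqxx.
  exact/esym/(mulIf nr).
have [k0|k0] := eqVneq k 0.
  have [k0'|k0'] := eqVneq k' 0.
    have B0 : B = 0 by apply/eqP; have /eqP := k0; rewrite mulf_eq0 (negbTE r0) orbF.
    have B0' : B' = 0 by apply/eqP; have /eqP := k0'; rewrite mulf_eq0 (negbTE r0) orbF.
    by rewrite B0 B0'.
  have := mode_innovation_not_cst k0' eqX' (ccovariance0_cst LY' (etrans (esym covY) cov0)).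
  by rewrite leNgt small.
have := mode_innovation_not_cst k0 eqX (ccovariance0_cst LY cov0).
by rewrite leNgt small.
Qed.

End two_times.

Lemma additive_identification_small : exists2 delta : R, 0 < delta &
  forall (B B' r : R[i]) (x0 : Omega -> R[i]) (X X' : R -> Omega -> R[i]) t1 t2,
  r != 0 -> 0 <= t1 -> t1 < t2 -> t2 <= T -> t2 - t1 < delta ->
  mode_equation P F W T A B x0 (fun _ _ => r) X ->
  mode_equation P F W T A B' x0 (fun _ _ => r) X' ->
  cLfun P 2%:E (X t1) -> cLfun P 2%:E (X t2) ->
  cLfun P 2%:E (X' t1) -> cLfun P 2%:E (X' t2) ->
  same_mean_covariance P (X t1) (X t2) (X' t1) (X' t2) ->
  normc B = normc B'.
Proof.
have C1 : 0 < C + 1 by rewrite ltr_wpDl.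
(* [C] may be 0, so [C + 1] is inverted; then [C h < (C + 1) h < 1] for [h = t2 - t1]. *)
exists (C + 1)^-1; first by rewrite invr_gt0.
move=> B B' r x0 X X' t1 t2 r0 t10 t12 t2T small.
apply: (@additive_identification t1 t2 t10 t12 t2T B B' r x0 X X' r0).
have h0 : 0 < t2 - t1 by rewrite subr_gt0.
apply: (@lt_trans _ _ ((C + 1) * (t2 - t1))); first by rewrite ltr_pM2r// ltrDl.
by rewrite mulrC -ltr_pdivlMr// div1r.
Qed.

End additive_identification.

(** * Means of modes with multiplicative noise *)

Section increment_exponential.
Context (R : realType) (d : measure_display) (Omega : measurableType d).
Variables (P : probability Omega R) (F : R -> set (set Omega)) (W : R -> Omega -> R).
Hypotheses (cF : complete_filtration P F) (bW : brownian_motion P F W).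
Notation Re := (@complex.Re R).
Notation Im := (@complex.Im R).
Implicit Types (B : R[i]) (U : Omega -> R[i]).

Lemma measurable_cexp_real B :
  measurable_fun setT (fun x : R => Re (cexp (B * x%:C))) /\
  measurable_fun setT (fun x : R => Im (cexp (B * x%:C))).
Proof.
have mexp : measurable_fun setT (fun x : R => expR (Re B * x)).
  by apply: measurableT_comp => //; exact: measurable_funM.
have mIm : measurable_fun setT (fun x : R => Im B * x) by exact: measurable_funM.
have mcos : measurable_fun setT (fun x : R => cos (Im B * x)).
  exact: measurableT_comp (continuous_measurable_fun (@continuous_cos R)) mIm.
have msin : measurable_fun setT (fun x : R => sin (Im B * x)).
  exact: measurableT_comp (continuous_measurable_fun (@continuous_sin R)) mIm.
split.
- have -> : (fun x : R => Re (cexp (B * x%:C))) = (fun x => expR (Re B * x) * cos (Im B * x)).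
    by apply/funext => x; rewrite Re_cexp cReMr cImMr.
  exact: measurable_funM.
- have -> : (fun x : R => Im (cexp (B * x%:C))) = (fun x => expR (Re B * x) * sin (Im B * x)).
    by apply/funext => x; rewrite Im_cexp cReMr cImMr.
  exact: measurable_funM.
Qed.

Lemma increment_cexpectationM (s t : R) (U : Omega -> R[i]) (g : R -> R[i]) :
  0 <= s -> s < t ->
  measurable_wrt (F s) (fun w => Re (U w)) -> measurable_wrt (F s) (fun w => Im (U w)) ->
  measurable_fun setT (fun x => Re (g x)) -> measurable_fun setT (fun x => Im (g x)) ->
  cintegrable P U -> cintegrable P (fun w => g (W t w - W s w)) ->
  cintegrable P (fun w => U w * g (W t w - W s w)) /\
  cexpectation P (fun w => U w * g (W t w - W s w)) =
    cexpectation P U * cexpectation P (fun w => g (W t w - W s w)).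
Proof.
move=> s0 st mR mI gR gI [UR UI] [hR hI].
have [iRR RR] := increment_expectationM bW s0 st mR gR UR hR.
have [iRI RI] := increment_expectationM bW s0 st mR gI UR hI.
have [iIR IR] := increment_expectationM bW s0 st mI gR UI hR.
have [iII II] := increment_expectationM bW s0 st mI gI UI hI.
split.
  split.
  - by have := integrableB measurableT iRR iII; apply: eq_integrable => // w _ /=; rewrite cReM EFinB.
  - by have := integrableD measurableT iRI iIR; apply: eq_integrable => // w _ /=; rewrite cImM EFinD.
rewrite !cexpectationE; apply: complex_ext; rewrite ?cReM ?cImM/=.
- rewrite -RR -II -RintegralB//.
  by apply: eq_Rintegral => w _; rewrite cReM.
- rewrite -RI -IR -RintegralD//.
  by apply: eq_Rintegral => w _; rewrite cImM.
Qed.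

Definition increment_mgf B (s t : R) : R[i] :=
  cexpectation P (fun w => cexp (B * (W t w - W s w)%:C)).

Lemma increment_mgf_refl B s : increment_mgf B s s = 1.
Proof.
rewrite /increment_mgf -[RHS](cexpectation_cst P); congr cexpectation.
by apply/funext => w; rewrite subrr mulr0 cexp0.
Qed.

Lemma increment_cexp_integrable B s t : 0 <= s -> s < t ->
  cintegrable P (fun w => cexp (B * (W t w - W s w)%:C)).
Proof.
move=> s0 st; have [mR mI] := measurable_cexp_real B.
have bound (x : R) : normc (cexp (B * x%:C)) <= 1 * (`|x| ^+ 0 * expR (normc B * `|x|)).
  by rewrite expr0 !mul1r (le_trans (normc_cexp_le _))// (normcM B) normc_real.
split.
- apply: (increment_integrable cF bW s0 st mR (normc_ge0 B) ler01 _).1 => x.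
  exact: le_trans (normc_Re_le _) (bound x).
- apply: (increment_integrable cF bW s0 st mI (normc_ge0 B) ler01 _).1 => x.
  exact: le_trans (normc_Im_le _) (bound x).
Qed.

(** The exponential of the earlier increment is known at time [u], and the later increment is
    independent of that past. *)
Lemma increment_mgfM B s u t : 0 <= s -> s < u -> u < t ->
  increment_mgf B s t = increment_mgf B s u * increment_mgf B u t.
Proof.
move=> s0 su ut; have u0 := le_trans s0 (ltW su).
have [mR mI] := measurable_cexp_real B; have sF := filtration_sigma cF u0.
have mD : measurable_wrt (F u) (fun w => W u w - W s w).
  apply: measurable_wrtB => //; first exact: (brownian_adapted bW).
  by apply: (measurable_wrt_mono cF s0 (ltW su)); exact: (brownian_adapted bW).
have [_ <-] := increment_cexpectationM u0 ut (measurable_wrt_comp sF mR mD)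
  (measurable_wrt_comp sF mI mD) mR mI (increment_cexp_integrable B s0 su)
  (increment_cexp_integrable B u0 ut).
congr cexpectation; apply/funext => w; rewrite -cexpD -mulrDr -rmorphD/=.
by congr (cexp (B * _%:C)); ring.
Qed.

(** Twice, for real and imaginary part, the constant [8 |B|^3] of the cubic remainder times
    [normal_abs_cst 3], where [3! * 2 = 12] and the exponent is taken at time step 1. *)
Definition mgf_cst B : R := 16 * normc B ^+ 3 * (12 * expR ((normc B + 1) ^+ 2 / 2)).

Lemma mgf_cst_ge0 B : 0 <= mgf_cst B.
Proof. by rewrite !mulr_ge0 ?exprn_ge0 ?normc_ge0 ?expR_ge0. Qed.

(** The linear term has mean 0, the quadratic one [B^2 (t - s) / 2], and the cubic remainder
    contributes the power 3/2 of the time step. *)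
Lemma increment_mgf_taylor B s t : 0 <= s -> s < t -> t - s <= 1 ->
  normc (increment_mgf B s t - 1 - B ^+ 2 / 2 * (t - s)%:C) <=
  mgf_cst B * Num.sqrt (t - s) ^+ 3.
Proof.
move=> s0 st st1; have [mR mI] := measurable_cexp_real B.
pose r x := cexp (B * x%:C) - 1 - B * x%:C - (B * x%:C) ^+ 2 / 2.
have rE x : r x = cexp (B * x%:C) + (- 1 + ((- B) * x%:C + (- (B ^+ 2 / 2)) * (x ^+ 2)%:C)).
  by rewrite /r rmorphXn/= exprMn; field.
have reE x : Re (r x) = Re (cexp (B * x%:C)) + (- 1 - Re B * x - Re (B ^+ 2 / 2) * x ^+ 2).
  by rewrite rE !cReD !cReMr !cReN/=; ring.
have imE x : Im (r x) = Im (cexp (B * x%:C)) + (- Im B * x - Im (B ^+ 2 / 2) * x ^+ 2).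
  by rewrite rE !cImD !cImMr !cImN/=; ring.
have mlin (c : R) : measurable_fun setT (fun x : R => c * x) by exact: measurable_funM.
have msq (c : R) : measurable_fun setT (fun x : R => c * x ^+ 2).
  by apply: measurable_funM => //; exact: measurable_funX.
have mrR : measurable_fun setT (fun x => Re (r x)).
  under eq_fun do rewrite reE.
  by apply: measurable_funD => //; apply: measurable_funB => //; exact: measurable_funB.
have mrI : measurable_fun setT (fun x => Im (r x)).
  under eq_fun do rewrite imE.
  by apply: measurable_funD => //; exact: measurable_funB.
have bound x : normc (r x) <= (8 * normc B ^+ 3) * (`|x| ^+ 3 * expR (normc B * `|x|)).
  apply: le_trans (cexp_taylor2 _) _.
  by rewrite (normcM B) normc_real exprMn !mulrA.
have C0 : 0 <= 8 * normc B ^+ 3 by rewrite mulr_ge0 ?exprn_ge0 ?normc_ge0.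
have [_ bR] := increment_integrable cF bW s0 st mrR (normc_ge0 B) C0
  (fun x => le_trans (normc_Re_le _) (bound x)).
have [_ bI] := increment_integrable cF bW s0 st mrI (normc_ge0 B) C0
  (fun x => le_trans (normc_Im_le _) (bound x)).
have i1 : cintegrable P (fun w => (W t w - W s w)%:C).
  by split; [exact: (increment_integrable1 cF bW s0 st)|exact: (cintegrable_cst P 0).1].
have i2 : cintegrable P (fun w => ((W t w - W s w) ^+ 2)%:C).
  by split; [exact: (increment_pow_integrable cF bW 2 s0 st)|exact: (cintegrable_cst P 0).1].
have E1 : cexpectation P (fun w => (W t w - W s w)%:C) = 0.
  by rewrite cexpectationE/= (increment_mean cF bW s0 st) Rintegral_prob_cst.
have E2 : cexpectation P (fun w => ((W t w - W s w) ^+ 2)%:C) = (t - s)%:C.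
  by rewrite cexpectationE/= (increment_variance cF bW s0 st) Rintegral_prob_cst.
have Er : cexpectation P (fun w => r (W t w - W s w)) =
    increment_mgf B s t - 1 - B ^+ 2 / 2 * (t - s)%:C.
  under eq_fun do rewrite rE.
  have j1 := cintegrableZ (- B) i1; have j2 := cintegrableZ (- (B ^+ 2 / 2)) i2.
  have jc := cintegrable_cst P (- 1).
  have j12 := cintegrableD j1 j2.
  rewrite (cexpectationD (increment_cexp_integrable B s0 st) (cintegrableD jc j12)).
  rewrite (cexpectationD jc j12) (cexpectationD j1 j2) (cexpectationZ _ i1) (cexpectationZ _ i2) cexpectation_cst E1 E2.
  by rewrite -/(increment_mgf B s t); ring.
rewrite -Er cexpectationE; apply: le_trans (normc_le_ReIm _) _ => /=.
apply: le_trans (lerD bR bI) _; rewrite -mulr2n.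
set q := Num.sqrt (t - s).
have q0 : 0 <= q by exact: sqrtr_ge0.
have q1 : q <= 1 by rewrite -sqrtr1 ler_wsqrtr.
rewrite /normal_abs_cst /mgf_cst.
have e1 : expR ((normc B * q + 1) ^+ 2 / 2) <= expR ((normc B + 1) ^+ 2 / 2).
  rewrite ler_expR ler_pM2r ?invr_gt0// ler_pXn2r ?nnegrE ?addr_ge0 ?mulr_ge0 ?normc_ge0//.
  by rewrite lerD2r ler_piMr ?normc_ge0.
have -> : 3`!%:R = 6 :> R by [].
rewrite (_ : _ *+ 2 = (16 * normc B ^+ 3 * 12 * q ^+ 3) * expR ((normc B * q + 1) ^+ 2 / 2)); last by ring.
rewrite [leRHS](_ : _ = (16 * normc B ^+ 3 * 12 * q ^+ 3) * expR ((normc B + 1) ^+ 2 / 2)); last by ring.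
by rewrite ler_wpM2l// !mulr_ge0 ?exprn_ge0 ?normc_ge0.
Qed.

(* The factorization over subintervals writes the expectation as a product of
   factors close to 1. *)
Lemma increment_mgf_neq0 B s t : 0 <= s -> s <= t -> increment_mgf B s t != 0.
Proof.
move=> s0; rewrite le_eqVlt => /predU1P[<-|]; first by rewrite increment_mgf_refl oner_neq0.
(* For a time step [h <= 1] the expansion puts the expectation within [K h] of 1. The summand 1
   gives [K >= 1], so [h < 1 / K] also implies [h <= 1]. *)
pose K := normc (B ^+ 2 / 2) + mgf_cst B + 1.
have K1 : 1 <= K by rewrite lerDr addr_ge0 ?normc_ge0 ?mgf_cst_ge0.
have K0 : 0 < K := lt_le_trans ltr01 K1.
have small s' t' : 0 <= s' -> s' < t' -> t' - s' < K^-1 -> increment_mgf B s' t' != 0.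
  move=> s'0 st h; have h0 : 0 < t' - s' by rewrite subr_gt0.
  have h1 : t' - s' <= 1 by rewrite (le_trans (ltW h))// invf_le1.
  apply/eqP => E; have := increment_mgf_taylor B s'0 st h1; rewrite E.
  set q := Num.sqrt (t' - s').
  have q0 : 0 <= q by exact: sqrtr_ge0.
  have q1 : q <= 1 by rewrite -sqrtr1 ler_wsqrtr.
  have q3 : q ^+ 3 <= t' - s'.
    have -> : t' - s' = q ^+ 2 by rewrite sqr_sqrtr// ltW.
    by rewrite exprSr ler_piMr ?exprn_ge0.
  have e1 : (1 : R[i]) = - (0 - 1 - B ^+ 2 / 2 * (t' - s')%:C) - B ^+ 2 / 2 * (t' - s')%:C by ring.
  have : 1 <= normc (0 - 1 - B ^+ 2 / 2 * (t' - s')%:C) + normc (B ^+ 2 / 2) * (t' - s').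
    rewrite -{1}(normc1 R) {1}e1 (le_trans (le_normcD _ _))// !normcN (normcM (_ / _)) normc_real.
    by rewrite gtr0_norm.
  move=> le1 le2; have : K * (t' - s') < 1 by rewrite mulrC -ltr_pdivlMr// div1r.
  have := ler_wpM2l (mgf_cst_ge0 B) q3; rewrite /K; lra.
(* An interval shorter than [(n + 1) / K] splits into [n + 1] pieces shorter than [1 / K]; each
   induction step removes one piece. *)
have H n s' t' : 0 <= s' -> s' < t' -> t' - s' < n.+1%:R * K^-1 -> increment_mgf B s' t' != 0.
  elim: n s' t' => [|n IH] s' t' s'0 st h; first by apply: small => //; rewrite mul1r in h.
  have h0 : 0 < t' - s' by rewrite subr_gt0.
  pose tau := (t' - s') / n.+2%:R.
  have tau0 : 0 < tau by rewrite divr_gt0.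
  have tauK : tau < K^-1 by rewrite ltr_pdivrMr// mulrC.
  have tauE : t' - s' = n.+1%:R * tau + tau.
    by rewrite /tau -[X in _ * _ + X]mul1r -mulrDl natr1 mulrC divfK.
  have ut : s' + tau < t' by rewrite -ltrBrDl tauE ltrDr mulr_gt0.
  rewrite (@increment_mgfM B s' (s' + tau) t')// ?ltrDl// mulf_neq0//.
    by apply: small => //; rewrite ?ltrDl// addrAC subrr add0r.
  apply: IH => //; first by rewrite addr_ge0// ltW.
  by rewrite opprD addrA tauE addrK ltr_pM2l.
move=> st.
apply: (H (Num.trunc ((t - s) * K))) => //.
by rewrite ltr_pdivlMr//; exact: truncnS_gt.
Qed.

Lemma increment_mgf_sqr_eq B B' : B ^+ 2 != B' ^+ 2 ->
  exists2 delta : R, 0 < delta & forall s t, 0 <= s -> s < t -> t - s < delta ->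
    increment_mgf B s t <> increment_mgf B' s t.
Proof.
move=> BB'; pose D := normc (B ^+ 2 / 2 - B' ^+ 2 / 2).
have D0 : 0 < D.
  rewrite lt_neqAle normc_ge0 andbT eq_sym; apply: contra BB' => /eqP/eq0_normc/eqP.
  rewrite -mulrBl mulf_eq0 invr_eq0 pnatr_eq0 orbF subr_eq0.
  by [].
pose K := mgf_cst B + mgf_cst B' + 1.
have K0 : 0 < K by rewrite ltr_wpDl// addr_ge0 ?mgf_cst_ge0.
(* With [q] the square root of the time step, equal expectations would give
   [D q^2 <= (mgf_cst B + mgf_cst B') q^3]. This fails for [q < D / K], and [q < 1] keeps both
   expansions available. *)
pose e := Num.min 1 (D / K).
have e0 : 0 < e by rewrite lt_min ltr01 divr_gt0.
exists (e ^+ 2) => [|s t s0 st]; first by rewrite exprn_gt0.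
have h0 : 0 < t - s by rewrite subr_gt0.
move=> small EE; set q := Num.sqrt (t - s).
have q0 : 0 < q by rewrite sqrtr_gt0.
have qh : q ^+ 2 = t - s by rewrite sqr_sqrtr// ltW.
have qe : q < e by rewrite -(ltr_pXn2r (ltn0Sn 1)) ?nnegrE ?(ltW q0) ?(ltW e0)// qh.
have h1 : t - s <= 1.
  by rewrite -qh exprn_ile1 ?(ltW q0)// (le_trans (ltW qe))// /e ge_min lexx.
have := lerD (increment_mgf_taylor B s0 st h1) (increment_mgf_taylor B' s0 st h1).
rewrite EE -(normcN (_ - _ - B ^+ 2 / 2 * _)) => /(le_trans (le_normcD _ _)).
have -> : - (increment_mgf B' s t - 1 - B ^+ 2 / 2 * (t - s)%:C) +
   (increment_mgf B' s t - 1 - B' ^+ 2 / 2 * (t - s)%:C) =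
   (B ^+ 2 / 2 - B' ^+ 2 / 2) * (t - s)%:C by ring.
rewrite normcM normc_real gtr0_norm// -/D -/q -qh -mulrDl.
rewrite (_ : _ * q ^+ 3 = (mgf_cst B + mgf_cst B') * q * q ^+ 2); last by ring.
rewrite ler_pM2r ?exprn_gt0// => /le_lt_trans.
have qD : K * q < D.
  by rewrite mulrC -ltr_pdivlMr// (lt_le_trans qe)// /e ge_min lexx orbT.
have : (mgf_cst B + mgf_cst B') * q < K * q by rewrite ltr_pM2r// ltrDl.
move=> h /(_ _ (lt_trans h qD)); by rewrite ltxx.
Qed.

End increment_exponential.

(** * Identification of [B^2] with multiplicative noise *)

Section multiplicative_identification.
Context (R : realType) (d : measure_display) (Omega : measurableType d).
Variables (P : probability Omega R) (F : R -> set (set Omega)) (W : R -> Omega -> R).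
Hypotheses (cF : complete_filtration P F) (bW : brownian_motion P F W).
Variables (T : R) (A : R[i]).
Hypothesis T0 : 0 < T.
Notation Re := (@complex.Re R).
Notation Im := (@complex.Im R).

(* Without noise the Stratonovich integral of G is unconstrained, but it
   disappears from the equation, which is solved path by path. *)
Lemma drift_mode_paths (x0 : Omega -> R[i]) (G X : R -> Omega -> R[i]) :
  mode_equation P F W T A 0 x0 G X ->
  forall t, 0 <= t <= T -> \forall w \ae P, X t w = geometric_solution W A 0 x0 t w.
Proof.
move=> [_ [cR cI] [J [_ _ XE]]] t tT; have [t0 tT'] := andP tT.
have cW : continuous_paths P T W by apply: (brownian_continuous bW); exact: ltW.
have XE' s : 0 <= s <= T -> \forall w \ae P,
    X s w = x0 w + A * cRintegral (fun s => X s w) s + 0 * (W s w - W 0 w)%:C.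
  by move=> /XE; apply: filterS => w ->; rewrite !mul0r.
have := linear_mode_paths T0 cW cR cI XE'.
apply: filterS3 cR cI => w cRw cIw E.
have c0 : {within `[0, T], continuous (fun _ : R => 0 : R)} by move=> s; exact: cvg_cst.
have E' s : 0 <= s <= T ->
    X s w = x0 w + A * cRintegral (fun s => X s w) s + 0 * (0 : R)%:C.
  by move=> /E ->; rewrite !mul0r.
have X0 : X 0 w = x0 w.
  rewrite E ?lexx ?(ltW T0)// /cRintegral set_itv1 !Rintegral_set1 mul0r addr0.
  by rewrite (_ : Complex 0 0 = 0 :> R[i])// mulr0 addr0.
rewrite /geometric_solution /geometric_path mul0r addr0 -X0 mulrC.
have [->|tn0] := eqVneq t 0; first by rewrite mulr0 cexp0 mul1r.
have tp : 0 < t by rewrite lt_neqAle eq_sym tn0.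
have := linear_equation_increment cRw cIw c0 E' (lexx 0) tp tT'.
rewrite (_ : normc 0 = 0) ?normc0// !(mulr0, mul0r) !subr0 => h.
have /eq0_normc/eqP : normc (X t w - cexp (A * t%:C) * X 0 w) = 0.
  by apply/eqP; rewrite eq_le h normc_ge0.
by rewrite subr_eq0 => /eqP.
Qed.

Section mode.
Variables (B : R[i]) (x0 : Omega -> R[i]) (X : R -> Omega -> R[i]).
Hypotheses (mR0 : measurable_wrt (F 0) (fun w => Re (x0 w)))
  (mI0 : measurable_wrt (F 0) (fun w => Im (x0 w))) (ix0 : cintegrable P x0).
Hypothesis eqX : mode_equation P F W T A B x0 X X.
Hypothesis uniqX : forall Y, mode_equation P F W T A B x0 Y Y ->
  forall t, 0 <= t <= T -> \forall w \ae P, Y t w = X t w.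

Lemma multiplicative_mode_paths t : 0 <= t <= T ->
  \forall w \ae P, X t w = geometric_solution W A B x0 t w.
Proof.
move=> tT; have [B0|B0] := eqVneq B 0.
  by move: eqX; rewrite B0 => eqX0; exact: drift_mode_paths eqX0 t tT.
have := uniqX (geometric_solution_equation cF bW A T0 B0 mR0 mI0) tT.
by apply: filterS => w ->.
Qed.

(** [x0] is known at time 0, hence independent of [W_t - W_0], and the mean of the explicit process
    factorizes. *)
Lemma multiplicative_mode_mean t : 0 <= t <= T -> cmeasurable (X t) ->
  cexpectation P (X t) = cexpectation P x0 * cexp (A * t%:C) * increment_mgf P W B 0 t.
Proof.
move=> tT mX; have [t0 _] := andP tT.
have [gR gI] := geometric_solution_wrt cF bW A B mR0 mI0 t0.
have mZ : cmeasurable (geometric_solution W A B x0 t).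
  by split; apply: (measurable_wrt_filtration cF t0).
rewrite (ae_eq_cexpectation mX mZ (multiplicative_mode_paths tT)).
have ZE : geometric_solution W A B x0 t =
    (fun w => cexp (A * t%:C) * (x0 w * cexp (B * (W t w - W 0 w)%:C))).
  by apply/funext => w; rewrite /geometric_solution /geometric_path cexpD; ring.
move: t0; rewrite ZE le_eqVlt => /predU1P[t0|t0].
  rewrite -t0 increment_mgf_refl mulr0 cexp0 !mulr1; congr cexpectation.
  by apply/funext => w; rewrite subrr mulr0 cexp0 mulr1 mul1r.
have [mR mI] := measurable_cexp_real B.
have [i E] := increment_cexpectationM bW (lexx 0) t0 mR0 mI0 mR mI ix0
  (increment_cexp_integrable cF bW B (lexx 0) t0).
by rewrite cexpectationZ// E mulrA [cexp _ * _]mulrC.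
Qed.

End mode.

Lemma multiplicative_identification (B B' : R[i]) : B ^+ 2 != B' ^+ 2 ->
  exists2 delta : R, 0 < delta &
  forall (x0 : Omega -> R[i]) (X X' : R -> Omega -> R[i]) t1 t2,
  measurable_wrt (F 0) (fun w => Re (x0 w)) -> measurable_wrt (F 0) (fun w => Im (x0 w)) ->
  cintegrable P x0 -> cexpectation P x0 != 0 ->
  0 <= t1 -> t1 < t2 -> t2 <= T -> t2 - t1 < delta ->
  mode_equation P F W T A B x0 X X ->
  (forall Y, mode_equation P F W T A B x0 Y Y ->
    forall t, 0 <= t <= T -> \forall w \ae P, Y t w = X t w) ->
  mode_equation P F W T A B' x0 X' X' ->
  (forall Y, mode_equation P F W T A B' x0 Y Y ->
    forall t, 0 <= t <= T -> \forall w \ae P, Y t w = X' t w) ->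
  cmeasurable (X t1) -> cmeasurable (X t2) -> cmeasurable (X' t1) -> cmeasurable (X' t2) ->
  cexpectation P (X t1) = cexpectation P (X' t1) ->
  cexpectation P (X t2) <> cexpectation P (X' t2).
Proof.
move=> BB'; have [delta delta0 H] := increment_mgf_sqr_eq cF bW BB'.
exists delta => // x0 X X' t1 t2 mR0 mI0 ix0 x0n t10 t12 t2T small eqX uX eqX' uX' m1 m2 m1' m2'.
have t1T : 0 <= t1 <= T by rewrite t10 (le_trans (ltW t12)).
have t2T' : 0 <= t2 <= T by rewrite t2T (le_trans t10 (ltW t12)).
rewrite (multiplicative_mode_mean mR0 mI0 ix0 eqX uX t1T m1).
rewrite (multiplicative_mode_mean mR0 mI0 ix0 eqX' uX' t1T m1').
rewrite (multiplicative_mode_mean mR0 mI0 ix0 eqX uX t2T' m2).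
rewrite (multiplicative_mode_mean mR0 mI0 ix0 eqX' uX' t2T' m2').
have nz t : cexpectation P x0 * cexp (A * t%:C) != 0 by rewrite mulf_neq0 ?cexp_neq0.
(* The factor taken out is nonzero because the mode is excited, so equal means give equal
   expectations of the exponentials. *)
move=> /(mulfI (nz _)) E1 /(mulfI (nz _)).
have split_at C : increment_mgf P W C 0 t2 = increment_mgf P W C 0 t1 * increment_mgf P W C t1 t2.
  move: t10; rewrite le_eqVlt => /predU1P[<-|t1p]; first by rewrite increment_mgf_refl mul1r.
  exact: (increment_mgfM cF bW C (lexx 0) t1p t12).
(* The factor over [[0, t1]] is common by [E1] and nonzero; what remains is the short interval,
   where [H] applies. *)
rewrite !split_at E1 => /(mulfI (increment_mgf_neq0 cF bW B' (lexx 0) t10)).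
exact: H.
Qed.

End multiplicative_identification.

(** * Quadratic polynomials of the coefficients *)

Section quadratic_polynomials.
Variables (R : realType) (d p : nat).
Notation index := (bmultinom d p.+1).
Implicit Types (Q : set 'rV[int]_d) (gamma : multinom d) (xi : 'rV[int]_d) (b : index -> R).
Notation Re := (@complex.Re R).
Notation Im := (@complex.Im R).

Definition monomial_at xi (m : multinom d) : R := \prod_(j < d) (xi 0 j)%:~R ^+ m j.

Lemma monomial_atD xi m m' :
  monomial_at xi (mnm_add m m') = monomial_at xi m * monomial_at xi m'.
Proof. by rewrite -big_split; apply: eq_bigr => j _; rewrite mnmDE exprD. Qed.

(** The sums over [m + m' = gamma] are the coefficients of a polynomial of degree at most [2 p] that
    vanishes on [Q]; were it nonzero, [Q] would lie on a hypersurface. *)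
Lemma quadratic_coef_eq0 Q (e : index -> index -> R) : ~ on_hypersurface R (2 * p) Q ->
  (forall xi, Q xi ->
    \sum_(m : index) \sum_(m' : index) e m m' * (monomial_at xi m * monomial_at xi m') = 0) ->
  forall gamma, \sum_(m : index) \sum_(m' : index | mnm_add m m' == gamma) e m m' = 0.
Proof.
move=> nQ eQ gamma.
pose q : mpoly d R := \sum_(m : index) \sum_(m' : index) e m m' *: mpolyX R (mnm_add m m').
have coefq : \sum_(m : index) \sum_(m' : index | mnm_add m m' == gamma) e m m' = mcoeff gamma q.
  rewrite /q raddf_sum; apply: eq_bigr => m _; rewrite raddf_sum big_mkcond /=.
  apply: eq_bigr => m' _; rewrite mcoeffZ mcoeffX.
  by case: eqP => _; rewrite ?mulr1 ?mulr0.
rewrite coefq; have [->|q0] := eqVneq q 0; first by rewrite raddf0.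
case: nQ; exists q; split => //.
- rewrite /q; apply: (big_ind (fun r : mpoly d R => mmeasure mdeg r <= (2 * p).+1)%N).
  + by rewrite mmeasure0.
  + by move=> r r' h h'; rewrite (leq_trans (mmeasureD_le _ _ _))// geq_max h.
  move=> m _; apply: (big_ind (fun r : mpoly d R => mmeasure mdeg r <= (2 * p).+1)%N).
  + by rewrite mmeasure0.
  + by move=> r r' h h'; rewrite (leq_trans (mmeasureD_le _ _ _))// geq_max h.
  (* Indices have order below [p + 1], and [mmeasure] is the degree plus one, hence the bound
     [2 p + 1]. *)
  move=> m' _; rewrite (leq_trans (mmeasureZ_le _ _ _))// mmeasureX/= ltnS mdegD mul2n -addnn.
  by apply: leq_add; rewrite -ltnS bmdeg.
- move=> xi /eQ <-; rewrite /q raddf_sum; apply: eq_bigr => m _; rewrite raddf_sum.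
  apply: eq_bigr => m' _; rewrite -monomial_atD.
  by rewrite /= mevalZ mevalX.
Qed.

(** The hypersurface condition concerns real polynomials; monomials are real at integer points, so
    real and imaginary parts of the coefficients separate. *)
Lemma quadratic_coef_complex_eq0 Q (e : index -> index -> R[i]) :
  ~ on_hypersurface R (2 * p) Q ->
  (forall xi, Q xi ->
    \sum_(m : index) \sum_(m' : index)
      e m m' * (monomial_at xi m * monomial_at xi m')%:C = 0) ->
  forall gamma, \sum_(m : index) \sum_(m' : index | mnm_add m m' == gamma) e m m' = 0.
Proof.
move=> nQ eQ gamma; apply: complex_ext.
- rewrite cRe_sum; under eq_bigr do rewrite cRe_sum.
  apply: (quadratic_coef_eq0 (e := fun m m' => Re (e m m')) nQ) => xi /eQ/(congr1 Re).
  rewrite cRe_sum => E; rewrite -[RHS]/(Re 0) -E; apply: eq_bigr => m _; rewrite cRe_sum.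
  by apply: eq_bigr => m' _; rewrite cReMr.
- rewrite cIm_sum; under eq_bigr do rewrite cIm_sum.
  apply: (quadratic_coef_eq0 (e := fun m m' => Im (e m m')) nQ) => xi /eQ/(congr1 Im).
  rewrite cIm_sum => E; rewrite -[RHS]/(Im 0) -E; apply: eq_bigr => m _; rewrite cIm_sum.
  by apply: eq_bigr => m' _; rewrite cImMr.
Qed.

Lemma symbol_monomialE b xi :
  symbol b xi = \sum_(m : index) 'i%C ^+ mdeg m * (b m * monomial_at xi m)%:C.
Proof.
apply: eq_bigr => m _; rewrite rmorphM/= mulrCA; congr (_ * _).
rewrite /monomial_at rmorph_prod/= mdegE -prodrXr -big_split/=; apply: eq_bigr => j _.
by rewrite exprMn rmorphXn/= rmorph_int.
Qed.

Lemma sqr_symbolE b xi : symbol b xi ^+ 2 = \sum_(m : index) \sum_(m' : index)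
  'i%C ^+ (mdeg m + mdeg m') * (b m * b m')%:C * (monomial_at xi m * monomial_at xi m')%:C.
Proof.
rewrite expr2 symbol_monomialE big_distrlr/=; apply: eq_bigr => m _; apply: eq_bigr => m' _.
by rewrite exprD !rmorphM/=; ring.
Qed.

Lemma sqr_normc_symbolE b xi : (normc (symbol b xi) ^+ 2)%:C =
  \sum_(m : index) \sum_(m' : index)
  'i%C ^+ mdeg m * (- 'i%C) ^+ mdeg m' * (b m * b m')%:C *
    (monomial_at xi m * monomial_at xi m')%:C.
Proof.
have -> : (normc (symbol b xi) ^+ 2)%:C = symbol b xi * conjc (symbol b xi).
  by rewrite sqr_normcE; case: (symbol b xi) => x y; apply: complex_ext => /=; ring.
rewrite [in X in conjc X]symbol_monomialE symbol_monomialE rmorph_sum big_distrlr/=.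
apply: eq_bigr => m _; apply: eq_bigr => m' _.
have -> : conjc ('i%C ^+ mdeg m' * (b m' * monomial_at xi m')%:C) =
    (- 'i%C) ^+ mdeg m' * (b m' * monomial_at xi m')%:C :> R[i].
  rewrite rmorphM rmorphXn/=; congr (_ ^+ _ * _); apply: complex_ext => //=; ring.
by rewrite !rmorphM/=; ring.
Qed.

(** For [gamma] of even order, [m] and [m'] have the same parity, so the two sums of the definition
    cover all pairs. In the even sum [i^n = (- i)^n], in the odd one [i^(-n) = (- i)^n]; both take
    the form of the coefficients of [|symbol|^2]. *)
Lemma additive_coefE b gamma : ~~ odd (mdeg gamma) -> additive_coef b gamma =
  \sum_(m : index) \sum_(m' : index | mnm_add m m' == gamma)
    'i%C ^+ mdeg m * (- 'i%C) ^+ mdeg m' * (b m * b m')%:C.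
Proof.
move=> even_gamma; rewrite /additive_coef [RHS](bigID (fun m : index => odd (mdeg m)))/= [RHS]addrC.
have i0 : ('i%C : R[i]) != 0 by apply/eqP => -[]/eqP; rewrite oner_eq0.
have iV : ('i%C : R[i])^-1 = - 'i%C.
  by apply: (mulIf i0); rewrite mulVf//; apply: complex_ext => /=; ring.
congr (_ + _); apply: eq_bigr => m odd_m.
- apply: eq_big => m'.
    case: eqP => [E|]; last by rewrite !andbF.
    by rewrite andbT; move: even_gamma; rewrite -E mdegD oddD (negbTE odd_m) addFb.
  move=> /andP[odd_m' _]; rewrite mdegD exprD; congr (_ * _ * _).
  by rewrite [RHS]exprNn -signr_odd (negbTE odd_m') expr0 mul1r.
- apply: eq_big => m'.
    case: eqP => [E|]; last by rewrite !andbF.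
    by rewrite andbT; move: even_gamma; rewrite -E mdegD oddD odd_m addTb negbK.
  move=> /andP[odd_m' _]; congr (_ * _).
  by rewrite expfzDr// -exprnP -exprnN -exprVn iV.
Qed.

End quadratic_polynomials.

Section equivalence.
Variables (R : realType) (d p : nat) (Q : set 'rV[int]_d).
Hypothesis nQ : ~ on_hypersurface R (2 * p) Q.
Implicit Types b : bmultinom d p.+1 -> R.

Lemma multiplicative_equivalence b b' :
  (forall xi, Q xi -> symbol b xi ^+ 2 = symbol b' xi ^+ 2) ->
  equivalent_coefs MultiplicativeNoise b b'.
Proof.
move=> bb' gamma _; apply/eqP; rewrite -subr_eq0 -sumrB; apply/eqP.
rewrite -[RHS](quadratic_coef_complex_eq0 (e := fun m m' =>
  'i%C ^+ (mdeg m + mdeg m') * ((b m * b m')%:C - (b' m * b' m')%:C)) nQ _ gamma).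
  by apply: eq_bigr => m _; rewrite -sumrB; apply: eq_bigr => m' _; rewrite mulrBr.
move=> xi /bb'/eqP.
rewrite !sqr_symbolE -subr_eq0 -sumrB => /eqP E; rewrite -[RHS]E; apply: eq_bigr => m _.
by rewrite -sumrB; apply: eq_bigr => m' _; rewrite mulrBr mulrBl.
Qed.

Lemma additive_equivalence (r : d.-tuple R -> R) b b' :
  (forall xi, Q xi -> normc (symbol b xi) = normc (symbol b' xi)) ->
  equivalent_coefs (AdditiveNoise r) b b'.
Proof.
move=> bb' gamma _ even_gamma; apply/eqP; rewrite !additive_coefE// -subr_eq0 -sumrB; apply/eqP.
rewrite -[RHS](quadratic_coef_complex_eq0 (e := fun m m' =>
  'i%C ^+ mdeg m * (- 'i%C) ^+ mdeg m' * ((b m * b m')%:C - (b' m * b' m')%:C)) nQ _ gamma).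
  by apply: eq_bigr => m _; rewrite -sumrB; apply: eq_bigr => m' _; rewrite mulrBr.
move=> xi /bb' N; have : (normc (symbol b xi) ^+ 2)%:C = (normc (symbol b' xi) ^+ 2)%:C by rewrite N.
move/eqP; rewrite !sqr_normc_symbolE -subr_eq0 -sumrB => /eqP E; rewrite -[RHS]E; apply: eq_bigr => m _.
by rewrite -sumrB; apply: eq_bigr => m' _; rewrite mulrBr mulrBl.
Qed.

End equivalence.

(** Exchanging the two times conjugates the mixed covariance; this reduces the theorem to
    [t1 < t2]. *)
Lemma same_mean_covarianceC (R : realType) (d : measure_display) (Omega : measurableType d)
    (P : probability Omega R) (X1 X2 Y1 Y2 : Omega -> R[i]) :
  cLfun P 2%:E X1 -> cLfun P 2%:E X2 -> cLfun P 2%:E Y1 -> cLfun P 2%:E Y2 ->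
  same_mean_covariance P X1 X2 Y1 Y2 -> same_mean_covariance P X2 X1 Y2 Y1.
Proof.
move=> L1 L2 L1' L2' [m1 m2 c11 c12 c22]; split=> //.
by rewrite (ccovarianceC L1 L2) (ccovarianceC L1' L2') c12.
Qed.

Theorem theorem3p2 (R : realType) (d p2 : nat) (d_gt0 : (0 < d)%N) :
  exists N0 : nat,
  forall (p1 : nat) (disp : measure_display) (Omega : measurableType disp)
    (P : probability Omega R) (F : R -> set (set Omega))
    (W : R -> Omega -> R) (T : R) (nu : noise R d)
    (a : bmultinom d p1.+1 -> R) (u0 : Omega -> d.-tuple R -> R),
  complete_filtration P F -> brownian_motion P F W -> 0 < T ->
  noise_integrable nu -> initial_datum P F u0 ->
  (`I_N0 #<= excited_modes P nu u0)%card ->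
  ~ on_hypersurface R (2 * p2) (excited_modes P nu u0) ->
  forall b b' : bmultinom d p2.+1 -> R,
  exists2 delta : R, 0 < delta &
  forall u u' : R -> Omega -> d.-tuple R -> R,
  strong_solution P F W T nu a b u0 u ->
  strong_solution P F W T nu a b' u0 u' ->
  forall t1 t2 : R, 0 <= t1 <= T -> 0 <= t2 <= T ->
  0 < `|t2 - t1| < delta ->
  (forall xi t, excited_modes P nu u0 xi -> t = t1 \/ t = t2 ->
     cLfun P 2%:E (fun w => fourier (u t w) xi) /\
     cLfun P 2%:E (fun w => fourier (u' t w) xi)) ->
  (forall xi, excited_modes P nu u0 xi ->
     same_mean_covariance P
       (fun w => fourier (u t1 w) xi) (fun w => fourier (u t2 w) xi)
       (fun w => fourier (u' t1 w) xi) (fun w => fourier (u' t2 w) xi)) ->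
  equivalent_coefs nu b b'.
Proof.
exists 0%N => p1 disp Omega P F W T nu a u0 cF bW T0 _ iu0 _ nQ b b'.
(* If all excited modes agree, equivalence holds outright and any [delta] serves. Otherwise the
   separating mode is chosen from [b], [b'] and the data, so that [delta] can be fixed before the
   solutions are given. *)
have [all_eq|] := pselect (forall xi, excited_modes P nu u0 xi ->
    if nu is AdditiveNoise _ then normc (symbol b xi) = normc (symbol b' xi)
    else symbol b xi ^+ 2 = symbol b' xi ^+ 2).
  exists 1 => // u u' _ _ t1 t2 _ _ _ _ _; case: nu nQ all_eq => [r|] nQ all_eq.
    by have h := additive_equivalence nQ r all_eq; exact: h.
  by have h := multiplicative_equivalence nQ all_eq; exact: h.
move=> /existsNP[xi /not_implyP[Qxi neq]].
suff [delta delta0 H] : exists2 delta : R, 0 < delta &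
    forall u u', strong_solution P F W T nu a b u0 u -> strong_solution P F W T nu a b' u0 u' ->
    forall t1 t2, 0 <= t1 -> t1 < t2 -> t2 <= T -> t2 - t1 < delta ->
    cLfun P 2%:E (fun w => fourier (u t1 w) xi) -> cLfun P 2%:E (fun w => fourier (u t2 w) xi) ->
    cLfun P 2%:E (fun w => fourier (u' t1 w) xi) -> cLfun P 2%:E (fun w => fourier (u' t2 w) xi) ->
    ~ same_mean_covariance P
       (fun w => fourier (u t1 w) xi) (fun w => fourier (u t2 w) xi)
       (fun w => fourier (u' t1 w) xi) (fun w => fourier (u' t2 w) xi).
  exists delta => // u u' su su' t1 t2 /andP[t10 t1T] /andP[t20 t2T] /andP[t12 small] L2 /(_ xi Qxi) same.
  have [L1 L1'] := L2 xi t1 Qxi (or_introl erefl); have [L2u L2u'] := L2 xi t2 Qxi (or_intror erefl).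
  case: (ltrgtP t1 t2) => [lt12|lt21|eq12].
  - by case: (H u u' su su' t1 t2) => //; rewrite -(gtr0_norm (x := t2 - t1)) ?subr_gt0.
  - case: (H u u' su su' t2 t1) => //; last exact: same_mean_covarianceC.
    by rewrite -(gtr0_norm (x := t1 - t2)) ?subr_gt0// distrC.
  - by move: t12; rewrite eq12 subrr normr0 ltxx.
case: nu nQ Qxi neq => [r|] nQ Qxi neq.
- have [delta delta0 H] := additive_identification_small cF bW (symbol a xi) T0.
  exists delta => // u u' su su' t1 t2 t10 t12 t2T small L1 L2 L1' L2' same; apply: neq.
  exact: (H _ _ _ _ _ _ _ _ Qxi t10 t12 t2T small (solution_modes su xi) (solution_modes su' xi)).
- have neq' : symbol b xi ^+ 2 != symbol b' xi ^+ 2 by apply/eqP.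
  have [delta delta0 H] := multiplicative_identification cF bW (symbol a xi) T0 neq'.
  have [i1 i2] := initial_mean iu0 xi.
  have ix0 : cintegrable P (fun w => fourier (u0 w) xi) by split; exact/Lfun1_integrable.
  exists delta => // u u' su su' t1 t2 t10 t12 t2T small L1 L2 L1' L2' [e1 e2 _ _ _].
  have m1 := cLfun2_measurable L1; have m2 := cLfun2_measurable L2.
  have m1' := cLfun2_measurable L1'; have m2' := cLfun2_measurable L2'.
  apply: (H _ _ _ t1 t2 (initial_measurable_Re iu0 xi) (initial_measurable_Im iu0 xi) ix0 Qxi
    t10 t12 t2T small (solution_modes su xi) (solution_unique su (xi := xi))
    (solution_modes su' xi) (solution_unique su' (xi := xi))) => //.
Qed.
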